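(* Each of the groups $\mathrm{Diff}_+^{1+AC}(\mathbb{S}^1)$ and $\mathrm{Diff}_+^{1+AC}(I)$ is quasi-isometric to a hyperplane of the Banach space $L^1(I)$.
   Context: $I=[0,1]$, and $\mathbb{S}^1$ is $[0,1]$ with endpoints identified (i.e. $\mathbb{R}/\mathbb{Z}$). For $M\in\{I,\mathbb{S}^1\}$, $\mathrm{Diff}_+^{1+AC}(M)$ is the group (under composition) of orientation-preserving $C^1$ diffeomorphisms of $M$ whose first derivative is absolutely continuous, a Polish group with topology given by the metric $\rho(f,g)=\sup_{x\in M}|f(x)-g(x)|+\sup_{x\in M}|f'(x)-g'(x)|+\int_{M}|f''-g''|$ (for $M=\mathbb{S}^1$, $|f(x)-g(x)|$ denotes distance in $\mathbb{S}^1$). A pseudometric $d$ on a topological group $G$ is maximal if it is continuous, right-invariant, and for every continuous right-invariant pseudometric $\sigma$ on $G$ there are constants $K,C$ with $\sigma\le K\cdot d+C$; any two maximal pseudometrics are quasi-isometrically equivalent. A topological group admitting a maximal pseudometric is said to be quasi-isometric to a metric space $X$ if, equipped with a (equivalently, any) maximal pseudometric, it is quasi-isometric to $X$ in the usual sense. A hyperplane of a Banach space is a closed linear subspace of codimension one, with the norm metric. *)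

(* Defs.v *)
From HB Require Import structures.
From mathcomp Require Import all_boot all_order all_algebra.
From mathcomp Require Import all_classical all_reals all_analysis.
From mathcomp Require Import measurable_realfun ess_sup_inf ring lra.
Set Implicit Arguments. Unset Strict Implicit. Unset Printing Implicit Defensive.
Import Order.TTheory GRing.Theory Num.Theory.
Import numFieldNormedType.Exports.
Local Open Scope classical_set_scope.
Local Open Scope ring_scope.

(* As for the library's PreTopologicalZmodule, continuity of the operations is
   not part of the structure. *)
#[short(type="preTopologicalGroupType")]
HB.structure Definition PreTopologicalGroup := {G of Topological G & Group G}.

Section coarse_geometry.
Context (R : realType).

Record continuous_right_invariant_pseudometric (G : preTopologicalGroupType)
    (d : G -> G -> R) : Prop := {
  crp_ge0 : forall x y, 0 <= d x y ;
  crp_refl : forall x, d x x = 0 ;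
  crp_sym : forall x y, d x y = d y x ;
  crp_triangle : forall x y z, d x z <= d x y + d y z ;
  crp_continuous : continuous (fun xy : G * G => d xy.1 xy.2) ;
  crp_right : forall x y h, d (x * h)%g (y * h)%g = d x y }.

Definition maximal_pseudometric (G : preTopologicalGroupType)
    (d : G -> G -> R) : Prop :=
  continuous_right_invariant_pseudometric d /\
  forall s : G -> G -> R, continuous_right_invariant_pseudometric s ->
    exists K C : R, forall x y, s x y <= K * d x y + C.

Definition quasi_isometric (X Y : Type) (dX : X -> X -> R) (dY : Y -> Y -> R) :
    Prop :=
  exists (phi : X -> Y) (K C : R), [/\ 1 <= K, 0 <= C,
    (forall x x', K^-1 * dX x x' - C <= dY (phi x) (phi x') <= K * dX x x' + C) &
    (forall y, exists x, dY (phi x) y <= C)].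

Definition group_quasi_isometric (G : preTopologicalGroupType) (Y : Type)
    (dY : Y -> Y -> R) : Prop :=
  exists d : G -> G -> R, maximal_pseudometric d /\ quasi_isometric d dY.

(* Codimension one: V = H + <e> for some e outside H. *)
Definition hyperplane (V : normedModType R) (H : set V) : Prop :=
  [/\ closed H, H 0, (forall (a : R) u v, H u -> H v -> H (a *: u + v)) &
    exists2 e, ~ H e & forall v, exists a : R, H (v - a *: e)].

Definition norm_dist (V : normedModType R) (H : set V) (u v : H) : R :=
  `|set_val u - set_val v|.

End coarse_geometry.

Definition abs_cont (R : realType) (a b : R) (f : R -> R) :=
  forall e : R, 0 < e -> exists2 d : R, 0 < d &
    forall (n : nat) (s t : 'I_n -> R),
      (forall i, a <= s i /\ s i <= t i /\ t i <= b) ->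
      (forall i j, i != j -> t i <= s j \/ t j <= s i) ->
      \sum_i (t i - s i) < d -> \sum_i `|f (t i) - f (s i)| < e.

Definition diff_quot (R : realType) (f : R -> R) (x y : R) :=
  (f y - f x) / (y - x).

(* One-sided at the endpoints of D. *)
Definition deriv_within (R : realType) (D : set R) (f : R -> R) (x : R) : R :=
  lim (diff_quot f x @ within D x^').

(* A C^1 bijection with positive derivative is an orientation-preserving C^1
   diffeomorphism. For the lift of a circle map (D = R), whose derivative is
   1-periodic, absolute continuity on all compact intervals amounts to
   absolute continuity on [0, 1]. *)
Record C1AC_diffeo (R : realType) (D : set R) (F : R -> R) := {
  C1AC_bij : set_bij D D F ;
  C1AC_incr : forall x y, D x -> D y -> x < y -> F x < F y ;
  C1AC_derivable : forall x, D x -> cvg (diff_quot F x @ within D x^') ;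
  C1AC_cont : {within D, continuous (deriv_within D F)} ;
  C1AC_pos : forall x, D x -> 0 < deriv_within D F x ;
  C1AC_ac : forall a b, `[a, b] `<=` D -> abs_cont a b (deriv_within D F) }.

Section lift_group.
Context (R : realType) (D : set R).
Hypotheses (intD : is_interval D) (limD : D `<=` limit_point D).
Implicit Types (f g u F G H : R -> R) (x y z l m a b s t : R).

Lemma within_dnbhs_proper x : D x -> ProperFilter (within D x^').
Proof.
move=> Dx; apply: Build_ProperFilter.
move=> /= W; have [y [yx Dy]] := limD Dx W.
by move=> /(_ yx Dy).
Qed.

Lemma derivE F x l : D x -> diff_quot F x @ within D x^' --> l ->
  deriv_within D F x = l.
Proof.
by move=> Dx Fl; have PF := within_dnbhs_proper Dx; exact: cvg_lim.
Qed.

Lemma derivP F x : cvg (diff_quot F x @ within D x^') ->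
  diff_quot F x @ within D x^' --> deriv_within D F x.
Proof. by []. Qed.

Lemma near_within_dnbhs x (P : set R) :
  within D x^' P -> P x -> within D (nbhs x) P.
Proof.
move=> H Px; move: H; rewrite /within /= => H.
apply: (@filterS _ (nbhs x) _ _ _ _ H) => y /= {}H Dy.
by have [->//|yx] := eqVneq y x; exact: H.
Qed.

Lemma within_dnbhsW x (P : set R) :
  nbhs x [set y | y != x -> D y -> P y] -> within D x^' P.
Proof. by rewrite /within /=. Qed.

Lemma derivable_cvg F x l : diff_quot F x @ within D x^' --> l ->
  F y @[y --> within D x^'] --> F x.
Proof.
move=> Fl.
have yx0 : y - x @[y --> within D x^'] --> 0.
  rewrite -(subrr x); apply: cvgB; last exact: cvg_cst.
  by do 2 apply: cvg_within_filter; exact: cvg_id.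
have : F x + diff_quot F x y * (y - x) @[y --> within D x^'] --> F x + l * 0.
  by apply: cvgD; [exact: cvg_cst|exact: cvgM].
rewrite mulr0 addr0; apply: cvg_trans; apply: near_eq_cvg.
apply: within_dnbhsW; apply: (@filterE _ (nbhs _)) => y yx Dy.
by rewrite /diff_quot divfK ?subrKC// subr_eq0.
Qed.

Lemma derivable_cont F x l : diff_quot F x @ within D x^' --> l ->
  F y @[y --> within D (nbhs x)] --> F x.
Proof.
move=> /derivable_cvg Fx U /= FU; apply: (near_within_dnbhs (Fx _ FU)).
exact: (nbhs_singleton FU).
Qed.


Lemma cvg_within_dnbhs G x m : D x -> (forall y, D y -> D (G y)) ->
  {in D &, injective G} -> diff_quot G x @ within D x^' --> m ->
  G @ within D x^' --> within D (G x)^'.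
Proof.
move=> Dx DG injG /derivable_cvg Gx U.
rewrite {1}/within /= => /Gx; rewrite /nbhs/= /within /= => WU.
apply: (@filterS _ (nbhs x) _ _ _ _ WU) => y /= + yx Dy; apply => //.
  by apply: contra_neq yx => /injG; apply; exact: mem_set.
exact: DG.
Qed.

Lemma deriv_comp F G x l m : D x -> (forall y, D y -> D (G y)) ->
  {in D &, injective G} ->
  diff_quot G x @ within D x^' --> m ->
  diff_quot F (G x) @ within D (G x)^' --> l ->
  diff_quot (F \o G) x @ within D x^' --> l * m.
Proof.
move=> Dx DG injG Gm Fl.
have /cvg_comp/(_ Fl) FGl := cvg_within_dnbhs Dx DG injG Gm.
have : diff_quot F (G x) (G y) * diff_quot G x y @[y --> within D x^'] --> l * m.
  exact: cvgM.
apply: cvg_trans; apply: near_eq_cvg.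
apply: within_dnbhsW; apply: (@filterE _ (nbhs _)) => y yx Dy.
rewrite /diff_quot mulrA divfK// subr_eq0.
by apply: contra_neq yx => /injG; apply; exact: mem_set.
Qed.

Lemma inverse_cvg F H y : {in D &, {homo F : x z / x < z}} ->
  (forall z, D z -> D (H z) /\ F (H z) = z) -> D y ->
  H z @[z --> within D (nbhs y)] --> H y.
Proof.
move=> incF HP Dy; apply/cvgrPdist_lt => e e0.
have [DHy FHy] := HP _ Dy.
have inc x z : D x -> D z -> x <= z -> F x <= F z.
  move=> Dx Dz; rewrite le_eqVlt => /predU1P[->//|xz].
  by apply/ltW/incF => //; exact: mem_set.
have up : nbhs y [set z | D z -> H z < H y + e].
  have [De|nDe] := pselect (D (H y + e)); last first.
    apply: (@filterE _ (nbhs y)) => z Dz; rewrite ltNge; apply/negP => ez; apply: nDe.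
    have [DHz _] := HP _ Dz; apply: (intD DHy DHz); rewrite ez andbT.
    by rewrite lerDl ltW.
  have : y < F (H y + e).
    by rewrite -[ltLHS]FHy incF ?ltrDl//; exact: mem_set.
  move=> /lt_nbhsl; apply: filterS => z /= zF Dz; have [DHz FHz] := HP _ Dz.
  rewrite ltNge; apply/negP => /(inc _ _ De DHz); rewrite FHz.
  by rewrite leNgt zF.
have lo : nbhs y [set z | D z -> H y - e < H z].
  have [De|nDe] := pselect (D (H y - e)); last first.
    apply: (@filterE _ (nbhs y)) => z Dz; rewrite ltNge; apply/negP => ez; apply: nDe.
    have [DHz _] := HP _ Dz; apply: (intD DHz DHy); rewrite ez/=.
    by rewrite gerBl ltW.
  have : F (H y - e) < y.
    by rewrite -[ltRHS]FHy incF ?gtrBl//; exact: mem_set.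
  move=> /lt_nbhsr; apply: filterS => z /= zF Dz; have [DHz FHz] := HP _ Dz.
  rewrite ltNge; apply/negP => /(inc _ _ DHz De); rewrite FHz.
  by rewrite leNgt zF.
apply: (@filterS2 _ (nbhs y) _ _ _ _ _ up lo) => z u v Dz.
by rewrite /= distrC ltr_distl u// v.
Qed.

Lemma deriv_inverse F H y l : {in D &, {homo F : x z / x < z}} ->
  (forall z, D z -> D (H z) /\ F (H z) = z) -> D y -> l != 0 ->
  diff_quot F (H y) @ within D (H y)^' --> l ->
  diff_quot H y @ within D y^' --> l^-1.
Proof.
move=> incF HP Dy l0 Fl.
have [DHy FHy] := HP _ Dy.
have Hcvg : H @ within D y^' --> within D (H y)^'.
  move=> U; rewrite {1}/within /= => WU.
  have := inverse_cvg incF HP Dy WU; rewrite /nbhs /= /within /= => {}WU.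
  apply: (@filterS _ (nbhs y) _ _ _ _ WU) => z /= + zy Dz; apply => //.
    by apply: contra_neq zy => /(congr1 F); rewrite FHy (HP _ Dz).2.
  exact: (HP _ Dz).1.
have /cvg_comp/(_ Fl) FHl := Hcvg.
have : (diff_quot F (H y) (H z))^-1 @[z --> within D y^'] --> l^-1.
  exact: cvgV.
apply: cvg_trans; apply: near_eq_cvg.
apply: within_dnbhsW; apply: (@filterE _ (nbhs _)) => z zy Dz.
by rewrite /diff_quot invf_div FHy (HP _ Dz).2.
Qed.


Lemma is_derive_within F x l : nbhs x D ->
  diff_quot F x @ within D x^' --> l -> is_derive x 1 F l.
Proof.
move=> nD Fl.
have hx : h + x @[h --> (0:R)^'] --> within D x^'.
  move=> U; rewrite {1}/within /= => WU.
  have : nbhs x [set y | y != x -> U y].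
    by apply: (@filterS2 _ (nbhs x) _ _ _ _ _ WU nD) => y /= + Dy yx; apply.
  rewrite -[x in nbhs x]add0r => Ux.
  have /(_ _ Ux) : h + x @[h --> (0:R)] --> 0 + x.
    by apply: cvgD; [exact: cvg_id|exact: cvg_cst].
  rewrite /nbhs/= /within/=; apply: (@filterS _ (nbhs (0:R))) => h /= + h0; apply.
  by rewrite -subr_eq0 addrK.
have /cvg_comp/(_ Fl) FHl := hx.
have Fl' : h^-1 *: ((F \o shift x) (h *: 1) - F x) @[h --> 0^'] --> l.
  apply: cvg_trans FHl; apply: near_eq_cvg; apply: nearW => h.
  by rewrite /diff_quot /= addrK scaler1 mulrC.
by apply: DeriveDef; [apply/cvg_ex; exists l|exact: cvg_lim].
Qed.

Definition has_deriv F F' := forall x, D x -> diff_quot F x @ within D x^' --> F' x.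

Lemma lipschitz_within F F' a b : a <= b -> `[a, b] `<=` D -> has_deriv F F' ->
  {within D, continuous F'} -> exists2 K, 0 < K &
  forall s t, a <= s -> s <= t -> t <= b -> `|F t - F s| <= K * (t - s).
Proof.
move=> ab abD FF' cF'.
have : {within `[a, b], continuous (fun x => `|F' x|)}.
  have : {within `[a, b], continuous F'} by exact: continuous_subspaceW cF'.
  move=> /subspace_continuousP c; apply/subspace_continuousP => x /c.
  exact: cvg_norm.
move=> /(EVT_max ab)[c cab cmax].
exists (`|F' c| + 1); first by rewrite ltr_wpDl.
move=> s t as_ st tb.
have [x xst ->] : exists2 x, x \in `[s, t] & F t - F s = F' x * (t - s).
  apply: MVT_segment => //.
    move=> x xst; apply: is_derive_within.
      have := near_in_itvoo xst; apply: filterS => y yst; apply: abD.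
      move: yst; rewrite /= !in_itv/= => /andP[sy yt].
      by rewrite (le_trans as_ (ltW sy)) (le_trans (ltW yt) tb).
    apply: FF'; apply: abD; move: xst; rewrite /= !in_itv/= => /andP[sy yt].
    by rewrite (le_trans as_ (ltW sy)) (le_trans (ltW yt) tb).
  have cD : {within D, continuous F}.
    by apply/subspace_continuousP => x Dx; apply: derivable_cont; exact: FF'.
  apply: continuous_subspaceW cD => y; rewrite /= in_itv/= => /andP[sy yt].
  by apply: abD; rewrite /= in_itv/= (le_trans as_ sy) (le_trans yt tb).
rewrite normrM [`|t - s|]ger0_norm ?subr_ge0// ler_wpM2r ?subr_ge0//.
rewrite (@le_trans _ _ `|F' c|) ?lerDl// cmax//.
move: xst; rewrite !in_itv/= => /andP[sy yt].
by rewrite (le_trans as_ sy) (le_trans yt tb).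
Qed.

End lift_group.

Section abs_cont_theory.
Context (R : realType).
Implicit Types (f g u v G : R -> R) (a b : R).

Lemma abs_cont_gt a b f : b < a -> abs_cont a b f.
Proof.
move=> ba e e0; exists 1 => // n s t st _ _; rewrite big1// => i _.
have [as_ [st' tb]] := st i.
by have := le_trans as_ (le_trans st' tb); rewrite leNgt ba.
Qed.

Lemma eq_abs_cont a b f g : {in `[a, b], f =1 g} ->
  abs_cont a b f -> abs_cont a b g.
Proof.
move=> fg acf e /acf[d d0 H]; exists d => // n s t st no sd.
rewrite (eq_bigr (fun i => `|f (t i) - f (s i)|)); first exact: H.
move=> i _; have [as_ [st' tb]] := st i.
by rewrite !fg// in_itv/= ?as_ ?tb ?(le_trans as_ st')// (le_trans st' tb).
Qed.

Lemma abs_cont_lip a b f K : 0 < K ->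
  (forall s t, a <= s -> s <= t -> t <= b -> `|f t - f s| <= K * (t - s)) ->
  abs_cont a b f.
Proof.
move=> K0 fK e e0; exists (e / K); first exact: divr_gt0.
move=> n s t st _ sd.
apply: le_lt_trans (_ : \sum_i K * (t i - s i) < _).
  by apply: ler_sum => i _; have [? [? ?]] := st i; exact: fK.
by rewrite -mulr_sumr mulrC -ltr_pdivlMr.
Qed.

Lemma abs_cont_comp a b f G : abs_cont (G a) (G b) f -> abs_cont a b G ->
  (forall s t, a <= s -> s <= t -> t <= b -> G s <= G t) ->
  abs_cont a b (f \o G).
Proof.
move=> acf acG incG e /acf[d d0 H]; have [d' d'0 H'] := acG _ d0.
exists d' => // n s t st no sd; apply: (H n (G \o s) (G \o t)).
- move=> i; have [as_ [st' tb]] := st i => /=; split; last split.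
  + by apply: incG => //; exact: le_trans st' tb.
  + exact: incG.
  + by apply: incG => //; exact: le_trans st'.
- move=> i j /no; have [as_ [st' tb]] := st i; have [as' [st2 tb2]] := st j.
  move=> [ts|ts]; [left|right]; apply: incG => //.
  + exact: le_trans as_ st'.
  + exact: le_trans st2 tb2.
  + exact: le_trans as' st2.
  + exact: le_trans st' tb.
- apply: le_lt_trans (H' n s t st no sd); apply: ler_sum => i _.
  exact: ler_norm.
Qed.

Lemma abs_cont_mul a b u v M : 0 < M ->
  {in `[a, b], forall x, `|u x| <= M} -> {in `[a, b], forall x, `|v x| <= M} ->
  abs_cont a b u -> abs_cont a b v -> abs_cont a b (u \* v).
Proof.
move=> M0 uM vM acu acv e e0.
have eM0 : 0 < e / 2 / M by rewrite !divr_gt0.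
have [d d0 Hu] := acu _ eM0; have [d' d'0 Hv] := acv _ eM0.
exists (Num.min d d'); first by rewrite lt_min d0.
move=> n s t st no; rewrite lt_min => /andP[sd sd'].
have /= := ltrD (Hu n s t st no sd) (Hv n s t st no sd').
rewrite -(ltr_pM2l M0) -mulrDl -splitr mulrCA divff ?gt_eqF// mulr1.
apply: le_lt_trans; rewrite -big_split/= mulr_sumr; apply: ler_sum => i _.
have [as_ [st' tb]] := st i.
have -> : u (t i) * v (t i) - u (s i) * v (s i) =
  (u (t i) - u (s i)) * v (t i) + u (s i) * (v (t i) - v (s i)).
  by rewrite mulrBl mulrBr addrA subrK.
rewrite (le_trans (ler_normD _ _))// !normrM mulrDr; apply: lerD.
  by rewrite mulrC ler_wpM2r// vM// in_itv/= tb (le_trans as_ st').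
by rewrite ler_wpM2r// uM// in_itv/= as_ (le_trans st' tb).
Qed.

Lemma abs_cont_inv a b u c : 0 < c -> {in `[a, b], forall x, c <= u x} ->
  abs_cont a b u -> abs_cont a b (fun x => (u x)^-1).
Proof.
move=> c0 cu acu e e0.
have [|d d0 H] := acu (e * (c * c)); first by rewrite !mulr_gt0.
exists d => // n s t st no sd; have := H n s t st no sd.
rewrite -ltr_pdivrMr ?mulr_gt0//; apply: le_lt_trans.
rewrite mulr_suml; apply: ler_sum => i _; have [as_ [st' tb]] := st i.
have ct : c <= u (t i) by rewrite cu// in_itv/= tb (le_trans as_ st').
have cs : c <= u (s i) by rewrite cu// in_itv/= as_ (le_trans st' tb).
have ut := lt_le_trans c0 ct; have us := lt_le_trans c0 cs.
have -> : (u (t i))^-1 - (u (s i))^-1 =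
    (u (s i) - u (t i)) / (u (t i) * u (s i)).
  by field; rewrite !gt_eqF.
rewrite normrM distrC ler_wpM2l// normfV.
rewrite (ger0_norm (mulr_ge0 (ltW ut) (ltW us))).
by rewrite lef_pV2 ?posrE ?mulr_gt0// ler_pM// ltW.
Qed.

End abs_cont_theory.

Section lift_closure.
Context (R : realType) (D : set R).
Hypotheses (intD : is_interval D) (limD : D `<=` limit_point D).
Implicit Types (f g u F G H : R -> R) (x y z l m a b s t : R).

Lemma sub_itv_interval a b : D a -> D b -> `[a, b] `<=` D.
Proof. by move=> Da Db x; rewrite /= in_itv => /= abx; exact: (intD Da Db). Qed.

Lemma C1AC_has_deriv F : C1AC_diffeo D F -> has_deriv D F (deriv_within D F).
Proof. by move=> FD x Dx; exact: (C1AC_derivable FD). Qed.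

Lemma C1AC_maps F x : C1AC_diffeo D F -> D x -> D (F x).
Proof. by move=> /C1AC_bij[DD _ _]; exact: DD. Qed.

Lemma C1AC_inj F : C1AC_diffeo D F -> {in D &, injective F}.
Proof. by move=> /C1AC_bij[_ inj _]. Qed.

Lemma C1AC_mono F : C1AC_diffeo D F -> {in D &, {homo F : x y / x < y}}.
Proof. by move=> /C1AC_incr Fi x y /set_mem Dx /set_mem Dy; exact: Fi. Qed.

Lemma C1AC_within_cont F x : C1AC_diffeo D F -> D x ->
  F @ within D (nbhs x) --> within D (nbhs (F x)).
Proof.
move=> FD Dx U; rewrite {1}/within/= => WU.
have := derivable_cont (C1AC_has_deriv FD Dx) WU.
rewrite /nbhs/= /within/=; apply: (@filterS _ (nbhs x)) => y /= + Dy; apply => //.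
exact: (C1AC_maps FD).
Qed.

Lemma C1AC_mk F (F' : R -> R) : set_bij D D F ->
  (forall x y, D x -> D y -> x < y -> F x < F y) ->
  has_deriv D F F' -> {within D, continuous F'} ->
  (forall x, D x -> 0 < F' x) ->
  (forall a b, `[a, b] `<=` D -> abs_cont a b F') ->
  C1AC_diffeo D F.
Proof.
move=> bF iF FF' cF' pF' aF'.
have E x : D x -> deriv_within D F x = F' x.
  by move=> Dx; apply: derivE => //; exact: FF'.
split=> //.
- by move=> x Dx; apply/cvg_ex; exists (F' x); exact: FF'.
- apply: (@subspace_eq_continuous _ D _ F') cF' => x /set_mem Dx.
  exact/esym/E.
- by move=> x Dx; rewrite E// pF'.
- move=> a b abD; apply: eq_abs_cont (aF' _ _ abD) => x xab.
  by apply/esym/E; exact: abD.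
Qed.

Lemma bounded_within u a b : a <= b -> `[a, b] `<=` D ->
  {within D, continuous u} ->
  exists2 M, 0 < M & {in `[a, b], forall x, `|u x| <= M}.
Proof.
move=> ab abD cu.
have : {within `[a, b], continuous (fun x => `|u x|)}.
  have : {within `[a, b], continuous u} by exact: continuous_subspaceW cu.
  move=> /subspace_continuousP c; apply/subspace_continuousP => x /c.
  exact: cvg_norm.
move=> /(EVT_max ab)[c _ cmax]; exists (`|u c| + 1); first by rewrite ltr_wpDl.
by move=> x xab; rewrite (le_trans (cmax _ xab))// lerDl.
Qed.

Lemma C1AC_abs_cont F a b : C1AC_diffeo D F -> `[a, b] `<=` D ->
  abs_cont a b F.
Proof.
move=> FD abD; have [ab|] := leP a b; last exact: abs_cont_gt.
have [K K0] := lipschitz_within ab abD (C1AC_has_deriv FD) (C1AC_cont FD).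
exact: abs_cont_lip.
Qed.

Lemma C1AC_nd F a b : C1AC_diffeo D F -> `[a, b] `<=` D ->
  forall s t, a <= s -> s <= t -> t <= b -> F s <= F t.
Proof.
move=> FD abD s t as_; rewrite le_eqVlt => /predU1P[->//|st] tb.
apply/ltW/(C1AC_incr FD) => //; apply: abD; rewrite /= in_itv/=.
  by rewrite as_ (le_trans (ltW st) tb).
by rewrite tb (le_trans as_ (ltW st)).
Qed.

Lemma endpoints a b : a <= b -> `[a, b] `<=` D -> D a /\ D b.
Proof. by move=> ab abD; split; apply: abD; rewrite /= in_itv/= lexx ab. Qed.

Lemma C1AC_id : C1AC_diffeo D id.
Proof.
apply: (@C1AC_mk _ (cst 1)) => //.
- split=> //; by move=> x Dx; exists x.
- move=> x Dx.
  have : (fun=> 1) @ within D x^' --> (1 : R) by exact: cvg_cst.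
  apply: cvg_trans; apply: near_eq_cvg; apply: within_dnbhsW; apply: (@filterE _ (nbhs _)) => y yx Dy.
  by rewrite /diff_quot divff// subr_eq0.
- by apply/subspace_continuousP => x Dx; exact: cvg_cst.
- move=> a b _; apply: (@abs_cont_lip _ _ _ _ 1) => // s t _ st _.
  by rewrite subrr normr0 mul1r subr_ge0.
Qed.

Lemma C1AC_comp F G : C1AC_diffeo D F -> C1AC_diffeo D G ->
  C1AC_diffeo D (F \o G).
Proof.
move=> FD GD.
have cFG : {within D, continuous (deriv_within D F \o G)}.
  apply/subspace_continuousP => x Dx.
  have /subspace_continuousP/(_ _ (C1AC_maps GD Dx)) := C1AC_cont FD.
  exact: cvg_comp (C1AC_within_cont GD Dx).
apply: (@C1AC_mk _ ((deriv_within D F \o G) \* deriv_within D G)).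
- exact: set_bij_comp (C1AC_bij GD) (C1AC_bij FD).
- move=> x y Dx Dy xy /=.
  by apply: (C1AC_incr FD); [exact: C1AC_maps..|exact: (C1AC_incr GD)].
- move=> x Dx; apply: deriv_comp => //.
  + by move=> y; exact: C1AC_maps.
  + exact: C1AC_inj.
  + exact: C1AC_has_deriv.
  + by apply: C1AC_has_deriv => //; exact: C1AC_maps.
- apply/subspace_continuousP => x Dx; apply: cvgM.
    by have /subspace_continuousP := cFG; exact.
  by have /subspace_continuousP := C1AC_cont GD; exact.
- by move=> x Dx /=; rewrite mulr_gt0 ?C1AC_pos//; exact: C1AC_maps.
- move=> a b abD; have [ab|] := leP a b; last exact: abs_cont_gt.
  have [Da Db] := endpoints ab abD.
  have [M M0 uM] := bounded_within ab abD cFG.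
  have [N N0 vN] := bounded_within ab abD (C1AC_cont GD).
  apply: (@abs_cont_mul _ _ _ _ _ (M + N)); first exact: addr_gt0.
  + by move=> x /uM /le_trans; apply; rewrite lerDl ltW.
  + by move=> x /vN /le_trans; apply; rewrite lerDr ltW.
  + apply: abs_cont_comp (C1AC_abs_cont GD abD) (C1AC_nd GD abD).
    by apply: (C1AC_ac FD); apply: sub_itv_interval; exact: C1AC_maps.
  + exact: (C1AC_ac GD).
Qed.

Lemma C1AC_inverse F : C1AC_diffeo D F ->
  exists2 H, C1AC_diffeo D H & forall y, D y -> F (H y) = y.
Proof.
move=> FD.
have /choice[H HP] : forall y, exists x, D y -> D x /\ F x = y.
  move=> y; have [Dy|] := pselect (D y); last by exists 0.
  by have [_ _ /(_ _ Dy)[x Dx <-]] := C1AC_bij FD; exists x.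
exists H => [|y /HP[]//].
have FK x : D x -> H (F x) = x.
  move=> Dx; have [DH FH] := HP _ (C1AC_maps FD Dx).
  by apply: (C1AC_inj FD) => //; exact: mem_set.
have inc : {in D &, {homo F : x y / x < y}} by exact: C1AC_mono.
have Hinc x y : D x -> D y -> x < y -> H x < H y.
  move=> Dx Dy xy; rewrite ltNge; apply/negP; rewrite le_eqVlt.
  have [DHx FHx] := HP _ Dx; have [DHy FHy] := HP _ Dy.
  move=> /predU1P[Hyx|/(inc _ _ (mem_set DHy) (mem_set DHx))].
    by move: xy; rewrite -FHx -FHy Hyx ltxx.
  by rewrite FHx FHy ltNge (ltW xy).
pose F' := deriv_within D F.
have HH' : has_deriv D H (fun y => (F' (H y))^-1).
  move=> y Dy; apply: (deriv_inverse intD inc HP Dy).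
    by rewrite gt_eqF// (C1AC_pos FD)//; exact: (HP _ Dy).1.
  by apply: C1AC_has_deriv => //; exact: (HP _ Dy).1.
have cFH : {within D, continuous (F' \o H)}.
  apply/subspace_continuousP => y Dy.
  have /subspace_continuousP/(_ _ (HP _ Dy).1) := C1AC_cont FD.
  apply: cvg_comp => U; rewrite {1}/within/= => WU.
  have := inverse_cvg intD inc HP Dy WU.
  rewrite /nbhs/= /within/=; apply: (@filterS _ (nbhs y)) => z /= + Dz; apply => //.
  exact: (HP _ Dz).1.
have cH' : {within D, continuous (fun y => (F' (H y))^-1)}.
  apply/subspace_continuousP => y Dy; apply: cvgV.
    by rewrite gt_eqF// (C1AC_pos FD)//; exact: (HP _ Dy).1.
  by have /subspace_continuousP := cFH; exact.
apply: (@C1AC_mk _ (fun y => (F' (H y))^-1)) => //.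
- split.
  + by move=> y /HP[].
  + by move=> y z /set_mem/HP[_ Fy] /set_mem/HP[_ Fz] Hyz; rewrite -Fy -Fz Hyz.
  + move=> x Dx; exists (F x); first exact: C1AC_maps.
    exact: FK.
- by move=> y Dy; rewrite invr_gt0 (C1AC_pos FD)//; exact: (HP _ Dy).1.
- move=> a b abD; have [ab|] := leP a b; last exact: abs_cont_gt.
  have [Da Db] := endpoints ab abD.
  have [K K0 HK] := lipschitz_within ab abD HH' cH'.
  have cab : {within `[a, b], continuous (F' \o H)}.
    exact: continuous_subspaceW cFH.
  have [c cab' cmin] := EVT_min ab cab.
  apply: (@abs_cont_inv _ _ _ (F' \o H) (F' (H c))) => //.
    by rewrite (C1AC_pos FD)//; apply: (HP _ _).1; exact: abD.
  apply: abs_cont_comp (abs_cont_lip K0 HK) _.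
    by apply: (C1AC_ac FD); apply: sub_itv_interval; apply: (HP _ _).1.
  move=> s t as_; rewrite le_eqVlt => /predU1P[->//|st] tb.
  apply/ltW/Hinc => //; apply: abD; rewrite /= in_itv/=.
    by rewrite as_ (le_trans (ltW st) tb).
  by rewrite tb (le_trans as_ (ltW st)).
Qed.

End lift_closure.


(* [par] restricted to the interval [dom] is the universal covering of the
   curve, and restricted to [0, 1] it is the arc-length parametrization: the
   identity of I, resp. the projection R -> R/Z. *)
Record curve (R : realType) := Curve {
  pt : Type ;
  dom : set R ;
  par : R -> pt ;
  dist : pt -> pt -> R ;
  dom_itv : is_interval dom ;
  dom_lim : dom `<=` limit_point dom }.

Section unit_interval.
Context (R : realType).

Definition I_pt := {x : R | x \in `[0, 1]}.

Lemma I_pt0 : (0 : R) \in `[0, 1].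
Proof. by rewrite in_itv/= lexx ler01. Qed.

(* The identity on [0, 1]; the values elsewhere are irrelevant. *)
Definition I_par (x : R) : I_pt := insubd (exist _ 0 I_pt0 : I_pt) x.

Definition I_dist (x y : I_pt) : R := `|val x - val y|.

Lemma I_dom_itv : is_interval (`[0, 1]%classic : set R).
Proof. exact: interval_is_interval. Qed.

Lemma I_dom_lim : (`[0, 1]%classic : set R) `<=` limit_point (`[0, 1]%classic : set R).
Proof.
move=> x /=; rewrite in_itv/= => /andP[x0 x1] U /nbhs_ballP[e /= e0 eU].
have [xh|xh] := leP x 2^-1.
  pose t := Num.min (e / 2) 2^-1.
  have t0 : 0 < t by rewrite lt_min divr_gt0//= invr_gt0 ltr0n.
  have te : t < e by rewrite /t gt_min; apply/orP; left; lra.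
  have th : t <= 2^-1 by rewrite /t ge_min lexx orbT.
  exists (x + t); split.
  - by rewrite gt_eqF// ltrDl.
  - by rewrite /= in_itv/=; apply/andP; split; lra.
  - by apply: eU; rewrite /ball/= opprD addNKr normrN gtr0_norm.
pose t := Num.min (e / 2) 2^-1.
have t0 : 0 < t by rewrite lt_min divr_gt0//= invr_gt0 ltr0n.
have te : t < e by rewrite /t gt_min; apply/orP; left; lra.
have th : t <= 2^-1 by rewrite /t ge_min lexx orbT.
exists (x - t); split.
- by rewrite lt_eqF// gtrBl.
- by rewrite /= in_itv/=; apply/andP; split; lra.
- by apply: eU; rewrite /ball/= subKr gtr0_norm.
Qed.

Definition interval_curve : curve R := Curve I_par I_dist I_dom_itv I_dom_lim.

End unit_interval.

Section circle.
Context (R : realType).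
Local Open Scope quotient_scope.

Definition int_congruent (x y : R) : bool := (x - y) \is a Num.int.

Lemma int_congruent_refl : reflexive int_congruent.
Proof. by move=> x; rewrite /int_congruent subrr rpred0. Qed.

Lemma int_congruent_sym : symmetric int_congruent.
Proof. by move=> x y; rewrite /int_congruent -opprB rpredN. Qed.

Lemma int_congruent_trans : transitive int_congruent.
Proof.
move=> y x z xy yz; rewrite /int_congruent -(subrKA y); exact: rpredD.
Qed.

Canonical int_congruent_equiv := EquivRel int_congruent
  int_congruent_refl int_congruent_sym int_congruent_trans.

Definition S1_pt := {eq_quot int_congruent}.

Definition S1_par (x : R) : S1_pt := \pi x.

Definition S1_dist (x y : S1_pt) : R :=
  inf [set `|repr x - repr y + k%:~R| | k in [set: int]].

Lemma S1_dom_itv : is_interval [set: R].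
Proof. by []. Qed.

Lemma S1_dom_lim : [set: R] `<=` limit_point [set: R].
Proof.
move=> x _ U /nbhs_ballP[e /= e0 eU]; exists (x + e / 2); split=> //.
  by rewrite gt_eqF// ltrDl divr_gt0.
apply: eU; rewrite /ball/= opprD addNKr normrN gtr0_norm ?divr_gt0//; lra.
Qed.

Definition circle_curve : curve R := Curve S1_par S1_dist S1_dom_itv S1_dom_lim.

End circle.

Section Diff.
Context (R : realType) (M : curve R).
Local Notation D := (dom M).

Definition is_lift (F : R -> R) (f : pt M -> pt M) : Prop :=
  forall x, D x -> f (par M x) = par M (F x).

(* On the circle, bijectivity of f forces F (x + 1) = F x + 1. *)
Definition is_diff1AC (f : pt M -> pt M) : Prop :=
  bijective f /\ exists F, C1AC_diffeo D F /\ is_lift F f.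

Record Diff := MkDiff { diff_fun :> pt M -> pt M ; diffP : is_diff1AC diff_fun }.

HB.instance Definition _ := gen_eqMixin Diff.
HB.instance Definition _ := gen_choiceMixin Diff.

Lemma Diff_ext (f g : Diff) : f =1 g -> f = g.
Proof.
case: f g => [f fP] [g gP] /= /funext fg.
by subst g; rewrite (Prop_irrelevance fP gP).
Qed.

Lemma is_diff_id : is_diff1AC id.
Proof.
split; first by exists id.
by exists id; split=> //; apply: C1AC_id; exact: dom_lim.
Qed.

Lemma is_diff_comp (f g : Diff) : is_diff1AC (f \o g).
Proof.
have [bf [F [FD Ff]]] := diffP f; have [bg [G [GD Gg]]] := diffP g.
split; first exact: bij_comp.
exists (F \o G); split.
  by apply: C1AC_comp => //; [exact: dom_itv|exact: dom_lim].
by move=> x Dx /=; rewrite Gg// Ff//; exact: C1AC_maps GD Dx.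
Qed.

Lemma Diff_inverse (f : Diff) : exists g : Diff, cancel f g /\ cancel g f.
Proof.
have [[g fg gf] [F [FD Ff]]] := diffP f.
suff gP : is_diff1AC g by exists (MkDiff gP).
split; first by exists f.
have [H HD HF] := C1AC_inverse (@dom_itv _ M) (@dom_lim _ M) FD.
exists H; split=> // x Dx.
rewrite -{1}(HF _ Dx) -Ff ?fg//; exact: C1AC_maps HD Dx.
Qed.

Definition Diff_one : Diff := MkDiff is_diff_id.
Definition Diff_mul (f g : Diff) : Diff := MkDiff (is_diff_comp f g).
Definition Diff_inv (f : Diff) : Diff := projT1 (cid (Diff_inverse f)).

Lemma Diff_mulA : associative Diff_mul.
Proof. by move=> f g h; exact: Diff_ext. Qed.

Lemma Diff_mul1 : left_id Diff_one Diff_mul.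
Proof. by move=> f; exact: Diff_ext. Qed.

Lemma Diff_mulr1 : right_id Diff_one Diff_mul.
Proof. by move=> f; exact: Diff_ext. Qed.

Lemma Diff_mulV : left_inverse Diff_one Diff_inv Diff_mul.
Proof.
by move=> f; apply: Diff_ext => x /=; rewrite /Diff_inv; case: cid => g []/= fg ?; exact: fg.
Qed.

Lemma Diff_mulrV : right_inverse Diff_one Diff_inv Diff_mul.
Proof.
by move=> f; apply: Diff_ext => x /=; rewrite /Diff_inv; case: cid => g []/= ? gf; exact: gf.
Qed.

HB.instance Definition _ := isGroup.Build Diff
  Diff_mulA Diff_mul1 Diff_mulr1 Diff_mulV Diff_mulrV.

(* Two lifts of f have the same derivative (on the circle they differ by an
   integer), so the choice of the lift is irrelevant. *)
Definition Diff_lift (f : Diff) : R -> R := projT1 (cid (diffP f).2).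

Definition Diff_deriv (f : Diff) : R -> R := deriv_within D (Diff_lift f).

(* f'' exists almost everywhere; elsewhere the value of [lim] is junk. *)
Definition Diff_deriv2 (f : Diff) : R -> R := deriv_within D (Diff_deriv f).

(* Extended-real valued, so that suprema and integrals need no finiteness proof
   at this point. *)
Definition Diff_rho (f g : Diff) : \bar R :=
  (ereal_sup [set (dist (f x) (g x))%:E | x in [set: pt M]]
   + ereal_sup [set `|Diff_deriv f x - Diff_deriv g x|%:E | x in `[0%R, 1%R]]
   + \int[lebesgue_measure]_(x in `[0%R, 1%R])
       `|Diff_deriv2 f x - Diff_deriv2 g x|%:E)%E.

(* The topology of the metric Diff_rho. *)
Definition Diff_open (A : set Diff) : Prop :=
  forall f, A f -> exists2 e : R, 0 < e &
    forall g, (Diff_rho f g < e%:E)%E -> A g.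

Lemma Diff_openT : Diff_open setT.
Proof. by move=> f _; exists 1. Qed.

Lemma Diff_openI : setI_closed Diff_open.
Proof.
move=> A B oA oB f [/oA[e e0 eA] /oB[e' e'0 eB]].
exists (Num.min e e'); first by rewrite lt_min e0.
move=> g; rewrite EFin_min lt_min => /andP[ge ge'].
by split; [exact: eA|exact: eB].
Qed.

Lemma Diff_open_bigcup (I : Type) (A : I -> set Diff) :
  (forall i, Diff_open (A i)) -> Diff_open (\bigcup_i A i).
Proof.
move=> oA f [i _ /oA[e e0 eA]]; exists e => // g /eA Ag; by exists i.
Qed.

HB.instance Definition _ :=
  isOpenTopological.Build Diff Diff_openT Diff_openI Diff_open_bigcup.

End Diff.

(* The library's L^p spaces come without algebraic structure: they are made
   into normed modules here. *)
Section Lspace_normed.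
Context d (T : measurableType d) (R : realType).
Variables (mu : {measure set T -> \bar R}) (p : \bar R) (p1 : (1 <= p)%E).
Local Notation V := (LspaceType mu p1).
Implicit Types (u v w : V) (f g : T -> R).

HB.instance Definition _ := gen_eqMixin V.
HB.instance Definition _ := gen_choiceMixin V.

Definition Lrepr u : T -> R := u.

Lemma Lspace_eq u v : Lrepr u = Lrepr v %[ae mu] -> u = v.
Proof.
move=> uv.
have : (LebesgueSpace.sort u) = (LebesgueSpace.sort v).
  by apply/eqP; rewrite -(reprK (LebesgueSpace.sort u)) -(reprK (LebesgueSpace.sort v));
    rewrite eqmodE; apply/asboolP.
case: u v uv => [u [[pu]]] [v [[pv]]] /= _ uv.
by subst v; rewrite (Prop_irrelevance pu pv).
Qed.

Lemma Lrepr_Lfun u : Lrepr u \in Lfun mu p.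
Proof.
apply/andP; split; rewrite inE/=.
  exact: (@measurable_funPT _ _ _ _ (repr (LebesgueSpace.sort u))).
exact: Lebesgue_finite.
Qed.

Lemma ae_eq_Lnorm f g : measurable_fun setT f -> measurable_fun setT g ->
  f = g %[ae mu] -> 'N[mu]_p[EFin \o f]%E = 'N[mu]_p[EFin \o g]%E.
Proof.
move=> mf mg fg; rewrite unlock; case: p p1 => [r r1|_|//].
- have mp (h : T -> R) : measurable_fun setT h ->
      measurable_fun [set: T] (fun x => `|(EFin \o h) x| `^ r)%E.
    move=> mh; apply: (@measurableT_comp _ _ _ _ _ _ (fun x => x `^ r)%E) => //=.
      exact: measurable_poweR.
    by apply: measurableT_comp => //=; apply: measurableT_comp => //.
  congr (_ `^ _)%E; apply: ge0_ae_eq_integral => //; [exact: mp|exact: mp|..].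
  + by move=> x _; exact: poweR_ge0.
  + by move=> x _; exact: poweR_ge0.
  + by apply: filterS fg => x /(_ I) /= ->.
- case: ifP => // _; apply: eq_ess_sup.
  by apply: filterS fg => x /(_ I) /= ->.
Qed.

Section Lclass.
Variables (f : T -> R) (fL : f \in Lfun mu p).

Let fm : {mfun T >-> measurableTypeR R} :=
  @mfun_Sub _ _ T (measurableTypeR R) f (sub_Lfun_mfun fL).
Let qf : {mfun_ mu, T >-> measurableTypeR R} := (\pi_({mfun_ mu, T >-> measurableTypeR R}) fm)%qT.

Let qfE : (qf : T -> R) = f %[ae mu].
Proof.
have : (repr qf == fm %[mod {mfun_ mu, T >-> measurableTypeR R}])%qT.
  by rewrite reprK.
by rewrite eqmodE => /asboolP.
Qed.

Let qf_fin : finite_norm mu p qf.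
Proof.
have /andP[/[!inE]/= mf ff] := fL.
rewrite /finite_norm (@ae_eq_Lnorm _ f)//.
exact: (@measurable_funPT _ _ _ _ (repr qf)).
Qed.

Definition Lclass : V :=
  LebesgueSpace.Pack (LebesgueSpace.Class (isFinLebesgue.Build _ _ _ mu p p1 qf qf_fin)).

Lemma LclassE : Lrepr Lclass = f %[ae mu].
Proof. exact: qfE. Qed.

End Lclass.


Lemma Lfun0 : (0 : T -> R) \in Lfun mu p.
Proof. by have [] := Lfun_submod_closed mu p1. Qed.

Lemma LfunZD a f g : f \in Lfun mu p -> g \in Lfun mu p -> a *: f + g \in Lfun mu p.
Proof. by have [_] := Lfun_submod_closed mu p1; apply. Qed.

Lemma LfunD f g : f \in Lfun mu p -> g \in Lfun mu p -> f + g \in Lfun mu p.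
Proof. by move=> fL gL; rewrite -[f]scale1r LfunZD. Qed.

Lemma LfunZ a f : f \in Lfun mu p -> a *: f \in Lfun mu p.
Proof. by move=> fL; rewrite -[_ *: _]addr0 LfunZD// Lfun0. Qed.

Lemma LfunN f : f \in Lfun mu p -> - f \in Lfun mu p.
Proof. by move=> fL; rewrite -scaleN1r LfunZ. Qed.

Definition Lspace0 : V := Lclass Lfun0.
Definition LspaceN u : V := Lclass (LfunN (Lrepr_Lfun u)).
Definition LspaceD u v : V := Lclass (LfunD (Lrepr_Lfun u) (Lrepr_Lfun v)).
Definition LspaceZ (a : R) u : V := Lclass (LfunZ a (Lrepr_Lfun u)).
Definition Lspace_norm u : R := fine 'N[mu]_p[EFin \o Lrepr u]%E.


Lemma Lspace0E : \forall x \ae mu, Lrepr Lspace0 x = 0.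
Proof. by apply: filterS (LclassE Lfun0) => x ->. Qed.

Lemma LspaceNE u : \forall x \ae mu, Lrepr (LspaceN u) x = - Lrepr u x.
Proof. by apply: filterS (LclassE (LfunN (Lrepr_Lfun u))) => x ->. Qed.

Lemma LspaceDE u v :
  \forall x \ae mu, Lrepr (LspaceD u v) x = Lrepr u x + Lrepr v x.
Proof.
by apply: filterS (LclassE (LfunD (Lrepr_Lfun u) (Lrepr_Lfun v))) => x ->.
Qed.

Lemma LspaceZE a u : \forall x \ae mu, Lrepr (LspaceZ a u) x = a * Lrepr u x.
Proof. by apply: filterS (LclassE (LfunZ a (Lrepr_Lfun u))) => x ->. Qed.

Let LspaceDA : associative LspaceD.
Proof.
move=> u v w; apply: Lspace_eq.
apply: filterS2 (filterI (LspaceDE u (LspaceD v w)) (LspaceDE v w))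
  (filterI (LspaceDE (LspaceD u v) w) (LspaceDE u v)) => x.
by move=> [-> ->] [-> ->] _; rewrite addrA.
Qed.

Let LspaceDC : commutative LspaceD.
Proof.
move=> u v; apply: Lspace_eq.
by apply: filterS2 (LspaceDE u v) (LspaceDE v u) => x -> -> _; rewrite addrC.
Qed.

Let Lspace0D : left_id Lspace0 LspaceD.
Proof.
move=> u; apply: Lspace_eq.
by apply: filterS2 (LspaceDE Lspace0 u) Lspace0E => x -> -> _; rewrite add0r.
Qed.

Let LspaceND : left_inverse Lspace0 LspaceN LspaceD.
Proof.
move=> u; apply: Lspace_eq.
apply: filterS3 (LspaceDE (LspaceN u) u) (LspaceNE u) Lspace0E => x -> -> -> _.
by rewrite addNr.
Qed.

HB.instance Definition _ :=
  GRing.isZmodule.Build V LspaceDA LspaceDC Lspace0D LspaceND.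

Let LspaceZA a b u : LspaceZ a (LspaceZ b u) = LspaceZ (a * b) u.
Proof.
apply: Lspace_eq; apply: filterS3 (LspaceZE a (LspaceZ b u)) (LspaceZE b u)
  (LspaceZE (a * b) u) => x -> -> -> _.
by rewrite mulrA.
Qed.

Let Lspace1Z : left_id 1 LspaceZ.
Proof.
move=> u; apply: Lspace_eq.
by apply: filterS (LspaceZE 1 u) => x -> _; rewrite mul1r.
Qed.

Let LspaceZDr : right_distributive LspaceZ +%R.
Proof.
move=> a u v; apply: Lspace_eq.
apply: filterS2
  (filterI (LspaceZE a (LspaceD u v)) (LspaceDE u v))
  (filterI (LspaceDE (LspaceZ a u) (LspaceZ a v))
    (filterI (LspaceZE a u) (LspaceZE a v))) => x.
by move=> [-> ->] [-> [-> ->]] _; rewrite mulrDr.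
Qed.

Let LspaceZDl u : {morph LspaceZ^~ u : a b / a + b}.
Proof.
move=> a b; apply: Lspace_eq.
apply: filterS2 (LspaceZE (a + b) u)
  (filterI (LspaceDE (LspaceZ a u) (LspaceZ b u))
    (filterI (LspaceZE a u) (LspaceZE b u))) => x.
by move=> -> [-> [-> ->]] _; rewrite mulrDl.
Qed.

HB.instance Definition _ := GRing.Zmodule_isLmodule.Build R V
  LspaceZA Lspace1Z LspaceZDr LspaceZDl.

Let Lfun_repr u : LfunType mu p1 := Lfun_Sub p1 (Lrepr_Lfun u).

Let Lspace_normE u f : f \in Lfun mu p -> Lrepr u = f %[ae mu] ->
  Lspace_norm u = fine 'N[mu]_p[EFin \o f]%E.
Proof.
move=> /andP[/[!inE]/= mf _] uf; rewrite /Lspace_norm (@ae_eq_Lnorm _ f)//.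
by have /andP[/[!inE]] := Lrepr_Lfun u.
Qed.

Let ler_Lspace_normD u v :
  Lspace_norm (u + v) <= Lspace_norm u + Lspace_norm v.
Proof.
rewrite (@Lspace_normE _ (Lrepr u + Lrepr v)).
- exact: (ler_LnormD (Lfun_repr u) (Lfun_repr v)).
- exact: LfunD (Lrepr_Lfun u) (Lrepr_Lfun v).
- by apply: filterS (LspaceDE u v) => x -> _.
Qed.

Let Lspace_normZ a u : Lspace_norm (a *: u) = `|a| * Lspace_norm u.
Proof.
rewrite (@Lspace_normE _ (a *: Lrepr u)).
- have := LnormZ (Lfun_repr u) a; rewrite -finite_norm_fine -EFinM => ->.
  by [].
- exact: LfunZ (Lrepr_Lfun u).
- by apply: filterS (LspaceZE a u) => x -> _.
Qed.

Let Lspace_norm0_eq0 u : Lspace_norm u = 0 -> u = 0.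
Proof.
move=> /(@fine_Lnormr_eq0 _ _ _ _ _ _ (Lfun_repr u)) u0; apply: Lspace_eq.
by apply: filterS2 u0 Lspace0E => x /(_ I) + -> _.
Qed.

HB.instance Definition _ := Lmodule_isNormed.Build R V
  ler_Lspace_normD Lspace_normZ Lspace_norm0_eq0.

End Lspace_normed.


Definition L1I (R : realType) : normedModType R :=
  LspaceType1 (mrestr (@lebesgue_measure R)
    (measurable_itv `[0%R, 1%R] : measurable (`[0, 1]%classic : set (measurableTypeR R)))).

(* Main.v *)
(* For a diffeomorphism f, the function ln f' is absolutely continuous. The total variation on
   [0, 1] of ln f' - ln g' is a right-invariant pseudometric d(f, g), because
   ln (f h)' = (ln f') o h + ln h' and total variation is invariant under reparametrization;
   it is continuous because the integral of |f'' - g''| is the total variation of f' - g'.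
   It is maximal: after composing f with a rotation, which changes any continuous
   right-invariant pseudometric by a bounded amount, f is joined to the identity by the
   diffeomorphisms whose logarithmic derivatives are (k / n) ln f' up to additive
   constants, and n steps of bounded size suffice when n is of order d(f, id). Since d(f, g)
   is also the L1 distance of the densities of ln f' and ln g', mapping f to the density of
   ln f' is an isometry onto the functions of integral 0 for the circle, and onto all of
   L1(I) for the interval. The latter is isomorphic to a hyperplane: move the mass of a
   function on the dyadic shell (2^-(n+1), 2^-n] to the next shell. *)
Require Import Defs.
From HB Require Import structures.
From mathcomp Require Import all_boot all_order all_algebra.
From mathcomp Require Import all_classical all_reals all_analysis.
From mathcomp Require Import measurable_realfun ess_sup_inf ring lra.
Set Implicit Arguments.
Unset Strict Implicit.
Unset Printing Implicit Defensive.
Import Order.TTheory GRing.Theory Num.Theory.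
Import numFieldNormedType.Exports.
Local Open Scope classical_set_scope.
Local Open Scope ring_scope.

(** * Densities of absolutely continuous functions *)

(** Small [log_dist] alone does not mean closeness in the topology of the group: rotations lie at
    [log_dist] 0 from the identity. Domination is therefore proved first for [based]
    diffeomorphisms, whose lift fixes 0 and 1. For such an [h] the mean value theorem gives a point
    where the derivative is 1, so the variation of [ln h'] bounds [ln h'] itself, and then [h' - 1]
    and [h - id]. Right-invariance replaces a pair [f], [g] by [f * g^-1] and 1, so that
    neighbourhoods of 1 suffice. The analytic obstacle is [Diff_deriv2], a pointwise [lim] whose
    measurability is not at hand. Densities come from Radon-Nikodym instead, are identified with
    that [lim] almost everywhere, and the integrals are compared by lemmas valid for arbitrary
    nonnegative functions. Both hyperplanes are kernels of the integral over []s, 1]]: [s = 0] for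
    the circle, and [s = 1/2], the first shell, for the interval. Moving mass adds to a function a
    step function of at most twice its norm, in both directions; hence the constant 3 = 1 + 2 of the
    quasi-isometry, whose additive constant is 0. *)

Section dyadic_cells.
Context {R : realType}.
Implicit Types (x : R) (N k : nat) (U : set R).

(** Cells are half-open on the left because a Stieltjes measure gives []a, b]] the increment of its
    cumulative function. *)
Definition dyadic_cell N k : set R := `]k%:R / 2 ^+ N, k.+1%:R / 2 ^+ N]%classic.

(** An inner approximation of an open set by finitely many disjoint intervals: [abs_cont] speaks of
    finite families only. *)
Definition dyadic_inner N U : set R :=
  \big[setU/set0]_(k < 2 ^ N | `[< dyadic_cell N k `<=` U >]) dyadic_cell N k.

Lemma dyadic_cellE N k x :
  dyadic_cell N k x <-> k%:R < x * 2 ^+ N /\ x * 2 ^+ N <= k.+1%:R.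
Proof.
rewrite /dyadic_cell /= in_itv/= ltr_pdivrMr ?exprn_gt0// ler_pdivlMr ?exprn_gt0//.
by split=> [/andP[]|[-> ->]].
Qed.

Lemma dyadic_cell_exists N x : 0 < x -> x <= 1 ->
  exists2 k, (k < 2 ^ N)%N & dyadic_cell N k x.
Proof.
move=> x0 x1; have y0 : 0 < x * 2 ^+ N by rewrite mulr_gt0 ?exprn_gt0.
have y1 : x * 2 ^+ N <= (2 ^ N)%:R by rewrite natrX ler_piMl ?exprn_ge0.
have ex : exists k, x * 2 ^+ N <= k.+1%:R.
  exists (2 ^ N)%N; apply: (le_trans y1); by rewrite ler_nat.
case: (ex_minnP ex) => k yk kmin; exists k.
  rewrite ltnNge; apply/negP => Nk.
  have := kmin (2 ^ N).-1; rewrite prednK ?expn_gt0// => /(_ y1).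
  move: Nk; case: (2 ^ N)%N (expn_gt0 2 N) => // m _ mk /= km.
  by have := leq_trans mk km; rewrite ltnn.
apply/dyadic_cellE; split=> //; case: k yk kmin => [//|k] yk kmin.
rewrite ltNge; apply/negP => /kmin; by rewrite ltnn.
Qed.

Lemma trivIset_dyadic_cell N : trivIset setT (fun k : 'I_(2 ^ N) => dyadic_cell N k).
Proof.
apply/trivIsetP => i j _ _ ij; apply/seteqP; split=> // x [].
move=> /dyadic_cellE[ix xi] /dyadic_cellE[jx xj].
have : (i < j.+1)%N by rewrite -(ltr_nat R) (lt_le_trans ix xj).
have : (j < i.+1)%N by rewrite -(ltr_nat R) (lt_le_trans jx xi).
rewrite !ltnS => ji ij'; move: ij; rewrite -val_eqE.
by rewrite eqn_leq ji ij'.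
Qed.

Lemma dyadic_innerP N U x : dyadic_inner N U x <->
  exists k, [/\ (k < 2 ^ N)%N, dyadic_cell N k `<=` U & dyadic_cell N k x].
Proof.
rewrite /dyadic_inner -bigcup_seq_cond; split.
  by move=> [k /andP[_ /asboolP kU] kx]; exists k; split.
move=> [k [kN kU kx]]; exists (Ordinal kN) => //=.
by rewrite mem_index_enum /=; exact/asboolP.
Qed.

Lemma dyadic_inner_sub N U : dyadic_inner N U `<=` U.
Proof. by move=> x /dyadic_innerP[k [_ kU /kU]]. Qed.

Lemma measurable_dyadic_inner N U :
  measurable (dyadic_inner N U : set (measurableTypeR R)).
Proof. by apply: bigsetU_measurable => k _; exact: measurable_itv. Qed.

(** Cell [k] of level [N] is the union of the cells [2k] and [2k+1] of level [N+1], which stay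
    inside [U] with it. *)
Lemma dyadic_inner_nd U : nondecreasing_seq (fun N => dyadic_inner N U).
Proof.
apply/nondecreasing_seqP => N; apply/subsetPset => x /dyadic_innerP[k [kN kU kx]].
have [kx1 kx2] := (dyadic_cellE _ _ _).1 kx.
have sub m : (m./2 = k)%N -> dyadic_cell N.+1 m `<=` dyadic_cell N k.
  move=> mk y /dyadic_cellE; rewrite exprS => -[my ym]; apply/dyadic_cellE.
  have m1 : k%:R * 2 <= m%:R :> R.
    by rewrite -natrM ler_nat -mk -[leqRHS]odd_double_half -muln2 leq_addl.
  have m2 : m.+1%:R <= k.+1%:R * 2 :> R.
    rewrite -natrM ler_nat -mk -[m in leqLHS]odd_double_half -muln2 mulSn.
    by rewrite -addSn leq_add2r; case: (odd m).
  by split; lra.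
have [xm|mx] := leP (x * 2 ^+ N.+1) (k.*2.+1)%:R.
  apply/dyadic_innerP; exists k.*2; split.
  - by rewrite expnS mul2n ltn_double.
  - by apply: subset_trans kU; apply: sub; rewrite doubleK.
  - apply/dyadic_cellE; split=> //; rewrite -muln2 natrM exprS; lra.
apply/dyadic_innerP; exists k.*2.+1; split.
- by rewrite expnS mul2n ltn_Sdouble.
- by apply: subset_trans kU; apply: sub; rewrite /= uphalf_double.
- apply/dyadic_cellE; split=> //; rewrite -doubleS -muln2 natrM exprS; lra.
Qed.

(** Around a point of [U], the cell of level [N] lies in the ball of radius [e] as soon as its
    length [2^-N] is below [e]. *)
Lemma dyadic_inner_cover U : open U ->
  \bigcup_N dyadic_inner N U = U `&` `]0, 1]%classic.
Proof.
move=> oU; apply/seteqP; split=> x.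
  move=> [N _ xN]; split; first exact: dyadic_inner_sub xN.
  move/dyadic_innerP: xN => [k [kN _ /dyadic_cellE[kx xk]]].
  have E0 : 0 < 2 ^+ N :> R by rewrite exprn_gt0.
  rewrite /= in_itv/=; apply/andP; split.
    by rewrite -(pmulr_lgt0 _ E0) (le_lt_trans _ kx).
  rewrite -(ler_pM2r E0) mul1r (le_trans xk)// -natrX ler_nat//.
move=> [Ux]; rewrite /= in_itv/= => /andP[x0 x1].
move: oU; rewrite openE => /(_ _ Ux) /nbhs_ballP[e /= e0 eU].
have [N Ne] : exists N, (2 ^+ N)^-1 < e.
  exists (Num.truncn e^-1).+1; rewrite invf_plt ?posrE ?exprn_gt0//.
  apply: (lt_trans (truncnS_gt _)); rewrite -natrX ltr_nat.
  exact: ltn_expl.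
exists N => //; have [k kN kx] := dyadic_cell_exists N x0 x1.
apply/dyadic_innerP; exists k; split=> // y /dyadic_cellE[ky yk]; apply: eU.
move/dyadic_cellE : kx => [kx xk].
have E0 : 0 < 2 ^+ N :> R by rewrite exprn_gt0.
have d1 z : `|z * 2 ^+ N| < 1 -> `|z| < e.
  by rewrite normrM (gtr0_norm E0) -ltr_pdivlMr// div1r => /lt_trans; apply.
apply: d1; rewrite mulrBl ltr_norml.
have ks : k.+1%:R = k%:R + 1 :> R by rewrite -natr1.
 apply/andP; split; lra.
Qed.

End dyadic_cells.

Section monotone_density.
Context {R : realType}.
Local Notation mu := (@lebesgue_measure R).
Implicit Types (f v P : R -> R).

(** Integrability is asked on the whole line so that [u] can be integrated over any set at once; the
    values of [u] off [[0, 1]] are arbitrary. *)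
Definition has_density v u := mu.-integrable setT (EFin \o u) /\
  forall s t, 0 <= s -> s <= t -> t <= 1 ->
    v t - v s = \int[mu]_(x in `]s, t]) u x.

(** Families indexed by any finite type, for later use with pairs made of an interval and a piece of
    its partition. *)
Lemma abs_cont_fin (a b : R) f : abs_cont a b f ->
  forall e, 0 < e -> exists2 d, 0 < d & forall (I : finType) (s t : I -> R),
    (forall i, a <= s i /\ s i <= t i /\ t i <= b) ->
    (forall i j, i != j -> t i <= s j \/ t j <= s i) ->
    \sum_i (t i - s i) < d -> \sum_i `|f (t i) - f (s i)| < e.
Proof.
move=> acf e /acf[d d0 H]; exists d => // I s t st dis.
have E (F : I -> R) : \sum_i F i = \sum_(k < #|I|) F (enum_val k).
  by rewrite (reindex (@enum_val I predT))//; exact/onW_bij/enum_val_bij.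
rewrite !E => sd; apply: (H _ (s \o enum_val) (t \o enum_val)) => //.
  by move=> i; exact: st.
by move=> i j ij; apply: dis; rewrite (inj_eq enum_val_inj).
Qed.

Section cumulative_extension.
Variables (P : R -> R) (cP : abs_cont 0 1 P)
  (ndP : {in `[0, 1] &, {homo P : x y / x <= y}}).

Let clamp (x : R) : R := Num.max 0 (Num.min 1 x).

Let clamp01 x : clamp x \in `[0, 1].
Proof.
by rewrite in_itv/= /clamp le_max lexx/= ge_max ler01 ge_min lexx.
Qed.

Let clamp_id x : 0 <= x -> x <= 1 -> clamp x = x.
Proof. by move=> x0 x1; rewrite /clamp min_r// max_r. Qed.

Let clamp_nd x y : x <= y -> clamp x <= clamp y.
Proof.
rewrite /clamp => xy; case: (leP 1 x) => ?; case: (leP 1 y) => ?;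
  case: (leP 0 x) => ?; case: (leP 0 y) => ?; rewrite ?(max_r ler01)//; lra.
Qed.

Let clamp_lip x y : `|clamp x - clamp y| <= `|x - y|.
Proof.
wlog xy : x y / x <= y.
  by move=> H; have [/H//|/ltW/H] := leP x y; rewrite distrC [leRHS]distrC.
rewrite distrC [leRHS]distrC !ger0_norm ?subr_ge0 ?clamp_nd//.
rewrite /clamp; case: (leP 1 x) => ?; case: (leP 1 y) => ?;
  case: (leP 0 x) => ?; case: (leP 0 y) => ?; rewrite ?(max_r ler01)//; lra.
Qed.

(** Continuing [P] by constants makes it a cumulative function on the line, to which a Stieltjes
    measure is attached. *)
Definition clamped (x : R) : R := P (clamp x).
Local Notation Q := clamped.

Let Qnd : {homo Q : x y / x <= y}.
Proof. by move=> x y xy; apply: ndP => //; exact: clamp_nd. Qed.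

Let Qrc : right_continuous Q.
Proof.
apply: right_continuousW => x; apply/cvgrPdist_lt => e e0.
have [d d0 H] := cP e0.
near=> y; rewrite /clamped.
have := H 1%N (fun=> Num.min (clamp x) (clamp y))
  (fun=> Num.max (clamp x) (clamp y)).
rewrite !big_ord1 => HH; apply: le_lt_trans (HH _ _ _).
- by case: (leP (clamp x) (clamp y)) => // _; rewrite distrC.
- move=> _; have := clamp01 x; have := clamp01 y; rewrite !in_itv/= => /andP[? ?] /andP[? ?].
  by case: (leP (clamp x) (clamp y)) => H1; split=> //; split=> //; exact: ltW.
- by move=> i j; rewrite !ord1.
- have -> : Num.max (clamp x) (clamp y) - Num.min (clamp x) (clamp y) = `|clamp x - clamp y|.
    by case: (leP (clamp x) (clamp y)) => [/[dup] ? ?|?];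
      [rewrite ler0_norm ?subr_le0// opprB|rewrite gtr0_norm ?subr_gt0].
  apply: (le_lt_trans (clamp_lip _ _)).
  by near: y; exact: cvgr_dist_lt.
Unshelve. all: by end_near. Qed.

HB.instance Definition _ := isCumulative.Build R _ R Q Qnd Qrc.

Let nu := lebesgue_stieltjes_measure (Q : cumulative R R).

Let nu_itv (a b : R) : a <= b -> nu `]a, b]%classic = (Q b - Q a)%:E.
Proof.
move=> ab; rewrite /nu /lebesgue_stieltjes_measure /measure_extension/=.
by rewrite measurable_mu_extE/= ?wlength_itv_bnd//; exact: is_ocitv.
Qed.

(** A null set lies in an open [U] of Lebesgue measure below [d]. The part of [U] in []0, 1]] is an
    increasing union of finite families of disjoint cells of total length below [d]; absolute
    continuity bounds the [nu]-mass of each family by [e], and the bound passes to the limit. *)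
Let nu_dom (A : set (measurableTypeR R)) : measurable A -> mu A = 0%E ->
  nu (A `&` `]0, 1]%classic) = 0%E.
Proof.
move=> mA A0; apply/eqP; rewrite -measure_le0; apply/lee_addgt0Pr => e e0.
rewrite add0e.
have [d d0 H] := cP e0.
have Aoo : (mu A < +oo)%E by rewrite A0.
have [U [oU AU UA]] := lebesgue_regularity_outer mA Aoo d0.
have mU : measurable (U : set (measurableTypeR R)) by exact: open_measurable.
have Ud : (mu U < d%:E)%E.
  rewrite -(setDUK AU) (le_lt_trans (measureU2 _ _ _))//.
    exact: measurableD.
  by rewrite [X in (X + _ < _)%E](A0 : _ = 0%E) add0e.
apply: (@le_trans _ _ (nu (U `&` `]0, 1]%classic))).
  apply: le_measure; rewrite ?inE; [exact: measurableI|exact: measurableI|].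
  exact: setSI.
rewrite -dyadic_inner_cover//.
have cv : nu \o (fun N => dyadic_inner N U) @ \oo --> nu (\bigcup_N dyadic_inner N U).
  apply: nondecreasing_cvg_mu => //.
  - by move=> N; exact: measurable_dyadic_inner.
  - by apply: bigcupT_measurable => N; exact: measurable_dyadic_inner.
  - exact: dyadic_inner_nd.
apply: (cvge_le _ cv) => //; apply: nearW => N /=.
have bnd (k : 'I_(2 ^ N)) : k.+1%:R / 2 ^+ N <= 1 :> R.
  by rewrite ler_pdivrMr ?exprn_gt0// mul1r -natrX ler_nat.
have lek (k : nat) : k%:R / 2 ^+ N <= k.+1%:R / 2 ^+ N :> R.
  by rewrite ler_pM2r ?invr_gt0 ?exprn_gt0// ler_nat.
have nuE (m : {measure set (measurableTypeR R) -> \bar R}) : m (dyadic_inner N U) =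
    (\sum_(k < 2 ^ N | `[< dyadic_cell N k `<=` U >]) m (dyadic_cell N k))%E.
  apply: measure_bigsetU_ord => [i|]; first exact: measurable_itv.
  exact: trivIset_dyadic_cell.
pose s (k : 'I_(2 ^ N)) : R := k%:R / 2 ^+ N.
(* Cells not contained in [U] are collapsed to empty intervals, so that the family can be indexed by
   all [k]. *)
pose t (k : 'I_(2 ^ N)) : R :=
  if `[< dyadic_cell N k `<=` U >] then k.+1%:R / 2 ^+ N else s k.
have Hs : \sum_i (t i - s i) < d.
  rewrite -lte_fin -sumEFin (le_lt_trans _ Ud)//.
  apply: (@le_trans _ _ (mu (dyadic_inner N U))).
    rewrite nuE [leRHS]big_mkcond/=; apply: lee_sum => k _; rewrite /t.
    case: ifPn => _; last by rewrite subrr.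
    rewrite /dyadic_cell lebesgue_measure_itv/= lte_fin.
    case: ifPn => [_|]; first by rewrite EFinB.
    by rewrite -leNgt lee_fin subr_le0.
  apply: le_measure; rewrite ?inE//; last exact: dyadic_inner_sub.
  exact: measurable_dyadic_inner.
have ss k : 0 <= s k by rewrite /s divr_ge0 ?exprn_ge0.
have st k : s k <= t k by rewrite /t; case: ifP => // _; exact: lek.
have t1 k : t k <= 1.
  by rewrite /t; case: ifP => // _; rewrite /s (le_trans (lek k)).
rewrite [X in (X <= _)%E](nuE nu); apply: (@le_trans _ _ (\sum_i `|P (t i) - P (s i)|)%:E).
  rewrite -sumEFin big_mkcond/=; apply: lee_sum => k _.
  case: ifPn => [kU|_]; last by rewrite lee_fin.
  have := t1 k; have := st k; rewrite /t kU => skt tk1.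
  rewrite [X in (X <= _)%E](nu_itv (lek k)) lee_fin /clamped !clamp_id ?ler_norm//.
  by rewrite (le_trans skt).
rewrite lee_fin ltW// H// => i j ij.
have ij' : (i < j)%N || (j < i)%N by rewrite -neq_ltn.
have tS (k : 'I_(2 ^ N)) : t k <= k.+1%:R / 2 ^+ N.
  by rewrite /t; case: ifP => // _; exact: lek.
case/orP : ij' => [ij'|ji]; [left|right]; rewrite (le_trans (tS _))//;
  by rewrite ler_pM2r ?invr_gt0 ?exprn_gt0// ler_nat.
Qed.

Let D01 : set (measurableTypeR R) := `]0, 1]%classic.
Let mD01 : measurable D01. Proof. exact: measurable_itv. Qed.
Let nuD : (nu D01 < +oo)%E.
Proof. by rewrite /D01 nu_itv ?ltry. Qed.

(** Radon-Nikodym for the Stieltjes measure of [clamped], cut down to []0, 1]]; [nu_dom] provides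
    the domination by Lebesgue measure. *)
Lemma abs_cont_nondecreasing_density :
  exists2 p, has_density P p & forall x, 0 <= p x.
Proof.
pose nu' := mfrestr mD01 nuD.
have dom : nu' `<< mu.
  apply/null_content_dominatesP => A mA A0; exact: nu_dom.
pose g : measurableTypeR R -> \bar R := Radon_Nikodym_SigmaFinite.f nu' mu.
have g0 x : (0 <= g x)%E by exact: Radon_Nikodym_SigmaFinite.f_ge0.
have gE : EFin \o (fine \o g) = g.
  by apply/funext => x /=; rewrite fineK//; exact: Radon_Nikodym_SigmaFinite.f_fin_num.
exists (fine \o g); last by move=> x; exact/fine_ge0.
split; first by rewrite gE; exact: Radon_Nikodym_SigmaFinite.f_integrable.
move=> s t s0 st t1; rewrite /Rintegral.
have -> : (\int[mu]_(x in `]s, t]) ((fine \o g) x)%:E = \int[mu]_(x in `]s, t]) g x)%E.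
  by apply: eq_integral => x _; rewrite -[RHS](congr1 (@^~ x) gE).
rewrite -(Radon_Nikodym_SigmaFinite.f_integral dom (measurable_itv `]s, t])).
transitivity (fine (nu (`]s, t]%classic `&` D01))) => [|//].
rewrite setIidl.
  by rewrite nu_itv//= /clamped !clamp_id// ?(le_trans s0)// (le_trans st).
move=> x; rewrite /D01/= !in_itv/= => /andP[sx xt].
by rewrite (le_lt_trans s0)// (le_trans xt).
Qed.

End cumulative_extension.
End monotone_density.

(** * Total variation *)

Section total_variation_theory.
Context {R : realType}.
Local Notation TV := total_variation.
Implicit Types (f v : R -> R).

Lemma variations_nonempty (a b : R) f : a <= b -> variations a b f !=set0.
Proof.
rewrite le_eqVlt => /predU1P[->|]; last exact: variations_neq0.
by rewrite variationsxx; exists 0.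
Qed.

(** The choices in the sets [A i] are independent, so the supremum of the sums is the sum of the
    suprema: each is approached up to [e / (n + 1)]. *)
Lemma sum_ereal_sup_le n (A : 'I_n -> set R) (c : R) :
  (forall i, A i !=set0) ->
  (forall x : 'I_n -> R, (forall i, A i (x i)) -> \sum_i x i <= c) ->
  (\sum_i ereal_sup [set x%:E | x in A i] <= c%:E)%E.
Proof.
move=> A0 Ac.
have ubA i : has_ubound (A i).
  have /choice[x Ax] := A0.
  (* This is [c] minus the other chosen elements: only coordinate [i] varies. *)
  exists (x i + (c - \sum_j x j)) => y Ay.
  have H : \sum_j (if j == i then y else x j) <= c.
    by apply: Ac => j; case: eqP => [->|].
  move: H; rewrite (bigD1 i)//= eqxx.
  rewrite (eq_bigr x) => [|j /negPf->//].
  rewrite [\sum_j x j](bigD1 i)//=; set s := \sum_(j | _) _; lra.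
have E i : ereal_sup [set x%:E | x in A i] = (sup (A i))%:E.
  by rewrite ereal_sup_EFin.
under eq_bigr do rewrite E.
rewrite sumEFin lee_fin; apply/ler_addgt0Pr => e e0.
have en : 0 < e / n.+1%:R by rewrite divr_gt0.
have /choice[x Hx] : forall i, exists x, A i x /\ sup (A i) - e / n.+1%:R < x.
  move=> i; have [x Ax sx] := sup_adherent en (conj (A0 i) (ubA i)).
  by exists x.
apply: (@le_trans _ _ (\sum_i (x i + e / n.+1%:R))).
  by apply: ler_sum => i _; have [_ /ltW] := Hx i; rewrite lerBlDr.
rewrite big_split/= lerD//; first exact: Ac (fun i => (Hx i).1).
rewrite sumr_const card_ord -[_ *+ _]mulr_natr mulrAC ler_pdivrMr//.
by rewrite ler_pM2l// ler_nat.
Qed.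

Lemma itv_partition_nth_nd (a b : R) (l : seq R) m n : itv_partition a b l ->
  (m <= n)%N -> (n <= size l)%N -> nth b (a :: l) m <= nth b (a :: l) n.
Proof.
move=> [pl _] mn nl.
have : sorted <=%R (a :: l) by apply: sub_sorted (pl : sorted <%R (a :: l)) => ? ? /ltW.
move=> /(sorted_leq_nth le_trans lexx); apply => //; rewrite inE/= ltnS//.
exact: leq_trans mn nl.
Qed.

(* Partitions of the intervals of a disjoint family together form a disjoint family with the
   same total length. *)
Lemma abs_cont_total_variation (a b : R) f : abs_cont a b f ->
  forall e, 0 < e -> exists2 d, 0 < d & forall n (s t : 'I_n -> R),
    (forall i, a <= s i /\ s i <= t i /\ t i <= b) ->
    (forall i j, i != j -> t i <= s j \/ t j <= s i) ->
    \sum_i (t i - s i) < d -> (\sum_i TV (s i) (t i) f <= e%:E)%E.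
Proof.
move=> acf e /(abs_cont_fin acf)[d d0 H]; exists d => // n s t st dis sd.
apply: sum_ereal_sup_le => [i|x Ax].
  by apply: variations_nonempty; have [_ []] := st i.
have /choice[l Hl] : forall i, exists l, itv_partition (s i) (t i) l /\
    variation (s i) (t i) f l = x i.
  by move=> i; have [l il <-] := Ax i; exists l.
pose pt i (k : nat) := nth (t i) (s i :: l i) k.
pose I : finType := {i : 'I_n & 'I_(size (l i))}.
pose S (p : I) := pt (tag p) (tagged p).
pose T (p : I) := pt (tag p) (tagged p).+1.
have pt_le i m k : (m <= k)%N -> (k <= size (l i))%N -> pt i m <= pt i k.
  by move=> mk kl; exact: itv_partition_nth_nd (Hl i).1 mk kl.
have pt0 i : pt i 0%N = s i by [].
have ptn i : pt i (size (l i)) = t i.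
  by rewrite /pt -last_nth; have [[_ /eqP]] := Hl i.
have sumE (F : forall i, 'I_(size (l i)) -> R) :
    \sum_(p : I) F (tag p) (tagged p) = \sum_i \sum_(k < size (l i)) F i k.
  by rewrite sig_big_dep.
have -> : \sum_i x i = \sum_(p : I) `|f (T p) - f (S p)|.
  rewrite (sumE (fun i k => `|f (pt i k.+1) - f (pt i k)|)); apply: eq_bigr => i _.
  by rewrite -(Hl i).2 /variation big_mkord.
apply/ltW/H.
- move=> [i k]; have [as_ [st' tb]] := st i; rewrite /S /T/=.
  split; last split; [|exact: pt_le|].
    by rewrite (le_trans as_)// -pt0 pt_le// ltnW.
  by rewrite (le_trans _ tb)// -[leRHS]ptn pt_le.
- move=> [i k] [j m]; rewrite /S /T/=; have [ij|ij] := eqVneq i j; last first.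
    move=> _; have [|] := dis _ _ ij => h; [left|right].
      by rewrite (le_trans _ (le_trans h _))// -?[leRHS]ptn -?pt0 pt_le// ltnW.
    by rewrite (le_trans _ (le_trans h _))// -?[leRHS]ptn -?pt0 pt_le// ltnW.
  subst j => ne; have [km|mk|km] := ltngtP k m.
  + by left; apply: pt_le => //; exact: ltnW.
  + by right; apply: pt_le => //; exact: ltnW.
  + by move: ne; rewrite (val_inj km) eqxx.
- rewrite (sumE (fun i k => pt i k.+1 - pt i k)); apply: le_lt_trans sd.
  apply: ler_sum => i _.
  by rewrite -(big_mkord xpredT (fun k => pt i k.+1 - pt i k)) telescope_sumr// ptn.
Qed.

(** The bound on increments is summed over each partition. Two majorants are allowed in order to
    handle increments of a product. *)
Lemma total_variation_dominated (a b A B : R) f p q : a <= b -> 0 <= A -> 0 <= B ->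
  (forall x y, a <= x -> x <= y -> y <= b ->
    `|f y - f x| <= A * `|p y - p x| + B * `|q y - q x|) ->
  (TV a b f <= A%:E * TV a b p + B%:E * TV a b q)%E.
Proof.
move=> ab A0 B0 fpq; apply: ge_ereal_sup => _ [_ [l il <-] <-].
apply: (@le_trans _ _ (A%:E * (variation a b p l)%:E + B%:E * (variation a b q l)%:E)%E).
  rewrite -!EFinM -EFinD lee_fin /variation !mulr_sumr -big_split/=.
  rewrite !big_mkord; apply: ler_sum => k _.
  apply: fpq.
  - exact: (itv_partition_nth_nd il (leq0n _) (ltnW (ltn_ord k))).
  - exact: (itv_partition_nth_nd il (leqnSn _) (ltn_ord k)).
  - have := itv_partition_nth_nd il (ltn_ord k) (leqnn _).
    by rewrite -[X in _ <= X]last_nth; have [_ /eqP ->] := il.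
by rewrite leeD// lee_wpmul2l// ?lee_fin//; apply: ereal_sup_ubound;
  (eexists; last reflexivity); exact: variations_variation.
Qed.

Lemma total_variation_lipschitz (a b A : R) f p : a <= b -> 0 <= A ->
  (forall x y, a <= x -> x <= y -> y <= b -> `|f y - f x| <= A * `|p y - p x|) ->
  (TV a b f <= A%:E * TV a b p)%E.
Proof.
move=> ab A0 fp; have := @total_variation_dominated a b A 0 f p p ab A0 (lexx 0).
rewrite mul0e adde0; apply => x y ax xy yb.
by rewrite mul0r addr0 fp.
Qed.

Lemma eq_total_variation (a b : R) f p : a <= b ->
  (forall x y, a <= x -> x <= y -> y <= b -> `|f y - f x| = `|p y - p x|) ->
  TV a b f = TV a b p.
Proof.
move=> ab fp; apply/eqP; rewrite eq_le; apply/andP; split;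
  rewrite -[leRHS]mul1e; apply: total_variation_lipschitz => // x y ax xy yb;
  by rewrite mul1r fp.
Qed.

Lemma itv_partition_map (a b : R) (G : R -> R) (l : seq R) :
  (forall x y, a <= x -> x < y -> y <= b -> G x < G y) ->
  itv_partition a b l -> itv_partition (G a) (G b) (map G l).
Proof.
elim: l a => [|y l IH] a Ginc il.
  by rewrite (itv_partition_nil il); split=> //=.
have yl := itv_partition_cons il; have [/= /andP[ay _] _] := il.
have yb := itv_partition_le yl.
have {}IH := IH _ (fun x z yx => Ginc x z (le_trans (ltW ay) yx)) yl.
by have [p q] := IH; split; rewrite //= p Ginc.
Qed.

(** A strictly increasing [G] maps partitions to partitions with the same variation sum. Equality,
    where it is needed, comes from applying this to the inverse as well. *)
Lemma total_variation_comp_le (a b : R) f G : a <= b ->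
  (forall x y, a <= x -> x < y -> y <= b -> G x < G y) ->
  (TV a b (f \o G) <= TV (G a) (G b) f)%E.
Proof.
move=> ab Ginc; apply: ge_ereal_sup => _ [_ [l il <-] <-].
apply: ereal_sup_ubound; exists (variation (G a) (G b) f (map G l)).
  exact/variations_variation/itv_partition_map.
have E j : (j <= size l)%N -> nth (G b) (G a :: map G l) j = G (nth b (a :: l) j).
  by move=> jl; rewrite -map_cons (nth_map b).
congr EFin; rewrite /variation size_map; apply: eq_big_nat => k /andP[_ kl].
by congr `|f _ - f _|; [exact: (E k.+1 kl)|exact: (E k (ltnW kl))].
Qed.

(** Intervals shorter than the [d] that belongs to [e = 1] have variation at most 1, and finitely
    many steps of length [d / 2] cover [[a, b]]. *)
Lemma abs_cont_bounded_variation (a b : R) f : a <= b -> abs_cont a b f ->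
  TV a b f \is a fin_num.
Proof.
move=> ab /abs_cont_total_variation/(_ _ ltr01)[d d0 H].
have loc x y : a <= x -> x <= y -> y <= b -> y - x < d -> TV x y f \is a fin_num.
  move=> ax xy yb xyd; have := H 1%N (fun=> x) (fun=> y).
  rewrite !big_ord1 => /(_ _ _ xyd) h; rewrite ge0_fin_numE ?total_variation_ge0//.
  by apply: le_lt_trans (h _ _) (ltry _) => // i j; rewrite !ord1.
have step n x : a <= x -> x <= b -> x - a <= n%:R * (d / 2) -> TV a x f \is a fin_num.
  elim: n x => [|n IH] x ax xb xn.
    have -> : x = a by lra.
    by rewrite total_variationxx.
  rewrite -natr1 in xn; pose y := Num.max a (x - d / 2).
  have ay : a <= y by rewrite /y le_max lexx.
  have yx : y <= x by rewrite /y ge_max ax/=; lra.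
  rewrite (total_variationD f ay yx) fin_numD IH//=; last 2 first.
    exact: le_trans yx xb.
    by rewrite /y; case: (leP a (x - d / 2)) => ?; [lra|rewrite subrr mulr_ge0//; lra].
  apply: loc => //; rewrite /y; case: (leP a (x - d / 2)) => ?; lra.
apply: (step (Num.truncn ((b - a) / (d / 2))).+1) => //.
rewrite -ler_pdivrMr ?divr_gt0//; exact/ltW/truncnS_gt.
Qed.
End total_variation_theory.

Section density_theory.
Context {R : realType}.
Local Notation mu := (@lebesgue_measure R).
Local Notation TV := total_variation.
Implicit Types (u v p : R -> R).

Definition primitive u (x : R) : R := \int[mu]_(t in `]0, x]) u t.

Lemma lebesgue_measure_oc (s t : R) : s <= t -> mu `]s, t]%classic = (t - s)%:E.
Proof.
rewrite lebesgue_measure_itv/= lte_fin le_eqVlt => /predU1P[->|->].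
  by rewrite ltxx subrr.
by rewrite EFinB.
Qed.

Lemma integrable_itv u (s t : R) : mu.-integrable setT (EFin \o u) ->
  mu.-integrable `]s, t] (EFin \o u).
Proof. by apply: integrableS. Qed.

Lemma integrable_norm u : mu.-integrable setT (EFin \o u) ->
  mu.-integrable setT (EFin \o (fun x => `|u x|)).
Proof. by move=> /integrable_norm. Qed.

Lemma Rintegral_itvD u (r s t : R) : mu.-integrable setT (EFin \o u) ->
  r <= s -> s <= t -> \int[mu]_(x in `]r, t]) u x =
  \int[mu]_(x in `]r, s]) u x + \int[mu]_(x in `]s, t]) u x.
Proof.
move=> iu rs st; rewrite -(@Rintegral_itvB _ u (BRight r) (BRight t) s)//.
- by rewrite addrC subrK.
- exact: integrable_itv.
Qed.

Lemma primitive_has_density u : mu.-integrable setT (EFin \o u) ->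
  has_density (primitive u) u.
Proof.
move=> iu; split=> // s t s0 st _.
by rewrite /primitive (Rintegral_itvD iu s0 st) addrC addKr.
Qed.

Lemma has_density_norm_le v u s t : has_density v u -> 0 <= s -> s <= t -> t <= 1 ->
  `|v t - v s| <= \int[mu]_(x in `]s, t]) `|u x|.
Proof.
move=> [iu vu] s0 st t1; rewrite vu//; apply: le_normr_Rintegral => //.
exact: integrable_itv.
Qed.

(** Absolute continuity of the integral of [|u|], applied to the union of the intervals of the
    family. *)
Lemma has_density_abs_cont v u : has_density v u -> abs_cont 0 1 v.
Proof.
move=> vu e e0; have [iu _] := vu.
have [d [d0 H]] := integral_normr_continuous iu e0.
exists d => // n s t st dis sd.
have mF i : measurable (`]s i, t i]%classic : set (measurableTypeR R)) by exact: measurable_itv.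
have tF : trivIset setT (fun i => `]s i, t i]%classic).
  apply/trivIsetP => i j _ _ /dis tsij; apply/seteqP; split=> // x [].
  by rewrite /= !in_itv/= => /andP[a b] /andP[c d']; case: tsij => h; lra.
have iun D : measurable D -> mu.-integrable D (EFin \o (fun x => `|u x|)).
  by move=> mD; apply: (integrableS measurableT) => //; exact: integrable_norm.
pose U : set (measurableTypeR R) := \big[setU/set0]_(i < n) `]s i, t i]%classic.
have mU : measurable U by apply: bigsetU_measurable => i _.
apply: (@le_lt_trans _ _ (\int[mu]_(x in U) `|u x|)).
  apply: (@le_trans _ _ (\sum_i \int[mu]_(x in `]s i, t i]) `|u x|)).
    apply: ler_sum => i _; have [? [? ?]] := st i.
    exact: has_density_norm_le vu _ _ _.
  rewrite -lee_fin -sumEFin [leRHS]fineK; last first.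
    by apply: integrable_fin_num => //; exact: iun.
  rewrite (@integral_bigsetU_EFin _ _ _ mu _ (fun i => `]s i, t i]%classic)
    (fun x => `|u x|) (index_enum 'I_n))//.
  - apply: lee_sum => i _; rewrite fineK//.
    by apply: integrable_fin_num => //; exact: iun.
  - exact: index_enum_uniq.
  - by apply: sub_trivIset tF.
  - exact: (measurable_int mu (iun _ mU)).
apply: H => //.
rewrite (@measure_bigsetU_ord _ _ _ mu)//.
apply: le_lt_trans (_ : ((\sum_i (t i - s i))%:E < _)%E) => //.
rewrite -sumEFin; apply: lee_sum => i _; have [_ [sti _]] := st i.
by rewrite [X in (X <= _)%E](lebesgue_measure_oc sti).
Qed.

(** Increments of [v] are bounded by those of the primitive of [|u|], which is nondecreasing, so
    that its variation is its total increment. *)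
Lemma has_density_total_variation_le v u : has_density v u ->
  (TV 0 1 v <= (\int[mu]_(x in `]0, 1]) `|u x|)%:E)%E.
Proof.
move=> vu; have [iu _] := vu; have iun := integrable_norm iu.
have [_ pn] := primitive_has_density iun.
have nd : {in `[0, 1] &, nondecreasing_fun (primitive (fun x => `|u x|))}.
  move=> x y; rewrite !in_itv/= => /andP[x0 _] /andP[_ y1] xy.
  by rewrite -subr_ge0 pn//; apply: Rintegral_ge0.
apply: (@le_trans _ _ (TV 0 1 (primitive (fun x => `|u x|)))).
  rewrite -[leRHS]mul1e; apply: total_variation_lipschitz => // x y x0 xy y1.
  rewrite mul1r pn// [leRHS]ger0_norm; last exact: Rintegral_ge0.
  exact: has_density_norm_le vu _ _ _.
by rewrite nondecreasing_total_variation// pn.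
Qed.

(** Jordan decomposition: with [T] the variation function of [v], both [T + v] and [T - v] are
    nondecreasing and absolutely continuous. If [p] and [q] are their densities, [v] has density
    [(p - q) / 2], and [|p - q| / 2] is at most [(p + q) / 2], whose integral is the increment of
    [T]. *)
Lemma abs_cont_density v : abs_cont 0 1 v -> exists2 u, has_density v u &
  ((\int[mu]_(x in `]0, 1]) `|u x|)%:E <= TV 0 1 v)%E.
Proof.
move=> acv; pose T x := fine (TV 0 x v).
have fin x y : 0 <= x -> x <= y -> y <= 1 -> TV x y v \is a fin_num.
  move=> x0 xy y1; apply/(bounded_variationP _ xy).
  apply: (bounded_variationl xy y1).
  apply: (bounded_variationr x0 (le_trans xy y1)).
  exact/(bounded_variationP _ ler01)/abs_cont_bounded_variation.
have TD x y : 0 <= x -> x <= y -> y <= 1 -> T y - T x = fine (TV x y v).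
  move=> x0 xy y1; rewrite /T (total_variationD v x0 xy) fineD.
  - by rewrite addrC addKr.
  - by apply: fin => //; exact: le_trans y1.
  - exact: fin.
have Tge x y : 0 <= x -> x <= y -> y <= 1 -> `|v y - v x| <= T y - T x.
  move=> x0 xy y1; rewrite TD// -lee_fin fineK ?fin//.
  exact: total_variation_ge.
have ac c : `|c| = 1 -> abs_cont 0 1 (fun x => T x + c * v x).
  (* An increment of [T + c v] is at most twice that of [T]. The bound on the variations is not
     strict, and [e / 4] keeps the double strictly below [e]. *)
  move=> c1 e e0; have [|d d0 H] := abs_cont_total_variation acv (_ : 0 < e / 4).
    by rewrite divr_gt0.
  exists d => // n s t st dis sd; have {}H := H n s t st dis sd.
  have : \sum_i (T (t i) - T (s i)) <= e / 4.
    rewrite -lee_fin (le_trans _ H)// -sumEFin; apply: lee_sum => i _.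
    by have [? [? ?]] := st i; rewrite TD// fineK// fin.
  move=> {}H; apply: (@le_lt_trans _ _ (2 * (e / 4))); last by lra.
  apply: (@le_trans _ _ (2 * \sum_i (T (t i) - T (s i)))); last by rewrite ler_pM2l.
  rewrite mulr_sumr; apply: ler_sum => i _; have [s0 [sti t1]] := st i.
  have := Tge _ _ s0 sti t1; set a := T _ - T _; set b := v _ - v _ => ba.
  have -> : T (t i) + c * v (t i) - (T (s i) + c * v (s i)) = a + c * b.
    by rewrite /a /b; ring.
  rewrite (le_trans (ler_normD _ _))// normrM c1 mul1r.
  have a0 : 0 <= a by exact: le_trans (normr_ge0 _) ba.
  by rewrite (ger0_norm a0); lra.
have nd c : `|c| = 1 -> {in `[0, 1] &, {homo (fun x => T x + c * v x) : x y / x <= y}}.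
  move=> c1 x y; rewrite !in_itv/= => /andP[x0 _] /andP[_ y1] xy.
  have := Tge _ _ x0 xy y1; have := ler_norm (- c * (v y - v x)).
  rewrite normrM normrN c1 mul1r => h1 /(le_trans h1); lra.
have [p [ip Pp] p0] := abs_cont_nondecreasing_density (ac 1 (normr1 _)) (nd 1 (normr1 _)).
have N1 : `|-1| = 1 :> R by rewrite normrN1.
have [q [iq Qq] q0] := abs_cont_nondecreasing_density (ac _ N1) (nd _ N1).
have ih (c : R) f : mu.-integrable setT (EFin \o f) ->
    mu.-integrable setT (EFin \o (fun x => c * f x)).
  move=> /(integrableZl measurableT c).
  by under [X in _ -> integrable _ _ X]eq_fun do rewrite /= EFinM.
have iS : mu.-integrable setT (EFin \o (fun x => 2^-1 * p x + 2^-1 * q x)).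
  by have := integrableD measurableT (ih 2^-1 p ip) (ih 2^-1 q iq).
have iB : mu.-integrable setT (EFin \o (fun x => 2^-1 * p x - 2^-1 * q x)).
  by have := integrableB measurableT (ih 2^-1 p ip) (ih 2^-1 q iq).
exists (fun x => 2^-1 * p x - 2^-1 * q x).
  split=> // s t s0 st t1.
  rewrite RintegralB//; [|exact: integrable_itv (ih _ _ _)..].
  rewrite !RintegralZl//; [|exact: integrable_itv..].
  rewrite -Pp// -Qq//; lra.
rewrite -[leRHS]fineK ?fin// lee_fin.
apply: (@le_trans _ _ (\int[mu]_(x in `]0, 1]) (2^-1 * p x + 2^-1 * q x))).
  apply: le_Rintegral => //.
  - exact: integrable_itv (integrable_norm iB).
  - exact: integrable_itv.
  - move=> x _; have := p0 x; have := q0 x => ? ?.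
    by rewrite ler_norml; apply/andP; split; lra.
rewrite RintegralD//; [|exact: integrable_itv (ih _ _ _)..].
rewrite !RintegralZl//; [|exact: integrable_itv..].
rewrite -Pp// -Qq// -[leRHS](TD 0 1)//; lra.
Qed.

End density_theory.

Section integral_without_measurability.
Context d (T : measurableType d) (R : realType) (mu : {measure set T -> \bar R}).
Implicit Types (D : set T) (f g : T -> \bar R).
Import HBNNSimple.

(* A simple function below [f] stays below [g] once it is set to 0 on a null set, so that
   measurability is not needed. *)
Lemma ae_ge0_le_integral_nonmeasurable D f g :
  (forall x, D x -> (0 <= f x)%E) -> (forall x, D x -> (0 <= g x)%E) ->
  {ae mu, forall x, D x -> (f x <= g x)%E} ->
  (\int[mu]_(x in D) f x <= \int[mu]_(x in D) g x)%E.
Proof.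
move=> f0 g0 [N [mN N0 fgN]]; rewrite !(integral_mkcond D).
have f0' x : (0 <= (f \_ D) x)%E by exact: erestrict_ge0.
have g0' x : (0 <= (g \_ D) x)%E by exact: erestrict_ge0.
rewrite !ge0_integralTE//; apply: ge_ereal_sup => _ [h hf <-].
have mNC : measurable (~` N) by exact: measurableC.
apply: ereal_sup_ubound; exists (proj_nnsfun h mNC).
  move=> x; rewrite -mrestrict patchE; case: ifPn => [xN|_]; last exact: g0'.
  apply: (le_trans (hf x)); rewrite !patchE; case: ifPn => // xD.
  have {}xN : ~ N x by move: xN; rewrite inE.
  apply: contra_notP xN => fgx; apply: fgN => /= /(_ _)H.
  by apply: fgx; apply: H; exact: set_mem.
rewrite -!integralT_nnsfun.
rewrite [RHS](ge0_negligible_integral mN)//; last first.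
  by move=> x _; rewrite lee_fin.
  exact/measurable_EFinP.
rewrite setTD [RHS]integral_mkcond; apply: eq_integral => x _.
by rewrite -mrestrict restrict_EFin.
Qed.

Lemma ae_ge0_eq_integral_nonmeasurable D f g :
  (forall x, D x -> (0 <= f x)%E) -> (forall x, D x -> (0 <= g x)%E) ->
  {ae mu, forall x, D x -> f x = g x :> \bar R} ->
  (\int[mu]_(x in D) f x = \int[mu]_(x in D) g x)%E.
Proof.
move=> f0 g0 fg; apply/eqP; rewrite eq_le; apply/andP.
by split; apply: ae_ge0_le_integral_nonmeasurable => //;
  apply: filterS fg => x fgx Dx; rewrite fgx.
Qed.

End integral_without_measurability.

(** * Densities as derivatives almost everywhere *)

Section density_derivative.
Context {R : realType}.
Local Notation mu := (@lebesgue_measure R).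
Local Notation TV := total_variation.
Implicit Types (u v w p : R -> R) (D : set R).

(** Near an interior point [v] is the primitive of [u] plus [v 0], and the primitive is
    differentiable almost everywhere by Lebesgue's theorem. *)
Lemma has_density_is_derive v u : has_density v u ->
  {ae mu, forall x : R, 0 < x -> x < 1 -> is_derive x 1 v (u x)}.
Proof.
move=> [iu vu].
have loc : locally_integrable [set: R] u.
  by have := integrable_locally measurableT iu; rewrite patch_setT.
have iuy y : mu.-integrable [set` Interval (BRight 0) (BRight y)] (EFin \o u).
  exact: integrable_itv.
have := FTC1 iuy loc; apply: filterS; first exact: (ae_filter_ringOfSetsType mu).
move=> x Hx x0 x1; have [|dF F'] := Hx; first exact: x0.
apply: (@near_eq_is_derive _ _ _ (fun y => primitive u y + v 0)).
  near=> y; rewrite -[primitive u y](vu 0 y) ?subrK//.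
    by apply: ltW; near: y; exact: lt_nbhsr.
  by apply: ltW; near: y; exact: lt_nbhsl.
rewrite -[u x]addr0; apply: is_deriveD.
apply: DeriveDef; first exact: dF.
by rewrite -derive1E.
Unshelve. all: by end_near. Qed.

Lemma is_derive_diff_quot D v (x l : R) : is_derive x 1 v l ->
  diff_quot v x @ within D x^' --> l.
Proof.
move=> vx; have H : h^-1 *: (v (h + x) - v x) @[h --> 0^'] --> l.
  have [dv <-] := vx; have := dv; rewrite /derivable /derive.
  by under eq_fun do rewrite /= scaler1.
apply/cvgrPdist_lt => e e0; move/cvgrPdist_lt/(_ _ e0) : H.
rewrite /within/= => /nbhs_ballP[r /= r0 rH]; apply/nbhs_ballP; exists r => //= y xy yx Dy.
have := rH (y - x); rewrite /ball/= sub0r normrN distrC subr_eq0 subrK => /(_ xy yx).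
by rewrite /diff_quot mulrC.
Qed.

(** The endpoints 0 and 1 form a null set; at other points the two-sided derivative gives the limit
    within any [D]. *)
Lemma has_density_deriv_within D v u : D `<=` limit_point D -> `[0, 1] `<=` D ->
  has_density v u -> {ae mu, forall x : R, x \in `[0, 1] -> deriv_within D v x = u x}.
Proof.
move=> limD ID /has_density_is_derive vu.
have n01 r : {ae mu, forall x : R, x != r}.
  exists [set r]; split; [exact: measurable_set1|exact: lebesgue_measure_set1|].
  by move=> x /= /negP; rewrite negbK => /eqP.
have := n01 0; have := n01 1; move: vu; apply: filterS3; first exact: (ae_filter_ringOfSetsType mu).
move=> x vx x1 x0; rewrite in_itv/= => /andP[x0' x1'].
apply: (Defs.derivE limD); first by apply: ID; rewrite /= in_itv/= x0' x1'.
by apply/is_derive_diff_quot/vx; rewrite lt_neqAle ?[0 == _]eq_sym ?x0 ?x1.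
Qed.

Lemma has_density_unique v u w : has_density v u -> has_density v w ->
  {ae mu, forall x : R, x \in `[0, 1] -> u x = w x}.
Proof.
move=> vu vw.
have limD : [set: R] `<=` limit_point [set: R] by exact: S1_dom_lim.
have := has_density_deriv_within limD (@subsetT _ _) vu.
have := has_density_deriv_within limD (@subsetT _ _) vw.
apply: filterS2; first exact: (ae_filter_ringOfSetsType mu).
by move=> x xw xu xI; rewrite -xw// -xu.
Qed.

(** The lower bound holds for the density built by [abs_cont_density], and [u] agrees with it almost
    everywhere. *)
Lemma has_density_total_variation v u : has_density v u ->
  TV 0 1 v = (\int[mu]_(x in `]0, 1]) `|u x|)%:E.
Proof.
move=> vu; apply/eqP; rewrite eq_le has_density_total_variation_le//=.
have [w vw] := abs_cont_density (has_density_abs_cont vu).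
apply: le_trans; rewrite lee_fin le_eqVlt; apply/orP; left; apply/eqP.
congr fine; apply: ae_ge0_eq_integral_nonmeasurable => //.
have := has_density_unique vu vw; apply: filterS.
  exact: (ae_filter_ringOfSetsType mu).
move=> x uw x01.
by rewrite uw//; move: x01; rewrite /= !in_itv/= => /andP[/ltW -> ->].
Qed.

Lemma has_densityB v u w p : has_density v u -> has_density w p ->
  has_density (fun x => v x - w x) (fun x => u x - p x).
Proof.
move=> [iu vu] [ip wp]; split; first by have := integrableB measurableT iu ip.
move=> s t s0 st t1; rewrite RintegralB//; [|exact: integrable_itv..].
by rewrite -vu// -wp//; ring.
Qed.

(** Turns the last term of [Diff_rho] into a total variation. The integrand is known only almost
    everywhere, through the densities. *)
Lemma integral_deriv_within_total_variation D v w : D `<=` limit_point D ->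
  `[0, 1] `<=` D -> abs_cont 0 1 v -> abs_cont 0 1 w ->
  (\int[mu]_(x in `[0%R, 1%R]) `|deriv_within D v x - deriv_within D w x|%:E)%E =
  TV 0 1 (fun x => v x - w x).
Proof.
move=> limD ID /abs_cont_density[u vu _] /abs_cont_density[p wp _].
have vwup := has_densityB vu wp.
rewrite (has_density_total_variation vwup).
have iup : mu.-integrable `]0, 1] (EFin \o (fun x => `|u x - p x|)).
  by apply: integrable_itv; apply: integrable_norm; have [] := vwup.
rewrite /Rintegral fineK; last exact: integrable_fin_num.
rewrite integral_itv_obnd_cbnd; last first.
  exact: (measurable_int mu).
apply: ae_ge0_eq_integral_nonmeasurable => //.
have := has_density_deriv_within limD ID wp.
have := has_density_deriv_within limD ID vu; apply: filterS2.
  exact: (ae_filter_ringOfSetsType mu).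
move=> x xv xw x01.
by rewrite xv// xw.
Qed.

End density_derivative.

(** * The logarithmic distance *)

Section exp_ln_estimates.
Context {R : realType}.
Implicit Types (m B x y : R).

(** From [1 + t <= expR t] at [t = ln (x / y)]. *)
Lemma ln_lipschitz m x y : 0 < m -> m <= x -> m <= y ->
  `|ln x - ln y| <= m^-1 * `|x - y|.
Proof.
move=> m0; wlog xy : x y / y <= x => [H mx my|mx my].
  by have [/H|/ltW/H] := leP y x; [exact|rewrite distrC [`|x - y|]distrC; exact].
have y0 := lt_le_trans m0 my; have x0 := lt_le_trans m0 mx.
rewrite !ger0_norm ?subr_ge0 ?ler_ln//.
rewrite -ln_div//; have := expR_ge1Dx (ln (x / y)).
rewrite lnK ?posrE ?divr_gt0// => h.
apply: (@le_trans _ _ ((x - y) / y)).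
  by rewrite mulrBl divff ?gt_eqF//; lra.
by rewrite mulrC ler_wpM2r ?subr_ge0// lef_pV2.
Qed.

Lemma expR_lipschitz B x y : x <= B -> y <= B ->
  `|expR x - expR y| <= expR B * `|x - y|.
Proof.
wlog xy : x y / y <= x => [H xB yB|xB yB].
  by have [/H|/ltW/H] := leP y x; [exact|rewrite distrC [`|x - y|]distrC; exact].
rewrite !ger0_norm ?subr_ge0 ?ler_expR//.
have -> : expR x - expR y = expR x * (1 - expR (y - x)).
  by rewrite mulrBr mulr1 -expRD subrKC.
apply: ler_pM; rewrite ?expR_ge0 ?ler_expR//.
  by rewrite subr_ge0 -[leRHS]expR0 ler_expR subr_le0.
by have := expR_ge1Dx (y - x); lra.
Qed.

End exp_ln_estimates.

Section total_variation_difference.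
Context {R : realType}.
Local Notation TV := total_variation.
Implicit Types (a b : R) (u v w : R -> R).

Lemma total_variation_sub_sym a b u v : a <= b ->
  TV a b (fun x => u x - v x) = TV a b (fun x => v x - u x).
Proof.
move=> ab; apply: eq_total_variation => // x y _ _ _.
by rewrite -normrN; congr `|_|; ring.
Qed.

Lemma total_variation_sub_triangle a b u v w : a <= b ->
  (TV a b (fun x => u x - w x)%R <=
   TV a b (fun x => u x - v x)%R + TV a b (fun x => v x - w x)%R)%E.
Proof.
move=> ab; apply: le_trans (total_variation_le _ _ ab).
rewrite le_eqVlt; apply/orP; left; apply/eqP.
by apply: eq_total_variation => // x y _ _ _; congr `|_|; rewrite /=; ring.
Qed.

Lemma total_variation_sub_eq0 u v :
  (forall x, x \in `[0, 1] -> u x - u 0 = v x - v 0) ->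
  TV 0 1 (fun x => u x - v x) = 0%E.
Proof.
move=> uv; apply/eqP; rewrite eq_le total_variation_ge0// andbT.
have := @total_variation_lipschitz _ 0 1 0 (fun x => u x - v x) id ler01 (lexx _).
rewrite mul0e; apply => x y x0 xy y1; rewrite mul0r normr_le0; apply/eqP.
have xI : x \in `[0, 1] by rewrite in_itv/= x0 (le_trans xy).
have yI : y \in `[0, 1] by rewrite in_itv/= y1 (le_trans x0).
by have := uv _ xI; have := uv _ yI; lra.
Qed.

Lemma abs_contB v w : abs_cont 0 1 v -> abs_cont 0 1 w ->
  abs_cont 0 1 (fun x => v x - w x).
Proof.
move=> /abs_cont_density[u vu _] /abs_cont_density[p wp _].
exact: has_density_abs_cont (has_densityB vu wp).
Qed.

(** [fine] would turn an infinite variation into 0, hence the absolute continuity hypotheses in the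
    lemmas where finiteness matters. *)
Definition tv_dist u v : R := fine (TV 0 1 (fun x => u x - v x)).

Lemma tv_dist_ge0 u v : 0 <= tv_dist u v.
Proof. by rewrite fine_ge0// total_variation_ge0. Qed.

Lemma tv_dist_sym u v : tv_dist u v = tv_dist v u.
Proof. by rewrite /tv_dist total_variation_sub_sym. Qed.

Lemma tv_distE u v : abs_cont 0 1 u -> abs_cont 0 1 v ->
  TV 0 1 (fun x => u x - v x) = (tv_dist u v)%:E.
Proof.
by move=> au av; rewrite /tv_dist fineK// abs_cont_bounded_variation//; exact: abs_contB.
Qed.

Lemma tv_dist_triangle u v w : abs_cont 0 1 u -> abs_cont 0 1 v -> abs_cont 0 1 w ->
  tv_dist u w <= tv_dist u v + tv_dist v w.
Proof.
move=> au av aw; rewrite -lee_fin EFinD -!tv_distE//.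
exact: total_variation_sub_triangle.
Qed.

(** The hypothesis says that [u - v] is constant: functions count only up to additive constants,
    which is why [log_deriv f x - log_deriv f 0] recurs below. *)
Lemma tv_dist_eq0 u v :
  (forall x, x \in `[0, 1] -> u x - u 0 = v x - v 0) -> tv_dist u v = 0.
Proof. by move=> uv; rewrite /tv_dist total_variation_sub_eq0. Qed.

End total_variation_difference.

Lemma abs_cont_dominated (R : realType) (a b K : R) (f p : R -> R) : 0 < K ->
  (forall x y, a <= x -> x <= y -> y <= b -> `|f y - f x| <= K * `|p y - p x|) ->
  abs_cont a b p -> abs_cont a b f.
Proof.
move=> K0 fp acp e e0; have [|d d0 H] := acp (e / K); first exact: divr_gt0.
exists d => // n s t st dis sd; have := H n s t st dis sd.
rewrite ltr_pdivlMr// mulrC; apply: le_lt_trans; rewrite mulr_sumr.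
by apply: ler_sum => i _; have [? [? ?]] := st i; exact: fp.
Qed.

Lemma C1AC_MVT (R : realType) (D : set R) (F : R -> R) (s t : R) :
  C1AC_diffeo D F -> s <= t -> `[s, t] `<=` D ->
  exists2 c, c \in `[s, t] & F t - F s = deriv_within D F c * (t - s).
Proof.
move=> FD st stD; apply: MVT_segment => //.
  move=> x xst; apply: (@is_derive_within _ D).
    have := near_in_itvoo xst; apply: filterS => y yst; apply: stD.
    by move: yst; rewrite /= !in_itv/= => /andP[/ltW -> /ltW ->].
  apply: C1AC_has_deriv => //; apply: stD.
  by move: xst; rewrite /= !in_itv/= => /andP[/ltW -> /ltW ->].
have cD : {within D, continuous F}.
  by apply/subspace_continuousP => x Dx; apply: (@derivable_cont _ D); exact: C1AC_has_deriv.
exact: continuous_subspaceW cD.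
Qed.

(* Locked because unification otherwise tries to compare [log_dist f g] with
   [log_dist g f] by unfolding [ln]. *)
HB.lock Definition log_deriv (R : realType) (M : curve R) (f : Diff M) (x : R) : R :=
  ln (Diff_deriv f x).
HB.lock Definition log_dist (R : realType) (M : curve R) (f g : Diff M) : R :=
  tv_dist (log_deriv f) (log_deriv g).

Section log_dist.
Context (R : realType) (M : curve R).
Local Notation D := (dom M).
Local Notation TV := total_variation.
Implicit Types (f g h : Diff M) (x y : R).

Lemma log_derivE f : log_deriv f = fun x => ln (Diff_deriv f x).
Proof. by apply/funext => x; rewrite log_deriv.unlock. Qed.

Lemma log_distE f g : log_dist f g = tv_dist (log_deriv f) (log_deriv g).
Proof. by rewrite log_dist.unlock. Qed.

Lemma Diff_lift_C1AC f : C1AC_diffeo D (Diff_lift f).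
Proof. by rewrite /Diff_lift; case: cid => F []. Qed.

Lemma Diff_lift_is_lift f : is_lift (Diff_lift f) f.
Proof. by rewrite /Diff_lift; case: cid => F []. Qed.

Lemma Diff_deriv_gt0 f x : D x -> 0 < Diff_deriv f x.
Proof. exact: (C1AC_pos (Diff_lift_C1AC f)). Qed.

Hypothesis D01 : `[0, 1] `<=` D.

Lemma Diff_deriv_abs_cont f : abs_cont 0 1 (Diff_deriv f).
Proof. exact: (C1AC_ac (Diff_lift_C1AC f)). Qed.

Lemma Diff_deriv_lower f : exists2 m, 0 < m & {in `[0, 1], forall x, m <= Diff_deriv f x}.
Proof.
have c01 : {within `[0, 1], continuous (Diff_deriv f)}.
  exact: continuous_subspaceW (C1AC_cont (Diff_lift_C1AC f)).
have [c c1 cm] := EVT_min ler01 c01.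
by exists (Diff_deriv f c) => //; apply: Diff_deriv_gt0; exact: D01.
Qed.

Lemma log_deriv_abs_cont f : abs_cont 0 1 (log_deriv f).
Proof.
have [m m0 mf] := Diff_deriv_lower f.
rewrite log_derivE; apply: (@abs_cont_dominated _ _ _ m^-1 _ _ _ _ (Diff_deriv_abs_cont f)).
  by rewrite invr_gt0.
move=> x y x0 xy y1; apply: ln_lipschitz => //; apply: mf; rewrite in_itv/=.
  by rewrite y1 (le_trans x0).
by rewrite x0 (le_trans xy).
Qed.

Lemma log_dist_ge0 f g : 0 <= log_dist f g.
Proof. rewrite log_distE; exact: tv_dist_ge0. Qed.

Lemma log_dist_sym f g : log_dist f g = log_dist g f.
Proof. rewrite !log_distE; exact: tv_dist_sym. Qed.

Lemma log_dist_triangle f g h : log_dist f h <= log_dist f g + log_dist g h.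
Proof. rewrite !log_distE; exact: tv_dist_triangle (log_deriv_abs_cont f) (log_deriv_abs_cont g)
  (log_deriv_abs_cont h). Qed.

Lemma eq_log_dist0 f g : (forall x, x \in `[0, 1] ->
  log_deriv f x - log_deriv f 0 = log_deriv g x - log_deriv g 0) -> log_dist f g = 0.
Proof. rewrite log_distE; exact: tv_dist_eq0. Qed.

Lemma log_dist_refl f : log_dist f f = 0.
Proof. exact: eq_log_dist0. Qed.

Lemma integral_Diff_deriv2 f g :
  (\int[lebesgue_measure]_(x in `[0%R, 1%R]) `|Diff_deriv2 f x - Diff_deriv2 g x|%:E)%E
  = TV 0 1 (fun x => Diff_deriv f x - Diff_deriv g x).
Proof.
apply: integral_deriv_within_total_variation; [exact: dom_lim|exact: D01|..];
  exact: Diff_deriv_abs_cont.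
Qed.

End log_dist.

(** The common term [w], which is [ln h'] in the chain rule, cancels in the difference. The last
    hypothesis covers the circle, where [[H 0, H 1]] is another interval of length one period. *)
Lemma tv_dist_comp_le (R : realType) (u v u' v' w H : R -> R) :
  abs_cont 0 1 u -> abs_cont 0 1 v -> abs_cont 0 1 u' -> abs_cont 0 1 v' ->
  (forall x, x \in `[0, 1] -> u' x = u (H x) + w x) ->
  (forall x, x \in `[0, 1] -> v' x = v (H x) + w x) ->
  {in `[0, 1] &, {homo H : x y / x < y}} ->
  total_variation (H 0) (H 1) (fun x => u x - v x) =
    total_variation 0 1 (fun x => u x - v x) ->
  tv_dist u' v' <= tv_dist u v.
Proof.
move=> au av au' av' u'E v'E Hinc Huv.
rewrite -lee_fin -!tv_distE// -Huv.
rewrite (@eq_total_variation _ 0 1 _ ((fun x => u x - v x) \o H))//.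
  apply: total_variation_comp_le => // x y x0 xy y1.
  by apply: Hinc; rewrite ?in_itv/= ?x0 ?y1 ?(le_trans x0 (ltW xy)) ?(le_trans (ltW xy) y1).
have E x : x \in `[0, 1] -> u' x - v' x = u (H x) - v (H x).
  by move=> xI; rewrite u'E// v'E//; lra.
move=> x y x0 xy y1 /=; rewrite !E// in_itv/=.
  by rewrite x0 (le_trans xy).
by rewrite y1 (le_trans x0 xy).
Qed.

(** * Properties shared by the interval and the circle *)

Section coarse_curve.
Context (R : realType) (M : curve R).
Local Notation D := (dom M).
Local Notation TV := total_variation.
Implicit Types (f g h : Diff M) (x y : R).

(** The average of the derivative over [[0, 1]] is 1, which rules out rotations other than the
    identity. On the interval every diffeomorphism qualifies. *)
Definition based f : Prop :=
  exists F, [/\ C1AC_diffeo D F, is_lift F f, F 0 = 0 & F 1 = 1].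

(** What the proof of maximality uses of the curve. [closed] is true for the circle, where [ln f']
    has equal values at 0 and 1 and a prescribed [w] must have them too. By [cc_base], any
    diffeomorphism becomes based at bounded cost and without change of the logarithmic distance. *)
Record coarse_curve (closed : bool) : Prop := {
  cc_dom : `[0, 1] `<=` D ;
  cc_deriv : forall f F x, C1AC_diffeo D F -> is_lift F f -> D x ->
    Diff_deriv f x = deriv_within D F x ;
  cc_dist_ge0 : forall p q : pt M, 0 <= dist p q ;
  cc_dist : forall x y, x \in `[0, 1] -> y \in `[0, 1] ->
    dist (par M x) (par M y) <= `|x - y| ;
  cc_par : forall p : pt M, exists2 x, x \in `[0, 1] & p = par M x ;
  cc_total_variation : forall f g h,
    TV (Diff_lift h 0) (Diff_lift h 1) (fun x => log_deriv f x - log_deriv g x) =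
    TV 0 1 (fun x => log_deriv f x - log_deriv g x) ;
  cc_closed : forall f, closed -> log_deriv f 0 = log_deriv f 1 ;
  cc_realize : forall w, abs_cont 0 1 w -> (closed -> w 0 = w 1) ->
    exists2 f, based f & forall x, x \in `[0, 1] ->
      log_deriv f x - log_deriv f 0 = w x - w 0 ;
  cc_base : forall s : Diff M -> Diff M -> R,
    continuous_right_invariant_pseudometric s ->
    exists C, forall f, exists f0, [/\ based f0, log_dist f f0 = 0 & s f f0 <= C] }.

Variables (closed : bool) (cc : coarse_curve closed).
Let D01 : `[0, 1] `<=` D := cc_dom cc.

Lemma dom0 : D 0. Proof. by apply: D01; rewrite /= in_itv/= lexx ler01. Qed.
Lemma dom1 : D 1. Proof. by apply: D01; rewrite /= in_itv/= lexx ler01. Qed.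

(** Chain rule for the composite of the two chosen lifts; it may differ from the lift chosen for
    [f * h], which [cc_deriv] repairs. *)
Lemma log_deriv_mul f h x : D x ->
  log_deriv (f * h)%g x = log_deriv f (Diff_lift h x) + log_deriv h x.
Proof.
move=> Dx; have FD := Diff_lift_C1AC f; have HD := Diff_lift_C1AC h.
have DH := C1AC_maps HD Dx.
rewrite !log_derivE (@cc_deriv _ cc (f * h)%g (Diff_lift f \o Diff_lift h))//.
- rewrite (@Defs.derivE _ _ (@dom_lim _ M) _ _ (Diff_deriv f (Diff_lift h x) * Diff_deriv h x))//.
    by rewrite lnM// posrE; exact: Diff_deriv_gt0.
  apply: Defs.deriv_comp => //.
  + by move=> y; exact: C1AC_maps.
  + exact: C1AC_inj.
  + exact: C1AC_has_deriv.
  + exact: C1AC_has_deriv.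
- by apply: C1AC_comp => //; [exact: dom_itv|exact: dom_lim].
- move=> y Dy /=; rewrite -(Diff_lift_is_lift f)//; last exact: C1AC_maps Dy.
  by rewrite -(Diff_lift_is_lift h).
Qed.

Lemma log_dist_mul_le f g h : log_dist (f * h)%g (g * h)%g <= log_dist f g.
Proof.
have HD := Diff_lift_C1AC h.
have LM k x : x \in `[0, 1] ->
    log_deriv (k * h)%g x = log_deriv k (Diff_lift h x) + log_deriv h x.
  by move=> xI; apply: log_deriv_mul; exact: D01.
rewrite !log_distE.
exact: (@tv_dist_comp_le _ (log_deriv f) (log_deriv g) _ _ (log_deriv h) (Diff_lift h)
  (log_deriv_abs_cont D01 f) (log_deriv_abs_cont D01 g)
  (log_deriv_abs_cont D01 _) (log_deriv_abs_cont D01 _) (LM f) (LM g)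
  (fun x y xI yI => C1AC_incr HD (D01 xI) (D01 yI)) (cc_total_variation cc f g h)).
Qed.

(** The reverse inequality is [log_dist_mul_le] for [f * h] and [g * h] multiplied by [h^-1]. *)
Lemma log_dist_mul f g h : log_dist (f * h)%g (g * h)%g = log_dist f g.
Proof.
apply/le_anti/andP; split; first exact: (log_dist_mul_le f g h).
have := log_dist_mul_le (f * h)%g (g * h)%g (h^-1)%g.
by rewrite (mulgK h f) (mulgK h g).
Qed.

Lemma log_deriv_one x : D x -> log_deriv (1%g : Diff M) x = 0.
Proof.
move=> Dx; rewrite !log_derivE (@cc_deriv _ cc _ id)//; last exact/C1AC_id/dom_lim.
rewrite (@Defs.derivE _ _ (@dom_lim _ M) _ _ 1) ?ln1//.
apply: is_derive_diff_quot; exact: is_derive_id.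
Qed.

Lemma Diff_deriv_one x : D x -> Diff_deriv (1%g : Diff M) x = 1.
Proof.
move=> Dx; rewrite (@cc_deriv _ cc _ id)//; last exact/C1AC_id/dom_lim.
rewrite (@Defs.derivE _ _ (@dom_lim _ M) _ _ 1)//.
apply: is_derive_diff_quot; exact: is_derive_id.
Qed.

Lemma based_divg f g : based f -> based g -> based (f * g^-1)%g.
Proof.
move=> [F [FD Ff F0 F1]] [G [GD Gg G0 G1]].
have [H HD HG] := C1AC_inverse (@dom_itv _ M) (@dom_lim _ M) GD.
have DH x : D x -> D (H x) by exact: C1AC_maps HD.
have HGx x y : D x -> D y -> G x = y -> H y = x.
  move=> Dx Dy Gxy; apply: (C1AC_inj GD); rewrite ?inE//; first exact: DH.
  by rewrite HG.
exists (F \o H); split.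
- by apply: C1AC_comp => //; [exact: dom_itv|exact: dom_lim].
- move=> x Dx; rewrite -Ff; last exact: DH.
  have -> : par M (H x) = (g^-1)%g (par M x).
    rewrite -[in RHS](HG x Dx) -Gg; last exact: DH.
    by have /(congr1 (fun k : Diff M => k (par M (H x)))) := mulVg g.
  by [].
- by rewrite /= (HGx 0)//; exact: dom0.
- by rewrite /= (HGx 1)//; exact: dom1.
Qed.

End coarse_curve.

(** * Comparison of the logarithmic distance with [Diff_rho] *)

Section log_estimates.
Context {R : realType}.
Local Notation TV := total_variation.
Implicit Types (p q : R -> R) (m e d x y : R).

(** Here [ln p - ln q = - ln r] with [r = q / p = 1 + (q - p) i] and [i = 1 / p]. The product rule
    bounds increments of [r] by those of [q - p] times [sup |i|], plus [sup |q - p|] times those of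
    [i]; both terms are small. *)
Lemma tv_dist_ln_small p m : 0 < m -> {in `[0, 1], forall x, m <= p x} ->
  abs_cont 0 1 p -> forall e : R, 0 < e -> exists2 d : R, 0 < d & forall q,
    (forall x, x \in `[0, 1] -> `|p x - q x| < d) ->
    (TV 0 1 (fun x => p x - q x)%R < d%:E)%E ->
    tv_dist (fun x => ln (p x)) (fun x => ln (q x)) < e.
Proof.
move=> m0 mp acp e e0; pose i x := (p x)^-1.
have aci : abs_cont 0 1 i by exact: (abs_cont_inv m0 mp acp).
have Vfin := abs_cont_bounded_variation ler01 aci.
pose V := fine (TV 0 1 i).
have V0 : 0 <= V by rewrite fine_ge0// total_variation_ge0.
have m'0 : 0 < m^-1 by rewrite invr_gt0.
(* The bound [m / 2] gives [r >= 1/2], where [ln] is 2-Lipschitz. The final estimate is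
   [2 d (m^-1 + V)], and the added 1 makes it strictly less than [e]. *)
pose d := Num.min (m / 2) (e / (2 * (m^-1 + V) + 1)).
have den0 : 0 < 2 * (m^-1 + V) + 1 by lra.
have d0 : 0 < d by rewrite lt_min !divr_gt0.
have dm : d <= m / 2 by rewrite /d ge_min lexx.
have de : d * (2 * (m^-1 + V) + 1) <= e.
  by rewrite -ler_pdivlMr// /d ge_min lexx orbT.
exists d => // q pq TVpq; pose r x := q x * i x.
have rE x : x \in `[0, 1] -> r x = 1 + (q x - p x) * i x.
  move=> xI; have p0 : p x != 0 by rewrite gt_eqF// (lt_le_trans m0)// mp.
  by rewrite /r /i mulrBl divff//; lra.
have ile x : x \in `[0, 1] -> `|i x| <= m^-1.
  move=> xI; have p0 := lt_le_trans m0 (mp _ xI).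
  by rewrite gtr0_norm ?invr_gt0// lef_pV2 ?posrE// mp.
have r2 x : x \in `[0, 1] -> 2^-1 <= r x.
  move=> xI; rewrite rE//.
  have : `|(q x - p x) * i x| <= m / 2 * m^-1.
    by rewrite normrM distrC ler_pM ?ile// (le_trans (ltW (pq _ xI))).
  rewrite mulrAC divff ?gt_eqF// div1r ler_norml => /andP[? _]; lra.
have pos x : x \in `[0, 1] -> 0 < p x /\ 0 < q x.
  move=> xI; have p0 := lt_le_trans m0 (mp _ xI); split=> //.
  have : 0 < r x by apply: lt_le_trans (r2 _ xI); rewrite invr_gt0.
  by rewrite /r pmulr_lgt0// invr_gt0.
have lnE x : x \in `[0, 1] -> ln (p x) - ln (q x) = - ln (r x).
  move=> xI; have [p0 q0] := pos _ xI.
  by rewrite /r /i ln_div ?posrE// opprB.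
have TVle : (TV 0 1 (fun x => ln (p x) - ln (q x))%R <=
    (2 * m^-1)%:E * TV 0 1 (fun x => p x - q x)%R + (2 * d)%:E * TV 0 1 i)%E.
  apply: total_variation_dominated => //; [by rewrite mulr_ge0// ltW|by rewrite mulr_ge0// ltW|].
  move=> x y x0 xy y1.
  have xI : x \in `[0, 1] by rewrite in_itv/= x0 (le_trans xy).
  have yI : y \in `[0, 1] by rewrite in_itv/= y1 (le_trans x0).
  rewrite !lnE// opprK addrC.
  apply: (le_trans (ln_lipschitz (_ : 0 < 2^-1) (r2 _ xI) (r2 _ yI))).
    by rewrite invr_gt0.
  rewrite invrK -!mulrA -mulrDr ler_pM2l// distrC !rE//.
  have -> : 1 + (q y - p y) * i y - (1 + (q x - p x) * i x) =
    ((q y - p y) - (q x - p x)) * i y + (q x - p x) * (i y - i x) by ring.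
  apply: (le_trans (ler_normD _ _)); rewrite !normrM; apply: lerD.
    have -> : q y - p y - (q x - p x) = - (p y - q y - (p x - q x)) by ring.
    by rewrite normrN mulrC ler_wpM2r// ile.
  by rewrite ler_wpM2r// distrC ltW// pq.
have TVpq_fin : TV 0 1 (fun x => p x - q x) \is a fin_num.
  by rewrite ge0_fin_numE ?total_variation_ge0// (lt_le_trans TVpq)// leey.
have TVlt : fine (TV 0 1 (fun x => p x - q x)) < d by rewrite -lte_fin fineK.
have TVge : 0 <= fine (TV 0 1 (fun x => p x - q x)).
  by rewrite fine_ge0// total_variation_ge0.
have {}TVle : (TV 0 1 (fun x => ln (p x) - ln (q x))%R <= (2 * m^-1 * d + 2 * d * V)%:E)%E.
  apply: (le_trans TVle); rewrite -(fineK TVpq_fin) -(fineK Vfin) -!EFinM -EFinD lee_fin.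
  by rewrite lerD2r ler_pM2l ?mulr_gt0// ltW.
rewrite /tv_dist; apply: (@le_lt_trans _ _ (2 * m^-1 * d + 2 * d * V)).
  rewrite -lee_fin fineK// ge0_fin_numE ?total_variation_ge0//.
  by apply: le_lt_trans TVle _; rewrite ltry.
lra.
Qed.

(** Since [ln p <= d <= 1], the exponential is applied where its Lipschitz constant is at most
    [expR 1]. *)
Lemma exp_near_one p d : 0 <= d -> d <= 1 -> (forall x, x \in `[0, 1] -> 0 < p x) ->
  (forall x, x \in `[0, 1] -> `|ln (p x)| <= d) ->
  (TV 0 1 (fun x => ln (p x)) <= d%:E)%E ->
  (forall x, x \in `[0, 1] -> `|1 - p x| <= expR 1 * d) /\
  (TV 0 1 (fun x => 1 - p x)%R <= (expR 1 * d)%:E)%E.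
Proof.
move=> d0 d1 p0 lnp TVp.
have le1 x : x \in `[0, 1] -> ln (p x) <= 1.
  by move=> xI; rewrite (le_trans (ler_norm _))// (le_trans (lnp _ xI)).
have pE x : x \in `[0, 1] -> p x = expR (ln (p x)).
  by move=> xI; rewrite lnK// posrE p0.
split.
  move=> x xI; rewrite pE// -[X in X - _]expR0.
  apply: (le_trans (@expR_lipschitz R 1 0 (ln (p x)) ler01 (le1 _ xI))).
  by rewrite sub0r normrN ler_pM2l ?expR_gt0// lnp.
apply: (@le_trans _ _ ((expR 1)%:E * TV 0 1 (fun x => ln (p x)))%E).
  apply: total_variation_lipschitz => //.
  move=> x y x0 xy y1.
  have xI : x \in `[0, 1] by rewrite in_itv/= x0 (le_trans xy).
  have yI : y \in `[0, 1] by rewrite in_itv/= y1 (le_trans x0).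
  have -> : 1 - p y - (1 - p x) = - (p y - p x) by ring.
  rewrite normrN {1}(pE _ yI) {1}(pE _ xI); apply: expR_lipschitz; exact: le1.
by rewrite EFinM lee_wpmul2l// lee_fin expR_ge0.
Qed.

End log_estimates.

Section maximality.
Context (R : realType) (M : curve R) (closed : bool).
Hypothesis cc : coarse_curve M closed.
Local Notation D := (dom M).
Local Notation TV := total_variation.
Implicit Types (f g h : Diff M) (x y e d : R).
Let D01 : `[0, 1] `<=` D := cc_dom cc.

Lemma Diff_rho_lt f g d : (Diff_rho f g < d%:E)%E ->
  (forall x, x \in `[0, 1] -> `|Diff_deriv f x - Diff_deriv g x| < d) /\
  (TV 0 1 (fun x => Diff_deriv f x - Diff_deriv g x)%R < d%:E)%E.
Proof.
rewrite /Diff_rho (integral_Diff_deriv2 D01 f g).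
set S1 := ereal_sup _; set S2 := ereal_sup _; set T := total_variation _ _ _ => H.
have S10 : (0 <= S1)%E.
  apply: le_ereal_sup_tmp; exists (dist (f (par M 0)) (g (par M 0)))%:E.
    by exists (par M 0).
  by rewrite lee_fin (cc_dist_ge0 cc).
have le2 x : x \in `[0, 1] -> (`|Diff_deriv f x - Diff_deriv g x|%:E <= S2)%E.
  by move=> xI; apply: ereal_sup_ubound; exists x.
have S20 : (0 <= S2)%E by apply: le_trans (le2 0 _); rewrite ?lee_fin// in_itv/= lexx ler01.
have T0 : (0 <= T)%E by exact: total_variation_ge0.
split.
  move=> x /le2 xS; rewrite -lte_fin (le_lt_trans xS)// (le_lt_trans _ H)//.
  by rewrite -[leLHS]add0e -[leLHS]adde0 leeD// leeD.
by rewrite (le_lt_trans _ H)// -[leLHS]add0e leeD// adde_ge0.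
Qed.

Lemma log_dist_small f e : 0 < e ->
  exists2 d, 0 < d & forall g, (Diff_rho f g < d%:E)%E -> log_dist f g < e.
Proof.
move=> e0; have [m m0 mf] := Diff_deriv_lower D01 f.
have [d d0 H] := tv_dist_ln_small m0 mf (Diff_deriv_abs_cont D01 f) e0.
by exists d => // g /Diff_rho_lt[fg TVfg]; rewrite log_distE !log_derivE; exact: H.
Qed.

(** [Diff_open] wants a [Diff_rho]-ball around every point [g] of the set: [log_dist_small] at [g]
    gives one for the slack [e - log_dist g f]. *)
Lemma log_dist_open f e : open [set g | log_dist g f < e].
Proof.
move=> g /= gf; have [|d d0 H] := @log_dist_small g (e - log_dist g f).
  by rewrite subr_gt0.
exists d => // h /H gh.
apply: (le_lt_trans (log_dist_triangle D01 h g f)).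
by rewrite -ltrBrDr log_dist_sym.
Qed.

Lemma log_dist_continuous :
  continuous (fun fg : Diff M * Diff M => log_dist fg.1 fg.2).
Proof.
move=> [f0 g0] /=; apply/cvgrPdist_lt => e e0.
have e2 : 0 < e / 2 by rewrite divr_gt0.
have N (k : Diff M) : nbhs k [set g | log_dist g k < e / 2].
  apply: open_nbhs_nbhs; split; first exact: log_dist_open.
  by rewrite /= (log_dist_refl k).
exists ([set g | log_dist g f0 < e / 2], [set g | log_dist g g0 < e / 2]).
  by split; exact: N.
move=> [f g] /= [ff0 gg0].
have t1 := log_dist_triangle D01 f0 f g0; have t2 := log_dist_triangle D01 f g g0.
have t3 := log_dist_triangle D01 f f0 g; have t4 := log_dist_triangle D01 f0 g0 g.
have s1 := log_dist_sym f f0; have s2 := log_dist_sym g g0.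
by rewrite ltr_norml; apply/andP; split; lra.
Qed.

Lemma log_dist_crp : continuous_right_invariant_pseudometric (@log_dist R M).
Proof.
split.
- exact: log_dist_ge0.
- exact: log_dist_refl.
- exact: log_dist_sym.
- exact: log_dist_triangle.
- exact: log_dist_continuous.
- exact: (log_dist_mul cc).
Qed.

(** A converse of [log_dist_small] at the identity, for [based] maps: [h'] equals 1 at some [c], so
    [|ln h'|] is at most its variation. Exponentiating controls [h' - 1] and its variation, and the
    mean value theorem on [[0, x]] controls [h x - x]. *)
Lemma Diff_rho_one_small e : 0 < e -> exists2 d, 0 < d & forall h, based h ->
  log_dist h 1%g < d -> (Diff_rho 1%g h < e%:E)%E.
Proof.
move=> e0; pose K := expR 1 : R.
have K0 : 0 < K by exact: expR_gt0.
(* The bound 1 is for [exp_near_one]; the other makes each of the three terms of [Diff_rho] at most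
   [e / 4]. *)
pose d := Num.min 1 (e / (4 * K)).
have d0 : 0 < d by rewrite lt_min ltr01 divr_gt0// mulr_gt0.
have d1 : d <= 1 by rewrite /d ge_min lexx.
have dK : K * d <= e / 4.
  rewrite mulrC -ler_pdivlMr// -mulrA -invfM mulrC.
  by rewrite /d ge_min; apply/orP; right; rewrite mulrC.
exists d => // h [H [HD Hh H0 H1]] hd.
have I0 : (0 : R) \in `[0, 1] by rewrite in_itv/= lexx ler01.
have hE x : x \in `[0, 1] -> Diff_deriv h x = deriv_within D H x.
  by move=> xI; apply: (cc_deriv cc) => //; exact: D01.
have p0 x : x \in `[0, 1] -> 0 < Diff_deriv h x.
  by move=> xI; apply: Diff_deriv_gt0; exact: D01.
have one x : x \in `[0, 1] -> log_deriv (1%g : Diff M) x = 0.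
  by move=> xI; apply: (log_deriv_one cc); exact: D01.
have TVh : TV 0 1 (log_deriv h) = (log_dist h 1%g)%:E.
  rewrite log_distE -(tv_distE (log_deriv_abs_cont D01 h) (log_deriv_abs_cont D01 1%g)).
  apply: eq_total_variation => // x y x0 xy y1.
  rewrite !one ?subr0// in_itv/=; first by rewrite x0 (le_trans xy).
  by rewrite y1 (le_trans x0).
have TVd : (TV 0 1 (log_deriv h) <= d%:E)%E by rewrite TVh lee_fin ltW.
have [c cI] := C1AC_MVT HD ler01 D01.
rewrite H0 H1 !subr0 mulr1 -hE// => c1.
have sub_TV x y : 0 <= x -> x <= y -> y <= 1 -> `|log_deriv h y - log_deriv h x| <= d.
  move=> x0 xy y1; rewrite -lee_fin (le_trans _ TVd)//.
  rewrite (total_variationD (log_deriv h) x0 (le_trans xy y1)).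
  rewrite (total_variationD (log_deriv h) xy y1).
  rewrite (le_trans (total_variation_ge _ xy))//.
  rewrite -[leLHS]adde0 -[leLHS]add0e leeD ?total_variation_ge0// leeD//.
  exact: total_variation_ge0.
have lnd x : x \in `[0, 1] -> `|log_deriv h x| <= d.
  move=> xI; have c0 : log_deriv h c = 0 by rewrite log_derivE -c1 ln1.
  move: xI cI; rewrite !in_itv/= => /andP[x0 x1] /andP[c0' c1'].
  have [xc|/ltW cx] := leP x c.
    by have := sub_TV _ _ x0 xc c1'; rewrite c0 sub0r normrN.
  by have := sub_TV _ _ c0' cx x1; rewrite c0 subr0.
rewrite log_derivE in lnd TVd.
have [dH TVH] := exp_near_one (ltW d0) d1 p0 lnd TVd.
have oneD x : x \in `[0, 1] -> Diff_deriv (1%g : Diff M) x = 1.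
  by move=> xI; apply: (Diff_deriv_one cc); exact: D01.
have Hx x : x \in `[0, 1] -> `|x - H x| <= K * d.
  rewrite in_itv/= => /andP[x0 x1].
  have x01 : `[0, x] `<=` `[0, 1]%classic.
    by move=> y; rewrite /= !in_itv/= => /andP[-> /le_trans ->].
  have [b bI] := C1AC_MVT HD x0 (subset_trans x01 D01).
  have bI' := x01 _ bI.
  rewrite H0 !subr0 -hE// => ->.
  rewrite -[X in X - _]mul1r -mulrBl normrM (ger0_norm x0).
  apply: (le_trans (ler_piMr _ x1)) => //; exact: dH.
have HI x : x \in `[0, 1] -> H x \in `[0, 1].
  rewrite !in_itv/= => /andP[x0 x1].
  have := C1AC_nd HD D01 (lexx 0) x0 x1; have := C1AC_nd HD D01 x0 x1 (lexx 1).
  by rewrite H0 H1 => -> ->.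
rewrite /Diff_rho (integral_Diff_deriv2 D01 1%g h).
apply: (@le_lt_trans _ _ (e / 4 + e / 4 + e / 4)%:E); last by rewrite lte_fin; lra.
rewrite !EFinD; apply: leeD.
- apply: leeD; apply: ge_ereal_sup => _ [x xI <-]; rewrite lee_fin.
    have [y yI ->] := cc_par cc x.
    have -> : h (par M y) = par M (H y) by apply: Hh; exact: D01.
    apply: (le_trans (cc_dist cc yI (HI _ yI))).
    exact: le_trans (Hx _ yI) dK.
  by rewrite oneD// (le_trans (dH _ xI)).
- rewrite (@eq_total_variation _ 0 1 _ (fun x => 1 - Diff_deriv h x))//; last first.
    move=> x y x0 xy y1; rewrite !oneD// in_itv/=.
      by rewrite x0 (le_trans xy).
    by rewrite y1 (le_trans x0).
  by rewrite (le_trans TVH).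
Qed.

End maximality.

(** * Maximality of the logarithmic distance *)

Section maximal_log_dist.
Context (R : realType) (M : curve R) (closed : bool).
Hypothesis cc : coarse_curve M closed.
Implicit Types (f g h : Diff M).
Let D01 : `[0, 1] `<=` dom M := cc_dom cc.

Section domination.
Variable s : Diff M -> Diff M -> R.
Hypothesis cs : continuous_right_invariant_pseudometric s.

Lemma crp_divg f g : s f g = s (f * g^-1)%g 1%g.
Proof. by have := crp_right cs f g (g^-1)%g; rewrite mulgV. Qed.

Lemma log_dist_divg f g : log_dist f g = log_dist (f * g^-1)%g 1%g.
Proof. by have := log_dist_mul cc f g (g^-1)%g; rewrite mulgV. Qed.

(** Continuity of [s] at [(1, 1)] together with right-invariance; [f * g^-1] is again based, so
    [Diff_rho_one_small] applies to it. *)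
Lemma crp_based_small : exists2 d, 0 < d &
  forall f g, based f -> based g -> log_dist f g < d -> s f g <= 1.
Proof.
have /cvgrPdist_lt/(_ 1 ltr01) :=
  crp_continuous cs (x := (1%g : Diff M, 1%g : Diff M)).
rewrite /= (crp_refl cs) => -[[A B] /= [A1 B1] AB].
move: B1; rewrite nbhsE => -[V [oV V1] VB].
have [e e0 Ve] := oV _ V1.
have [d d0 H] := Diff_rho_one_small cc e0.
exists d => // f g bf bg; rewrite log_dist_divg crp_divg => fg.
have b := H _ (based_divg cc bf bg) fg.
have /= := AB (1%g, (f * g^-1)%g) (conj (nbhs_singleton A1) (VB _ (Ve _ b))).
rewrite sub0r normrN => /(le_lt_trans (ler_norm _)).
by rewrite (crp_sym cs) => /ltW.
Qed.

Lemma crp_chain (n : nat) (f : nat -> Diff M) (c : R) :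
  (forall k, (k < n)%N -> s (f k) (f k.+1) <= c) -> s (f 0%N) (f n) <= c *+ n.
Proof.
elim: n => [|n IH] H; first by rewrite mulr0n (crp_refl cs).
rewrite mulrSr (le_trans (crp_triangle cs _ (f n) _))// lerD// ?H//.
by apply: IH => k kn; apply: H; rewrite ltnS ltnW.
Qed.

(* [f] is joined to the identity through diffeomorphisms with logarithmic derivative
   [k / n * log_deriv f] up to constants; consecutive ones are at distance [log_dist f 1 / n]. *)
Lemma crp_log_dist_based : exists K C : R, 0 <= K /\
  forall f, based f -> s f 1%g <= K * log_dist f 1%g + C.
Proof.
have [d d0 Hd] := crp_based_small.
(* There are [n <= L / d + 1] steps of cost at most 1, and one more at each end of the chain:
   [L / d + 3] in all. *)
exists d^-1, 3; split; first by rewrite invr_ge0 ltW.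
move=> f0 bf0; set L := log_dist f0 1%g.
have L0 : 0 <= L by exact: log_dist_ge0.
pose n := (Num.truncn (L / d)).+1.
have Ln : L / n%:R < d.
  by rewrite ltr_pdivrMr// mulrC -ltr_pdivrMr//; exact: truncnS_gt.
have acf := log_deriv_abs_cont D01 f0.
have /choice[f Hf] : forall k : nat, exists f, based f /\ forall x, x \in `[0, 1] ->
    log_deriv f x - log_deriv f 0 =
    k%:R / n%:R * log_deriv f0 x - k%:R / n%:R * log_deriv f0 0.
  move=> k; have [||f bf Hf] := @cc_realize _ _ _ cc (fun x => k%:R / n%:R * log_deriv f0 x).
  (* The 1 is added because the constant must be positive even for [k = 0]. *)
  - apply: (abs_cont_dominated (_ : 0 < k%:R / n%:R + 1) _ acf).
      by rewrite ltr_wpDl// divr_ge0.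
    move=> x y _ _ _; rewrite -mulrBr normrM ger0_norm ?divr_ge0//.
    by rewrite ler_wpM2r// lerDl.
  - by move=> cl; rewrite (cc_closed cc f0 cl).
  - by exists f.
have one x : x \in `[0, 1] -> log_deriv (1%g : Diff M) x = 0.
  by move=> xI; apply: (log_deriv_one cc); exact: D01.
have I0 : (0 : R) \in `[0, 1] by rewrite in_itv/= lexx ler01.
have b1 : based (1%g : Diff M).
  by exists id; split=> //; exact/C1AC_id/dom_lim.
have small k : log_dist (f k) (f k.+1) < d.
  apply: le_lt_trans Ln; rewrite -lee_fin log_distE.
  rewrite -(tv_distE (log_deriv_abs_cont D01 _) (log_deriv_abs_cont D01 _)).
  have -> : L / n%:R = n%:R^-1 * L by rewrite mulrC.
  rewrite EFinM /L log_distE.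
  rewrite -(tv_distE (log_deriv_abs_cont D01 f0) (log_deriv_abs_cont D01 1%g)).
  apply: total_variation_lipschitz => // x y x0 xy y1.
  have xI : x \in `[0, 1] by rewrite in_itv/= x0 (le_trans xy).
  have yI : y \in `[0, 1] by rewrite in_itv/= y1 (le_trans x0).
  rewrite (one _ xI) (one _ yI) !subr0.
  have := (Hf k).2 _ xI; have := (Hf k.+1).2 _ xI.
  have := (Hf k).2 _ yI; have := (Hf k.+1).2 _ yI.
  have kS : k.+1%:R = k%:R + 1 :> R by rewrite -natr1.
  rewrite kS => e1 e2 e3 e4.
  rewrite -[X in X * `|_|]ger0_norm// -normrM le_eqVlt; apply/orP; left; apply/eqP.
  rewrite -normrN; congr `|_|; move: e1 e2 e3 e4; move: (n%:R^-1) => N; lra.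
(* [f 0] and [f n] are only known to be at [log_dist] 0 from 1 and [f0], hence an extra step at both
   ends. *)
have end0 : log_dist 1%g (f 0%N) < d.
  rewrite (eq_log_dist0 (f := 1%g))// => x xI.
  by rewrite (Hf 0%N).2// (one _ xI) (one _ I0) !mul0r.
have endn : log_dist (f n) f0 < d.
  have n0 : n%:R != 0 :> R by rewrite pnatr_eq0.
  by rewrite eq_log_dist0// => x xI; rewrite (Hf n).2// (divff n0) !mul1r.
have ch : s (f 0%N) (f n) <= 1 *+ n.
  by apply: crp_chain => k _; apply: Hd; [exact: (Hf _).1|exact: (Hf _).1|exact: small].
have s0 : s 1%g (f 0%N) <= 1 by apply: Hd => //; exact: (Hf _).1.
have sn : s (f n) f0 <= 1 by apply: Hd => //; exact: (Hf _).1.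
have t1 := crp_triangle cs 1%g (f 0%N) f0; have t2 := crp_triangle cs (f 0%N) (f n) f0.
have nL : n%:R <= L / d + 1 by rewrite /n -natr1 lerD2r truncn_le// divr_ge0// ltW.
rewrite (crp_sym cs) [d^-1 * L]mulrC.
move: (s 1%g f0) (s (f 0%N) f0) (s (f 0%N) (f n)) (s 1%g (f 0%N)) (s (f n) f0) t1 t2 ch s0 sn nL.
by rewrite -/(n%:R : R) => *; lra.
Qed.

Lemma crp_log_dist : exists K C : R, forall f g, s f g <= K * log_dist f g + C.
Proof.
have [K [C [K0 H]]] := crp_log_dist_based; have [C' H'] := cc_base cc cs.
exists K, (C + C') => f g; rewrite crp_divg log_dist_divg.
have [f0 [bf0 ff0 sf0]] := H' (f * g^-1)%g.
apply: (le_trans (crp_triangle cs _ f0 _)).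
have : log_dist f0 1%g <= log_dist (f * g^-1)%g 1%g.
  have := log_dist_triangle D01 f0 (f * g^-1)%g 1%g.
  by rewrite (log_dist_sym f0 (f * g^-1)%g) ff0 add0r.
move=> /(ler_wpM2l K0) h2; have h1 := H _ bf0.
apply: (le_trans (lerD sf0 (le_trans h1 (lerD h2 (lexx C))))).
by rewrite addrCA [C' + C]addrC.
Qed.

End domination.

Lemma log_dist_maximal : maximal_pseudometric (@log_dist R M).
Proof. by split; [exact: log_dist_crp cc|exact: crp_log_dist]. Qed.

End maximal_log_dist.

(** * Diffeomorphisms with prescribed logarithmic derivative *)

Section antiderivative.
Context {R : realType}.
Local Notation mu := (@lebesgue_measure R).
Implicit Types (f g w F : R -> R) (a b x y : R).

(** [H a x] is the integral from 0 to [x] with either sign of [x], and does not depend on [a] as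
    long as [a] is at most both 0 and [x]. Near a given [x] one fixed [a] serves, and the
    fundamental theorem applies. *)
Lemma continuous_antiderivative g : continuous g ->
  exists F, forall x : R, is_derive x 1 F (g x).
Proof.
move=> cg.
have ig (a b : R) : mu.-integrable `[a, b] (EFin \o g).
  apply: continuous_compact_integrable; first exact: segment_compact.
  exact: continuous_subspaceT.
pose H a x := \int[mu]_(t in `[a, x]) g t - \int[mu]_(t in `[a, 0]) g t.
have HE a b x : a <= b -> b <= x -> b <= 0 ->
    H a x = \int[mu]_(t in `]b, x]) g t - \int[mu]_(t in `]b, 0]) g t.
  move=> ab bx b0; rewrite /H.
  rewrite -(@Rintegral_itvB _ g (BLeft a) (BRight x) b)//.
  rewrite -(@Rintegral_itvB _ g (BLeft a) (BRight 0) b)//.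
  by rewrite opprB addrA subrK.
pose n x : R := - (`|x| + 1).
have nx x : n x <= x by have := ler_norm (- x); rewrite /n normrN; lra.
have n0 x : n x <= 0 by rewrite /n oppr_le0 addr_ge0.
exists (fun x => H (n x) x) => x.
(* For [y] within 1 of [x], this [a] is at most [n y]. *)
pose a := n x - 1.
have ax : a < x by rewrite /a; have := nx x; lra.
have [dF F'] : derivable (fun y => \int[mu]_(t in [set` Interval (BLeft a) (BRight y)]) g t) x 1 /\
    derive1 (fun y => \int[mu]_(t in [set` Interval (BLeft a) (BRight y)]) g t) x = g x.
  apply: (@continuous_FTC1 _ _ _ _ (x + 1)); [by rewrite ltrDl|exact: ig|exact: ax|exact: cg].
pose K (y : R) : R := \int[mu]_(t in `[a, y]) g t - \int[mu]_(t in `[a, 0]) g t.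
apply: (@near_eq_is_derive _ _ _ K).
  near=> y.
  have ny : a <= n y.
    rewrite /a /n; have : `|x - y| < 1 by near: y; exact: cvgr_dist_lt.
    have := ler_normD (y - x) x; rewrite subrK [`|x - y|]distrC; lra.
  rewrite -[K y]/(H a y) (HE a (n y) y)//; exact/esym/HE.
rewrite -[g x]subr0; apply: is_deriveB.
apply: DeriveDef; first exact: dF.
by rewrite -derive1E.
Unshelve. all: by end_near. Qed.

Lemma is_derive_MVT F f x y : (forall z : R, is_derive z 1 F (f z)) -> x <= y ->
  exists2 c, c \in `[x, y] & F y - F x = f c * (y - x).
Proof.
move=> dF xy; apply: MVT_segment => //.
apply: continuous_subspaceT => z.
by apply: differentiable_continuous; apply/derivable1_diffP; have [] := dF z.
Qed.

Lemma is_derive_continuous F f : (forall z : R, is_derive z 1 F (f z)) -> continuous F.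
Proof.
by move=> dF z; apply: differentiable_continuous; apply/derivable1_diffP; have [] := dF z.
Qed.

Lemma abs_contS a b a' b' f : a <= a' -> b' <= b -> abs_cont a b f -> abs_cont a' b' f.
Proof.
move=> aa bb acf e /acf[d d0 H]; exists d => // n s t st; apply: H => i.
have [as_ [sti tb]] := st i; split; first exact: le_trans as_.
by split=> //; exact: le_trans bb.
Qed.

(** Each interval is cut at [b] into its [lo] and [hi] parts, one of them possibly degenerate,
    giving one family on each side. *)
Lemma abs_cont_cat a b c f : a <= b -> b <= c ->
  abs_cont a b f -> abs_cont b c f -> abs_cont a c f.
Proof.
move=> leab lebc ab bc e e0; have e2 : 0 < e / 2 by rewrite divr_gt0.
have [d d0 H] := ab _ e2; have [d' d'0 H'] := bc _ e2.
exists (Num.min d d'); first by rewrite lt_min d0.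
move=> n s t st dis; rewrite lt_min => /andP[sd sd'].
pose lo x := Num.min x b; pose hi x := Num.max x b.
have lohi x y : x <= y -> [/\ lo x <= lo y, hi x <= hi y,
    lo y - lo x <= y - x, hi y - hi x <= y - x &
    `|f y - f x| <= `|f (lo y) - f (lo x)| + `|f (hi y) - f (hi x)|].
  move=> xy; rewrite /lo /hi.
  case: (leP x b) => xb; case: (leP y b) => yb; split;
    rewrite ?subrr ?normr0 ?addr0 ?add0r//; try lra.
  have := ler_normD (f b - f x) (f y - f b).
  by have -> : f b - f x + (f y - f b) = f y - f x by lra.
have S : \sum_i `|f (lo (t i)) - f (lo (s i))| < e / 2.
  apply: H.
  - move=> i; have [as_ [sti tb]] := st i; have [l _ _ _ _] := lohi _ _ sti.
    by split; [rewrite le_min as_|split; [exact: l|rewrite ge_min lexx orbT]].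
  - move=> i j /dis[h|h]; [left|right]; have [l _ _ _ _] := lohi _ _ h; exact: l.
  - apply: le_lt_trans sd; apply: ler_sum => i _.
    by have [_ [sti _]] := st i; have [] := lohi _ _ sti.
have S' : \sum_i `|f (hi (t i)) - f (hi (s i))| < e / 2.
  apply: H'.
  - move=> i; have [as_ [sti tb]] := st i; have [_ l _ _ _] := lohi _ _ sti.
    by split; [rewrite le_max lexx orbT|split; [exact: l|rewrite ge_max tb]].
  - move=> i j /dis[h|h]; [left|right]; have [_ l _ _ _] := lohi _ _ h; exact: l.
  - apply: le_lt_trans sd'; apply: ler_sum => i _.
    by have [_ [sti _]] := st i; have [] := lohi _ _ sti.
rewrite (splitr e); apply: le_lt_trans (ltrD S S'); rewrite -big_split/=.
by apply: ler_sum => i _; have [_ [sti _]] := st i; have [] := lohi _ _ sti.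
Qed.

Lemma abs_cont_continuous f : (forall a b, abs_cont a b f) -> continuous f.
Proof.
move=> acf x; apply/cvgrPdist_lt => e e0; have [d d0 H] := acf (x - 1) (x + 1) e e0.
have H1 s t : x - 1 <= s -> s <= t -> t <= x + 1 -> t - s < d -> `|f t - f s| < e.
  move=> xs st tx std; have := H 1%N (fun=> s) (fun=> t).
  by rewrite !big_ord1; apply=> // i j; rewrite !ord1.
near=> y.
have yx : `|x - y| < d by near: y; exact: cvgr_dist_lt.
have y1 : `|x - y| < 1 by near: y; exact: cvgr_dist_lt.
move: yx y1; have [xy|/ltW yx] := leP x y.
  rewrite [`|f x - _|]distrC ler0_norm ?subr_le0// opprB => yd yx1.
  by apply: H1 => //; lra.
rewrite ger0_norm ?subr_ge0// => yd yx1; apply: H1 => //; lra.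
Unshelve. all: by end_near. Qed.

(** The factor [c] normalizes [F 1 = 1] and adds [ln c] to [ln F']: this is why [w] is prescribed
    only up to a constant. *)
Lemma exp_antiderivative w : (forall a b, abs_cont a b w) ->
  exists F (c : R), [/\ 0 < c, F 0 = 0, F 1 = 1 &
    forall x : R, is_derive x 1 F (c * expR (w x))].
Proof.
move=> acw; have cw := abs_cont_continuous acw.
have ce : continuous (fun x => expR (w x)).
  by move=> x; apply: continuous_comp; [exact: cw|exact: continuous_expR].
have [G dG] := continuous_antiderivative ce.
have G01 : 0 < G 1 - G 0.
  have [c _ ->] := is_derive_MVT dG ler01.
  by rewrite subr0 mulr1 expR_gt0.
exists (fun x => (G 1 - G 0)^-1 * (G x - G 0)), (G 1 - G 0)^-1.
split; [by rewrite invr_gt0|by rewrite subrr mulr0|by rewrite mulVf// gt_eqF|].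
move=> x; have dGx := dG x.
have := is_deriveZ (G 1 - G 0)^-1 (is_deriveB dGx (is_derive_cst (G 0) x 1)).
by rewrite subr0.
Qed.

Lemma expR_abs_cont w a b : (forall a b, abs_cont a b w) -> abs_cont a b (fun x => expR (w x)).
Proof.
move=> acw; have [ab|] := leP a b; last exact: abs_cont_gt.
have cw := abs_cont_continuous acw.
have [M M0 wM] := @bounded_within _ [set: R] w a b ab (@subsetT _ _)
  (continuous_subspaceT cw).
apply: (abs_cont_dominated (expR_gt0 M) _ (acw a b)) => x y ax xy yb.
apply: expR_lipschitz; apply: le_trans (ler_norm _) (wM _ _); rewrite in_itv/=.
  by rewrite yb (le_trans ax).
by rewrite ax (le_trans xy).
Qed.

Lemma exp_antiderivative_C1AC D w F c : D `<=` limit_point D ->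
  (forall a b, abs_cont a b w) -> 0 < c ->
  (forall x : R, is_derive x 1 F (c * expR (w x))) -> set_bij D D F ->
  C1AC_diffeo D F /\ forall x, D x -> deriv_within D F x = c * expR (w x).
Proof.
move=> limD acw c0 dF bF.
have hd : has_deriv D F (fun x => c * expR (w x)).
  by move=> x Dx; exact: is_derive_diff_quot.
split; last by move=> x Dx; apply: (Defs.derivE limD) => //; exact: hd.
have ac a b : abs_cont a b (fun x => c * expR (w x)).
  apply: (abs_cont_dominated c0 _ (expR_abs_cont a b acw)) => x y _ _ _.
  by rewrite -mulrBr normrM gtr0_norm.
apply: (C1AC_mk limD bF _ hd).
- move=> x y _ _ xy; rewrite -subr_gt0.
  have [z _ ->] := is_derive_MVT dF (ltW xy).
  by rewrite !mulr_gt0 ?expR_gt0// subr_gt0.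
- by apply: continuous_subspaceT => x; exact: abs_cont_continuous.
- by move=> x _; rewrite mulr_gt0// expR_gt0.
- by move=> a b _; exact: ac.
Qed.

End antiderivative.

Lemma eq_deriv_within (R : realType) (D : set R) (F G : R -> R) x :
  D `<=` limit_point D -> C1AC_diffeo D G -> (forall y, D y -> F y = G y) -> D x ->
  deriv_within D F x = deriv_within D G x.
Proof.
move=> limD GD FG Dx; apply: (Defs.derivE limD) => //.
apply: cvg_trans (C1AC_has_deriv GD Dx); apply: near_eq_cvg.
apply: within_dnbhsW; apply: (@filterE _ (nbhs _)) => y _ Dy.
by rewrite /diff_quot !FG.
Qed.

(** * The interval *)

Section interval_curve.
Context {R : realType}.
Local Notation M := (interval_curve R).
Local Notation D := (dom M).
Implicit Types (x y : R) (F G : R -> R) (f g h : Diff M).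

Lemma I_parK x : x \in `[0, 1] -> val (I_par x) = x.
Proof. by move=> xI; rewrite /I_par insubdK. Qed.

Lemma I_par_val (p : I_pt R) : I_par (val p) = p.
Proof. by apply: val_inj; rewrite I_parK//; exact: valP. Qed.

Lemma interval_lift_unique f F x : C1AC_diffeo D F -> is_lift F f -> D x ->
  F x = Diff_lift f x.
Proof.
move=> FD Ff Dx; rewrite -[LHS]I_parK; last exact: C1AC_maps FD Dx.
rewrite -[RHS]I_parK; last exact: (C1AC_maps (Diff_lift_C1AC f) Dx).
have E : par M (F x) = par M (Diff_lift f x).
  by rewrite -(Ff _ Dx) (Diff_lift_is_lift f Dx).
exact: (congr1 (fun p : I_pt R => val p) E).
Qed.

(** An increasing surjection of [[0, 1]] fixes the endpoints. *)
Lemma interval_C1AC_fix F : C1AC_diffeo D F -> F 0 = 0 /\ F 1 = 1.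
Proof.
move=> FD; have [_ _ surj] := C1AC_bij FD.
have D0 : D 0 by rewrite /= in_itv/= lexx ler01.
have D1 : D 1 by rewrite /= in_itv/= lexx ler01.
have nd := C1AC_nd FD (@subset_refl _ D : `[0, 1] `<=` D).
have := C1AC_maps FD D0; have := C1AC_maps FD D1.
rewrite /= !in_itv/= => /andP[_ F1] /andP[F0 _].
have [x Dx Fx] := surj _ D0; have [y Dy Fy] := surj _ D1.
move: Dx Dy; rewrite /= !in_itv/= => /andP[x0 x1] /andP[y0 y1].
split; apply/le_anti/andP; split=> //.
  by rewrite -[leRHS]Fx; exact: nd.
by rewrite -[leLHS]Fy; exact: nd.
Qed.

Lemma interval_Diff_exists F : C1AC_diffeo D F -> exists f : Diff M, is_lift F f.
Proof.
move=> FD; have [H HD FH] := C1AC_inverse (@dom_itv _ M) (@dom_lim _ M) FD.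
have HF x : D x -> H (F x) = x.
  move=> Dx; apply: (C1AC_inj FD); rewrite ?inE//.
    by apply: (C1AC_maps HD); exact: (C1AC_maps FD).
  by rewrite FH//; exact: (C1AC_maps FD).
pose f (p : I_pt R) : I_pt R := I_par (F (val p)).
have Ff : is_lift F (f : pt M -> pt M).
  by move=> x Dx; rewrite /f [val _]I_parK.
have bf : bijective f.
  exists (fun p => I_par (H (val p))) => p; rewrite /f I_parK ?HF ?FH ?I_par_val//;
    try exact: valP.
    exact: (C1AC_maps FD (valP p)).
  exact: (C1AC_maps HD (valP p)).
have fP : is_diff1AC (f : pt M -> pt M) by split=> //; exists F.
by exists (MkDiff fP).
Qed.

Lemma interval_based f : based f.
Proof.
have [F0 F1] := interval_C1AC_fix (Diff_lift_C1AC f).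
by exists (Diff_lift f); split=> //; [exact: Diff_lift_C1AC|exact: Diff_lift_is_lift].
Qed.

Lemma interval_Diff_deriv f F x : C1AC_diffeo D F -> is_lift F f -> D x ->
  Diff_deriv f x = deriv_within D F x.
Proof.
move=> FD Ff Dx; apply/esym/(eq_deriv_within (@dom_lim _ M) (Diff_lift_C1AC f)) => // y Dy.
exact: interval_lift_unique.
Qed.

Let clamp x : R := Num.max 0 (Num.min 1 x).

(** [w] is continued by constants through the 1-Lipschitz [clamp], so that antiderivatives can be
    taken on the whole line. *)
Lemma interval_realize w : abs_cont 0 1 w -> exists2 f : Diff M, based f &
  forall x, x \in `[0, 1] -> log_deriv f x - log_deriv f 0 = w x - w 0.
Proof.
move=> acw.
have clampE x : x \in `[0, 1] -> clamp x = x.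
  by rewrite in_itv/= => /andP[x0 x1]; rewrite /clamp min_r// max_r.
have clampP x y : x <= y -> clamp x <= clamp y /\ clamp y - clamp x <= y - x.
  rewrite /clamp => xy; case: (leP 1 x) => ?; case: (leP 1 y) => ?;
  case: (leP 0 x) => ?; case: (leP 0 y) => ?; rewrite ?(max_r ler01)//; split; lra.
have acv a b : abs_cont a b (w \o clamp).
  apply: (@abs_cont_comp _ a b w clamp).
  - apply: abs_contS acw; first by rewrite le_max lexx.
    by rewrite ge_max ler01 ge_min lexx.
  - apply: (abs_cont_lip ltr01) => s t _ st _; have [c1 c2] := clampP _ _ st.
    by rewrite mul1r ger0_norm ?subr_ge0.
  - by move=> s t _ st _; have [] := clampP _ _ st.
have [F [c [c0 F0 F1 dF]]] := exp_antiderivative acv.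
have incF x y : x < y -> F x < F y.
  move=> xy; rewrite -subr_gt0; have [z _ ->] := is_derive_MVT dF (ltW xy).
  by rewrite !mulr_gt0 ?expR_gt0// subr_gt0.
have ndF x y : x <= y -> F x <= F y.
  by rewrite le_eqVlt => /predU1P[->//|/incF/ltW].
have bF : set_bij D D F.
  split.
  - move=> x; rewrite /= !in_itv/= => /andP[x0 x1].
    by rewrite -[X in X <= F x]F0 -[X in F x <= X]F1 !ndF.
  - move=> x y _ _ Fxy; apply: contrapT => /eqP; rewrite neq_lt.
    by move=> /orP[] /incF; rewrite Fxy ltxx.
  - move=> y; rewrite /= in_itv/= => /andP[y0 y1].
    have cF : {within `[0, 1], continuous F}.
      exact: continuous_subspaceT (is_derive_continuous dF).
    have [|x xI Fx] := @IVT _ F 0 1 y ler01 cF; last by exists x.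
    by rewrite F0 F1 min_l// max_r// y0 y1.
have [FD F'] := exp_antiderivative_C1AC (@dom_lim _ M) acv c0 dF bF.
have [f Ff] := interval_Diff_exists FD.
exists f; first exact: interval_based.
have ln' x : x \in `[0, 1] -> log_deriv f x = ln c + w x.
  move=> xI; rewrite log_derivE (interval_Diff_deriv FD Ff)// F'//.
  by rewrite lnM ?posrE ?expR_gt0// expRK /= clampE.
move=> x xI; rewrite !ln'//; first lra.
by rewrite in_itv/= lexx ler01.
Qed.

Lemma interval_coarse_curve : coarse_curve M false.
Proof.
have D0 : D 0 by rewrite /= in_itv/= lexx ler01.
split.
- by [].
- exact: interval_Diff_deriv.
- by move=> p q; exact: normr_ge0.
- by move=> x y xI yI; rewrite /dist/= /I_dist !I_parK.
- by move=> p; exists (val p); [exact: valP|rewrite [par _ _]I_par_val].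
- by move=> f g h; have [-> ->] := interval_C1AC_fix (Diff_lift_C1AC h).
- by [].
- by move=> w acw _; exact: interval_realize.
- move=> s cs; exists 0 => f; exists f; split; first exact: interval_based.
    exact: log_dist_refl.
  by rewrite (crp_refl cs).
Qed.

End interval_curve.

(** * The circle *)

Section circle_lifts.
Context {R : realType}.
Local Notation M := (circle_curve R).
Implicit Types (x y : R) (F G : R -> R) (f g h : Diff M).

Lemma S1_parP x y : S1_par x = S1_par y <-> exists k : int, x = y + k%:~R.
Proof.
split=> [/eqquotP|[k ->]].
  by rewrite /= /int_congruent => /intrP[k xyk]; exists k; rewrite -xyk; ring.
apply/eqquotP; rewrite /= /int_congruent addrAC subrr add0r.
exact: intr_int.
Qed.

Lemma S1_par_repr (p : S1_pt R) : S1_par (repr p) = p.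
Proof. by rewrite /S1_par reprK. Qed.

(** Otherwise the intermediate value theorem yields the value [min + 1/2], which is not an
    integer. *)
Lemma continuous_int_constant (k : R -> R) : continuous k ->
  (forall x, k x \is a Num.int) -> forall x y, k x = k y.
Proof.
move=> ck ik x y; wlog xy : x y / x <= y.
  by move=> H; have [/H|/ltW/H/esym] := leP x y.
apply: contrapT => /eqP kxy.
pose v := Num.min (k x) (k y) + 2^-1.
have mi : Num.min (k x) (k y) \is a Num.int by case: leP.
have lt1 (a b : R) : a \is a Num.int -> b \is a Num.int -> a < b -> a + 1 <= b.
  move=> /intrP[m ->] /intrP[n ->]; rewrite ltr_int => mn.
  by rewrite -[1]/(1%:~R) -intrD ler_int lezD1.
have vle : v <= Num.max (k x) (k y).
  move: kxy; rewrite neq_lt /v; case: (ltgtP (k x) (k y)) => // h _.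
    by have := lt1 _ _ (ik x) (ik y) h; lra.
  by have := lt1 _ _ (ik y) (ik x) h; lra.
have vge : Num.min (k x) (k y) <= v by rewrite /v lerDl.
have ckxy : {within `[x, y], continuous k} by exact: continuous_subspaceT.
have [|c _ kc] := @IVT _ k x y v xy ckxy; first by rewrite vge vle.
have : v - Num.min (k x) (k y) \is a Num.int by rewrite rpredB// -kc.
rewrite /v addrAC subrr add0r => /intrP[n n2].
(* One half would be the integer [n]; parity of [2 n = 1] is the contradiction. *)
have : (2 * n)%:~R = 1%:~R :> R by rewrite intrM -n2 mulfV.
by move=> /intr_inj/(congr1 (odd \o absz)); rewrite /= abszM oddM.
Qed.

Lemma C1AC_circle_continuous F : C1AC_diffeo [set: R] F -> continuous F.
Proof.
move=> FD x; have := derivable_cont (C1AC_has_deriv FD (I : [set: R] x)).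
by move=> H U /H; rewrite /within/= /nbhs/=; apply: filterS => y; exact.
Qed.

(** The difference of two lifts is continuous and integer-valued. *)
Lemma circle_lift_unique f F G : C1AC_diffeo [set: R] F -> is_lift F f ->
  C1AC_diffeo [set: R] G -> is_lift G f -> forall x, F x = G x + (F 0 - G 0).
Proof.
move=> FD Ff GD Gf x.
have cF := C1AC_circle_continuous FD; have cG := C1AC_circle_continuous GD.
have cFG : continuous (fun x => F x - G x).
  by move=> z; apply: cvgB; [exact: cF|exact: cG].
have iFG z : F z - G z \is a Num.int.
  have /S1_parP[k ->] : S1_par (F z) = S1_par (G z).
    by rewrite -[LHS](Ff z I) -[RHS](Gf z I).
  by rewrite addrAC subrr add0r intr_int.
by rewrite (continuous_int_constant cFG iFG 0 x) subrKC.
Qed.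

Lemma deriv_within_shift F (c x : R) :
  deriv_within [set: R] (fun y => F y + c) x = deriv_within [set: R] F x.
Proof.
rewrite /deriv_within; have -> // : diff_quot (fun y => F y + c) x = diff_quot F x.
by apply/funext => y; rewrite /diff_quot; congr (_ / _); ring.
Qed.

Lemma circle_Diff_deriv f F x : C1AC_diffeo [set: R] F -> is_lift F f ->
  Diff_deriv f x = deriv_within [set: R] F x.
Proof.
move=> FD Ff; have LD := Diff_lift_C1AC f; have Lf := @Diff_lift_is_lift _ _ f.
rewrite /Diff_deriv -[RHS](deriv_within_shift F (Diff_lift f 0 - F 0) x).
congr (deriv_within _ _ x); apply/funext => y.
exact: (circle_lift_unique LD Lf FD Ff).
Qed.

Lemma C1AC_add_cst (b c : R) F : C1AC_diffeo [set: R] F ->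
  C1AC_diffeo [set: R] (fun x => F (x + b) + c).
Proof.
move=> FD.
have T (a : R) : C1AC_diffeo [set: R] (fun x => x + a).
  have d x : [set: R] x -> diff_quot (fun x => x + a) x @ within [set: R] x^' --> (1 : R).
    move=> _; apply: is_derive_diff_quot.
    by have := is_deriveD (is_derive_id x (1 : R)) (is_derive_cst a x 1); rewrite addr0.
  apply: (C1AC_mk (@S1_dom_lim R) _ _ (F' := cst 1) d) => //.
  - split=> //; first by move=> x y _ _ /addIr.
    by move=> y _; exists (y - a) => //; rewrite subrK.
  - by move=> x y _ _; rewrite ltrD2r.
  - by apply: continuous_subspaceT => x; exact: cvg_cst.
  - move=> r t _; apply: (abs_cont_lip ltr01) => x y _ xy _.
    by rewrite subrr normr0 mul1r subr_ge0.
have itv : is_interval [set: R] by [].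
exact: (C1AC_comp itv (@S1_dom_lim R) (T c) (C1AC_comp itv (@S1_dom_lim R) FD (T b))).
Qed.

(** [F (x + 1)] is another lift, so it is [F x + k] with an integer [k], positive by monotonicity.
    If [k > 1], the value [F 0 + 1] is taken at some [y] strictly between 0 and 1, and [f]
    identifies the distinct points of parameters 0 and [y]. *)
Lemma circle_lift_period f F : C1AC_diffeo [set: R] F -> is_lift F f ->
  forall x, F (x + 1) = F x + 1.
Proof.
move=> FD Ff; pose G x := F (x + 1) + 0.
have GD : C1AC_diffeo [set: R] G by exact: C1AC_add_cst.
have Gf : is_lift G f.
  move=> x _; rewrite /G addr0 -[RHS](Ff (x + 1) I); congr (f _).
  by apply/S1_parP; exists (-1); rewrite mulrN1z addrK.
have FG x : F (x + 1) = F x + (F 1 - F 0).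
  have := circle_lift_unique GD Gf FD Ff x; rewrite /G !addr0 add0r.
  by [].
have [k kE] : exists k : int, F 1 = F 0 + k%:~R.
  apply/S1_parP; have /S1_parP e : exists k : int, (1 : R) = 0 + k%:~R by exists 1; rewrite add0r.
  by rewrite -[LHS](Ff 1 I) -[RHS](Ff 0 I) [par M 1]e.
have F01 : F 0 < F 1 by apply: (C1AC_incr FD).
have k0 : 0 < k by rewrite -(ltr_int R) -(ltrD2l (F 0)) addr0 -kE.
suff k1 : k = 1 by move=> x; rewrite FG kE addrAC subrr add0r k1.
apply: contrapT => k1.
have k2 : 1 < k by rewrite lt_neqAle eq_sym -gtz0_ge1 k0 andbT; apply/eqP.
have [_ _ surj] := C1AC_bij FD; have [y _ Fy] := surj (F 0 + 1) I.
have mono u v : F u < F v -> u < v.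
  move=> uv; rewrite ltNge; apply/negP; rewrite le_eqVlt => /predU1P[vu|vu].
    by move: uv; rewrite vu ltxx.
  by have := C1AC_incr FD I I vu; rewrite ltNge (ltW uv).
have y0 : 0 < y by apply: mono; rewrite Fy ltrDl.
have y1 : y < 1 by apply: mono; rewrite Fy kE ltrD2l ltr1z.
have [g fK _] := (Defs.diffP f).1.
have : S1_par y = S1_par 0.
  apply: (can_inj fK); rewrite [LHS](Ff y I) [RHS](Ff 0 I) Fy.
  by apply/S1_parP; exists 1.
move=> /S1_parP[n]; rewrite add0r => yn.
move: y0 y1; rewrite yn ltr0z ltrz1; case: n yn => [[|n]|n] //.
Qed.

Lemma circle_shift_int F : (forall x, F (x + 1) = F x + 1) ->
  forall (k : int) x, F (x + k%:~R) = F x + k%:~R.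
Proof.
move=> F1.
have nat_shift (n : nat) x : F (x + n%:R) = F x + n%:R.
  elim: n => [|n IH]; first by rewrite !addr0.
  by rewrite -natr1 !addrA F1 IH.
case=> n x; first exact: nat_shift.
rewrite NegzE mulrNz; apply/eqP; rewrite -subr_eq opprK; apply/eqP.
by rewrite -[LHS]nat_shift subrK.
Qed.

(** Equivariance under integer shifts makes the map defined through [repr] independent of the
    representative. *)
Lemma circle_Diff_exists F : C1AC_diffeo [set: R] F -> (forall x, F (x + 1) = F x + 1) ->
  exists f : Diff M, is_lift F f.
Proof.
move=> FD F1; have Fk := circle_shift_int F1.
have [H HD FH] := C1AC_inverse (@dom_itv _ M) (@dom_lim _ M) FD.
have Finj x y : F x = F y -> x = y by apply: (C1AC_inj FD); rewrite inE.
have HF x : H (F x) = x by apply: Finj; rewrite FH.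
have H1 x : H (x + 1) = H x + 1 by apply: Finj; rewrite F1 !FH.
have Hk := circle_shift_int H1.
pose q G (p : S1_pt R) : S1_pt R := S1_par (G (repr p)).
have qE G : (forall (k : int) x, G (x + k%:~R) = G x + k%:~R) ->
    forall x, q G (S1_par x) = S1_par (G x).
  move=> Gk x; rewrite /q; have /S1_parP[k ->] := S1_par_repr (S1_par x).
  by rewrite Gk; apply/S1_parP; exists k.
have bf : bijective (q F).
  by exists (q H) => p; rewrite -(S1_par_repr p) !qE ?HF ?FH.
have Ff : is_lift F (q F : pt M -> pt M) by move=> x _; exact: qE.
have fP : is_diff1AC (q F : pt M -> pt M) by split=> //; exists F.
by exists (MkDiff fP).
Qed.

End circle_lifts.

Section circle_curve.
Context {R : realType}.
Local Notation M := (circle_curve R).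
Local Notation TV := total_variation.
Implicit Types (x y : R) (F G w : R -> R) (f g h : Diff M).

Lemma periodic_int (u : R -> R) : (forall x, u (x + 1) = u x) ->
  forall (k : int) x, u (x + k%:~R) = u x.
Proof.
move=> u1; have un (n : nat) x : u (x + n%:R) = u x.
  by elim: n x => [|n IH] x; rewrite ?addr0// -natr1 addrA u1.
case=> n x; first exact: un.
by rewrite NegzE mulrNz -[LHS](un n.+1) subrK.
Qed.

Lemma total_variation_shift (a b c : R) (u : R -> R) : a <= b ->
  TV (a + c) (b + c) u = TV a b (fun x => u (x + c)).
Proof.
move=> ab; apply/le_anti/andP; split.
  have E : u = (fun x => u (x + c)) \o (fun x => x - c).
    by apply/funext => x /=; rewrite subrK.
  rewrite [X in (TV _ _ X <= _)%E]E.
  apply: (le_trans (@total_variation_comp_le _ (a + c) (b + c) _ _ _ _)).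
  - by rewrite lerD2r.
  - by move=> x y _ xy _; rewrite ltrD2r.
  - by rewrite !addrK.
apply: (@total_variation_comp_le _ a b u (fun x => x + c)) => // x y _ xy _.
by rewrite ltrD2r.
Qed.

(** With [t] the fractional part of [a], the interval [[t, t + 1]] is cut at 1 and the piece
    [[1, t + 1]] is moved back to [[0, t]]. *)
Lemma total_variation_periodic (a : R) (u : R -> R) : (forall x, u (x + 1) = u x) ->
  TV a (a + 1) u = TV 0 1 u.
Proof.
move=> u1; have uk := periodic_int u1.
have TVk (k : int) (r t : R) : r <= t -> TV (r + k%:~R) (t + k%:~R) u = TV r t u.
  by move=> rt; rewrite total_variation_shift//; congr total_variation; exact/funext.
have /andP[f0 f1] := floor_itv a; rewrite intrD in f1.
set k := Num.floor a in f0 f1; pose t := a - k%:~R.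
have t0 : 0 <= t by rewrite subr_ge0.
have t1 : t <= 1 by rewrite /t; lra.
have aE : a = t + k%:~R by rewrite subrK.
have aE1 : a + 1 = t + 1 + k%:~R by rewrite aE addrAC.
rewrite {1}aE aE1 (TVk k t (t + 1)); last by rewrite lerDl.
rewrite (@total_variationD _ t (t + 1) 1)//; last by rewrite lerDr.
rewrite -[X in TV X (t + 1)]add0r (TVk 1 0 t t0) addeC.
by rewrite -total_variationD.
Qed.

Lemma S1_dist_ge0 (p q : S1_pt R) : 0 <= S1_dist p q.
Proof.
apply: lb_le_inf; first by exists `|repr p - repr q + 0%:~R|; exists 0.
by move=> _ [k _ <-].
Qed.

Lemma S1_dist_par x y : S1_dist (S1_par x) (S1_par y) <= `|x - y|.
Proof.
have /S1_parP[m xm] := S1_par_repr (S1_par x).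
have /S1_parP[n yn] := S1_par_repr (S1_par y).
apply: ge_inf; first by exists 0 => _ [k _ <-].
exists (n - m) => //; rewrite xm yn intrB; congr `|_|; ring.
Qed.

Lemma S1_par_unit_interval (p : S1_pt R) : exists2 x, x \in `[0, 1] & p = S1_par x.
Proof.
have /andP[f0 f1] := floor_itv (repr p); rewrite intrD in f1.
exists (repr p - (Num.floor (repr p))%:~R).
  by rewrite in_itv/=; apply/andP; split; lra.
rewrite -[LHS]S1_par_repr; apply/S1_parP; exists (Num.floor (repr p)).
by rewrite subrK.
Qed.

Lemma circle_log_deriv_periodic f x : log_deriv f (x + 1) = log_deriv f x.
Proof.
have FD := Diff_lift_C1AC f; have F1 := circle_lift_period FD (@Diff_lift_is_lift _ _ f).
rewrite log_derivE; congr ln; rewrite /Diff_deriv.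
set F := Diff_lift f in FD F1 *.
rewrite -[RHS](deriv_within_shift F 1 x).
have -> : (fun y => F y + 1) = F \o (fun y => y + 1) by apply/funext => y; rewrite /= F1.
apply/esym/(Defs.derivE (@S1_dom_lim R)) => //; rewrite -[X in _ --> X]mulr1.
apply: Defs.deriv_comp => //; first by move=> y z _ _ /addIr.
  apply: is_derive_diff_quot.
  by have := is_deriveD (is_derive_id x (1 : R)) (is_derive_cst (1 : R) x 1); rewrite addr0.
exact: (C1AC_has_deriv FD).
Qed.

(** [w] is extended periodically; its antiderivative normalized on [[0, 1]] then commutes with the
    shift by 1 and descends to the circle. *)
Lemma circle_realize w : abs_cont 0 1 w -> w 0 = w 1 -> exists2 f : Diff M, based f &
  forall x, x \in `[0, 1] -> log_deriv f x - log_deriv f 0 = w x - w 0.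
Proof.
move=> acw w01; pose v x := w (x - (Num.floor x)%:~R).
(* At the right end [x = k + 1] the definition of [v] gives [w 0]; here [w 0 = w 1] is used. *)
have vE (k : int) x : k%:~R <= x -> x <= (k + 1)%:~R -> v x = w (x - k%:~R).
  move=> kx; rewrite le_eqVlt => /predU1P[->|xk].
    by rewrite /v intrKfloor subrr intrD addrAC subrr add0r.
  by rewrite /v (floor_def (m := k))// kx.
have v1 x : v (x + 1) = v x.
  rewrite /v floorDrz ?rpred1// (_ : Num.floor (1 : R) = 1).
    by rewrite intrD opprD addrACA subrr addr0.
  by rewrite -[X in Num.floor X]/(1%:~R) intrKfloor.
have ac1 (k : int) : abs_cont k%:~R (k%:~R + 1) v.
  apply: (@eq_abs_cont _ _ _ (w \o (fun x => x - k%:~R))).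
    move=> x; rewrite in_itv/= => /andP[kx xk].
    by rewrite (vE k)// intrD.
  apply: (@abs_cont_comp _ k%:~R (k%:~R + 1) w (fun x => x - k%:~R)).
  - by rewrite subrr addrAC subrr add0r.
  - apply: (abs_cont_lip ltr01) => s t _ st _.
    by rewrite opprB addrA subrK mul1r ger0_norm ?subr_ge0.
  - by move=> s t _ st _; rewrite lerD2r.
have acn (k : int) (n : nat) : abs_cont k%:~R (k%:~R + n%:R) v.
  elim: n => [|n IH].
    rewrite addr0; apply: abs_contS (ac1 k) => //; by rewrite lerDl.
  rewrite -natr1 addrA; apply: (abs_cont_cat _ _ IH); [by rewrite lerDl|by rewrite lerDl|].
  have := ac1 (k + n%:Z); rewrite intrD; exact.
have acv a b : abs_cont a b v.
  have n0 : b - (Num.floor a)%:~R <= (Num.truncn (b - (Num.floor a)%:~R)).+1%:R.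
    exact/ltW/truncnS_gt.
  by apply: abs_contS (acn (Num.floor a) (Num.truncn (b - (Num.floor a)%:~R)).+1);
    [exact: floor_le|rewrite -lerBlDl].
have [F [c [c0 F0 F1 dF]]] := exp_antiderivative acv.
(* By periodicity of [v] the derivative of [F (x + 1) - F x] vanishes, and at 0 this difference is
   1. *)
have Fp x : F (x + 1) = F x + 1.
  have d0 (z : R) : is_derive z 1 (fun x => F (x + 1) - F x) 0.
    have -> : 0 = c * expR (v (z + 1)) * 1 - c * expR (v z) by rewrite v1 mulr1 subrr.
    apply: is_deriveB.
    apply: (@is_derive1_comp _ F (fun x => x + 1)).
    by have := is_deriveD (is_derive_id z (1 : R)) (is_derive_cst (1 : R) z 1); rewrite addr0.
  have := is_derive_0_is_cst x 0 d0; rewrite /= add0r F0 F1 subr0 => e.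
  by rewrite -[LHS](subrKC (F x)) e.
have incF x y : x < y -> F x < F y.
  move=> xy; rewrite -subr_gt0; have [z _ ->] := is_derive_MVT dF (ltW xy).
  by rewrite !mulr_gt0 ?expR_gt0// subr_gt0.
have bF : set_bij [set: R] [set: R] F.
  split=> //.
  - move=> x y _ _ Fxy; apply: contrapT => /eqP; rewrite neq_lt.
    by move=> /orP[] /incF; rewrite Fxy ltxx.
  - move=> y _; have Fk := circle_shift_int Fp.
    have /andP[f0 f1] := floor_itv y; rewrite intrD in f1.
    have e (k : int) : F k%:~R = k%:~R by rewrite -[in LHS](add0r k%:~R) Fk F0 add0r.
    have e1 : F ((Num.floor y)%:~R + 1) = (Num.floor y)%:~R + 1 by rewrite Fp e.
    have cF : {within `[(Num.floor y)%:~R, (Num.floor y)%:~R + 1], continuous F}.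
      exact: continuous_subspaceT (is_derive_continuous dF).
    have le1 : (Num.floor y)%:~R <= (Num.floor y)%:~R + 1 :> R by rewrite lerDl.
    have [|x _ Fx] := @IVT _ F _ _ y le1 cF; last by exists x.
    by rewrite e e1 min_l// max_r// f0 ltW.
have [FD F'] := exp_antiderivative_C1AC (@dom_lim _ M) acv c0 dF bF.
have [f Ff] := circle_Diff_exists FD Fp.
exists f; first by exists F.
have ln' x : x \in `[0, 1] -> log_deriv f x = ln c + w x.
  rewrite in_itv/= => /andP[x0 x1]; rewrite log_derivE (circle_Diff_deriv _ FD Ff) F'//.
  by rewrite lnM ?posrE ?expR_gt0// expRK (vE 0)// subr0.
move=> x xI; rewrite !ln'//; first lra.
by rewrite in_itv/= lexx ler01.
Qed.

End circle_curve.

(** * Rotations *)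

Section rotations.
Context {R : realType}.
Local Notation M := (circle_curve R).
Local Notation TV := total_variation.
Implicit Types (x y t : R) (f g h : Diff M).

Lemma C1AC_translation t : C1AC_diffeo [set: R] (fun x => x + t).
Proof.
have := C1AC_add_cst 0 t (C1AC_id (@S1_dom_lim R)).
by under eq_fun do rewrite addr0.
Qed.

Lemma rotation_exists t : exists r : Diff M, is_lift (fun x => x + t) r.
Proof.
by apply: (circle_Diff_exists (C1AC_translation t)) => x; rewrite addrAC.
Qed.

Definition rotation t : Diff M := projT1 (cid (rotation_exists t)).

Lemma rotationE t x : rotation t (S1_par x) = S1_par (x + t).
Proof. by rewrite /rotation; case: cid => r /= rt; exact: rt. Qed.

Lemma circle_Diff_eq f g : (forall x, f (S1_par x) = g (S1_par x)) -> f = g.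
Proof. by move=> fg; apply: Diff_ext => p; rewrite -(S1_par_repr p). Qed.

Lemma Diff_mulE f g (p : pt M) : (f * g)%g p = f (g p).
Proof. by []. Qed.

Lemma rotation0 : rotation 0 = 1%g.
Proof. by apply: circle_Diff_eq => x; rewrite rotationE addr0. Qed.

Lemma rotationD t u : rotation (t + u) = (rotation t * rotation u)%g.
Proof.
apply: circle_Diff_eq => x; rewrite rotationE Diff_mulE !rotationE.
by rewrite -addrA [u + t]addrC.
Qed.

Lemma rotation_int t (k : int) : rotation (t + k%:~R) = rotation t.
Proof.
by apply: circle_Diff_eq => x; rewrite !rotationE; apply/S1_parP; exists k; rewrite addrA.
Qed.

Lemma Diff_deriv_rotation t x : Diff_deriv (rotation t) x = 1.
Proof.
rewrite (circle_Diff_deriv x (C1AC_translation t)).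
  apply: (Defs.derivE (@S1_dom_lim R)) => //; apply: is_derive_diff_quot.
  by have := is_deriveD (is_derive_id x (1 : R)) (is_derive_cst t x 1); rewrite addr0.
by move=> y _; exact: rotationE.
Qed.

Lemma Diff_rho_rotation t : (Diff_rho 1%g (rotation t) <= `|t|%:E)%E.
Proof.
have E u x : Diff_deriv (rotation u) x - Diff_deriv (rotation t) x = 0.
  by rewrite !Diff_deriv_rotation subrr.
rewrite -rotation0 /Diff_rho integral_Diff_deriv2//.
have -> : TV 0 1 (fun x => Diff_deriv (rotation 0) x - Diff_deriv (rotation t) x) = 0%E.
  under eq_fun do rewrite E.
  rewrite nondecreasing_total_variation//; first by rewrite subrr.
rewrite adde0 -[leRHS]adde0; apply: leeD; apply: ge_ereal_sup => _ [x xI <-]; rewrite lee_fin.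
  have [y _ ->] := S1_par_unit_interval x; rewrite !rotationE addr0.
  by rewrite (le_trans (S1_dist_par _ _))// opprD addNKr normrN.
by rewrite E normr0.
Qed.

(** Modulo 1 the angle lies in [[0, 1]], and [n] steps of angle below [e] reach it, each of cost at
    most 1 by right-invariance; [n] depends on [s] alone. *)
Lemma crp_rotation_bounded (s : Diff M -> Diff M -> R) :
  continuous_right_invariant_pseudometric s ->
  exists C, forall t, s (rotation t) 1%g <= C.
Proof.
move=> cs.
have /cvgrPdist_lt/(_ 1 ltr01) :=
  crp_continuous cs (x := (1%g : Diff M, 1%g : Diff M)).
rewrite /= (crp_refl cs) => -[[A B] /= [A1 B1] AB].
move: B1; rewrite nbhsE => -[V [oV V1] VB].
have [e e0 Ve] := oV _ V1.
have small t : `|t| < e -> s 1%g (rotation t) <= 1.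
  move=> te; have b : V (rotation t).
    by apply: Ve; apply: le_lt_trans (Diff_rho_rotation t) _; rewrite lte_fin.
  have /= := AB (1%g, rotation t) (conj (nbhs_singleton A1) (VB _ b)).
  by rewrite sub0r normrN => /(le_lt_trans (ler_norm _))/ltW.
pose n := (Num.truncn e^-1).+1.
have ne : n%:R^-1 < e by rewrite invf_plt ?posrE// truncnS_gt.
exists (1 *+ n) => t.
have /andP[f0 f1] := floor_itv t; rewrite intrD in f1.
pose u := t - (Num.floor t)%:~R.
have -> : rotation t = rotation u by rewrite -(rotation_int u (Num.floor t)) subrK.
have u0 : 0 <= u by rewrite subr_ge0.
have u1 : u <= 1 by rewrite /u; lra.
have step (k : nat) : s (rotation (u / n%:R *+ k)) (rotation (u / n%:R *+ k.+1)) <= 1.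
  rewrite [X in s _ (rotation X)]mulrS rotationD -[X in s X _]mul1g (crp_right cs); apply: small.
  rewrite ger0_norm ?divr_ge0//; apply: le_lt_trans ne.
  by rewrite ler_piMl.
have := @crp_chain _ _ s cs n (fun k => rotation (u / n%:R *+ k)) 1 (fun k _ => step k).
rewrite mulr0n rotation0 -[_ *+ n]mulr_natr divfK ?pnatr_eq0//.
by rewrite (crp_sym cs).
Qed.

(** [f] is the rotation by [F 0] after the map [f0] lifted by [F - F 0]. The two have the same
    derivative, and right-invariance turns [s f f0] into the distance from the rotation to 1. *)
Lemma circle_base (s : Diff M -> Diff M -> R) :
  continuous_right_invariant_pseudometric s ->
  exists C, forall f, exists f0, [/\ based f0, log_dist f f0 = 0 & s f f0 <= C].
Proof.
move=> cs; have [C HC] := crp_rotation_bounded cs; exists C => f.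
have FD := Diff_lift_C1AC f; have Ff := @Diff_lift_is_lift _ _ f.
have F1 := circle_lift_period FD Ff; set F := Diff_lift f in FD Ff F1.
pose G x := F (x + 0) + - F 0.
have GD : C1AC_diffeo [set: R] G by exact: C1AC_add_cst.
have G1 x : G (x + 1) = G x + 1 by rewrite /G !addr0 F1 addrAC.
have [f0 Gf] := circle_Diff_exists GD G1.
have G0 : G 0 = 0 by rewrite /G addr0 subrr.
exists f0; split.
- by exists G; split=> //; rewrite -[1]add0r G1 G0 add0r.
- apply: eq_log_dist0 => x _; rewrite !log_derivE.
  have E y : Diff_deriv f0 y = Diff_deriv f y.
    rewrite (circle_Diff_deriv y GD Gf) /Diff_deriv -/F.
    rewrite -(deriv_within_shift F (- F 0) y); congr (deriv_within _ _ y).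
    by apply/funext => z; rewrite /G addr0.
  by rewrite !E.
- have -> : f = (rotation (F 0) * f0)%g.
    apply: circle_Diff_eq => x; rewrite Diff_mulE [f0 _](Gf x I) rotationE.
    by rewrite /G addr0 subrK; exact: Ff.
  by rewrite -[X in s _ X]mul1g (crp_right cs).
Qed.

Lemma circle_coarse_curve : coarse_curve M true.
Proof.
split.
- by [].
- by move=> f F x FD Ff _; exact: circle_Diff_deriv.
- exact: S1_dist_ge0.
- by move=> x y _ _; exact: S1_dist_par.
- exact: S1_par_unit_interval.
- move=> f g h.
  have := circle_lift_period (Diff_lift_C1AC h) (@Diff_lift_is_lift _ _ h) 0.
  rewrite add0r => ->; apply: total_variation_periodic => x.
  by rewrite !circle_log_deriv_periodic.
- by move=> f _; rewrite -[1]add0r circle_log_deriv_periodic.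
- by move=> w acw w01; apply: circle_realize => //; exact: w01.
- exact: circle_base.
Qed.

End rotations.

(** * The space [L1(I)] and its hyperplanes *)

Section L1_unit_interval.
Context {R : realType}.
Local Notation mu := (@lebesgue_measure R).
Let m01 : measurable (`[0%R, 1%R]%classic : set (measurableTypeR R)) := measurable_itv `[0%R, 1%R].
Local Notation nu := (mrestr mu m01).
Implicit Types (u w : R -> R) (v : L1I R).

(** [L1I] lives on the whole line with the restricted measure: the complement of [[0, 1]] is null,
    and the two measures agree on subsets of [[0, 1]]. *)
Lemma ge0_integral_mrestr01 (f : R -> \bar R) : measurable_fun setT f ->
  (forall x, (0 <= f x)%E) ->
  (\int[nu]_x f x = \int[mu]_(x in `[0%R, 1%R]) f x)%E.
Proof.
move=> mf f0.
have nuC : nu (~` `[0%R, 1%R]%classic) = 0%E by rewrite /mrestr setICl measure0.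
rewrite (@ge0_negligible_integral _ _ _ nu setT (~` `[0%R, 1%R]%classic))//; first last.
  exact: measurableC.
have E : [set: R] `\` ~` `[0%R, 1%R]%classic = `[0%R, 1%R]%classic by rewrite setTD setCK.
rewrite [X in integral _ X _](E : _ = _); apply: eq_measure_integral => A mA AI.
have {}AI : A `&` `[0%R, 1%R]%classic = A by exact: setIidl.
exact: (congr1 mu AI).
Qed.

Lemma ae_mrestr01 (P : R -> Prop) :
  {ae nu, forall x, P x} <-> {ae mu, forall x, x \in `[0, 1] -> P x}.
Proof.
split=> -[N [mN N0 PN]].
  exists (N `&` `[0%R, 1%R]%classic); split; [exact: measurableI|exact: N0|].
  move=> x /= /not_implyP[xI Px]; split=> //; exact: PN.
exists (N `|` ~` `[0%R, 1%R]%classic); split.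
- by apply: measurableU => //; exact: measurableC.
- rewrite /mrestr setIUl setICl setU0; apply: subset_measure0 N0 => //; exact: measurableI.
- move=> x /= Px; have [xI|] := pselect (x \in `[0, 1]); last by right.
  by left; apply: PN => /= /(_ xI).
Qed.

Lemma L1_normE v : `|v| = \int[mu]_(x in `[0, 1]) `|Lrepr v x|.
Proof.
have /andP[/[!inE]/= mv _] := Lrepr_Lfun v.
transitivity (fine 'N[nu]_1[EFin \o Lrepr v]%E) => [//|].
rewrite Lnorm1 ge0_integral_mrestr01//.
by apply: measurableT_comp => //; exact/measurable_EFinP.
Qed.

Lemma integrable_Lfun u : mu.-integrable setT (EFin \o u) -> u \in Lfun nu 1%E.
Proof.
move=> /integrableP[mu_ fu]; have mu' : measurable_fun setT u by exact/measurable_EFinP.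
apply/andP; split; rewrite inE//=.
rewrite /finite_norm Lnorm1 ge0_integral_mrestr01//.
  apply: le_lt_trans fu; apply: ge0_subset_integral => //.
  exact: measurableT_comp.
exact: measurableT_comp.
Qed.

Definition L1_class u (iu : mu.-integrable setT (EFin \o u)) : L1I R :=
  Lclass (lexx 1%E) (integrable_Lfun iu).

End L1_unit_interval.

Section hyperplane_kernel.
Context {R : realType} (V : normedModType R).

(** The bound makes the functional continuous, so its kernel is closed, and [v - phi v *: e] lies in
    the kernel. *)
Lemma hyperplane_kernel (phi : V -> R) (e : V) :
  (forall (a : R) u v, phi (a *: u + v) = a * phi u + phi v) ->
  (forall v, `|phi v| <= `|v|) -> phi e = 1 ->
  hyperplane [set v | phi v = 0].
Proof.
move=> lin bnd pe.
have phi0 : phi 0 = 0.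
  by have := lin (-1) 0 0; rewrite scaler0 addr0 mulN1r addNr.
have phiB u v : phi (u - v) = phi u - phi v.
  by have := lin (-1) v u; rewrite scaleN1r mulN1r addrC => ->; rewrite addrC.
have cphi : continuous phi.
  move=> x; apply/cvgrPdist_lt => d d0.
  have : \forall y \near x, `|x - y| < d by exact: cvgr_dist_lt.
  by apply: filterS => y xy; rewrite -phiB (le_lt_trans (bnd _)).
split.
- have -> : [set v | phi v = 0] = phi @^-1` [set 0] by [].
  by apply: preimage_closed; [move=> x _; exact: cphi|exact: closed_eq].
- exact: phi0.
- by move=> a u v /= pu pv; rewrite lin pu pv mulr0 addr0.
- exists e; first by rewrite /= pe; apply/eqP; rewrite oner_eq0.
  move=> v; exists (phi v); rewrite /= phiB.
  by have := lin (phi v) e 0; rewrite !addr0 phi0 pe addr0 mulr1 => ->; rewrite subrr.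
Qed.

End hyperplane_kernel.

Section L1_functions.
Context {R : realType}.
Local Notation mu := (@lebesgue_measure R).
Let m01 : measurable (`[0%R, 1%R]%classic : set (measurableTypeR R)) := measurable_itv `[0%R, 1%R].
Local Notation nu := (mrestr mu m01).
Implicit Types (u w : R -> R) (v : L1I R).

(** A representative cut off outside [[0, 1]], where [Lrepr v] is arbitrary, so that it is Lebesgue
    integrable on the line. *)
Definition L1_fun v : R -> R := Lrepr v \_ `[0, 1]%classic.

Lemma L1_fun_integrable v : mu.-integrable setT (EFin \o L1_fun v).
Proof.
have /andP[/[!inE]/= mv fv] := Lrepr_Lfun v.
have := fv; rewrite /finite_norm Lnorm1 ge0_integral_mrestr01//; last first.
  by apply: measurableT_comp => //; exact/measurable_EFinP.
move=> fin; have : mu.-integrable `[0%R, 1%R] (EFin \o Lrepr v).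
  by apply/integrableP; split=> //; exact/measurable_EFinP/measurable_funTS.
by rewrite integrable_mkcond//= restrict_EFin.
Qed.

Lemma L1_class_ae u (iu : mu.-integrable setT (EFin \o u)) :
  {ae mu, forall x, x \in `[0, 1] -> L1_fun (L1_class iu) x = u x}.
Proof.
have := LclassE (lexx 1%E) (integrable_Lfun iu).
move=> H; have {}H : {ae nu, forall x, Lrepr (L1_class iu) x = u x}.
  by apply: filterS H => x; exact.
move/ae_mrestr01 : H; apply: filterS; first exact: (ae_filter_ringOfSetsType mu).
by move=> x + xI => /(_ xI) <-; rewrite /L1_fun patchE mem_set.
Qed.

Lemma L1_fun_scaleD (a : R) v v' : {ae mu, forall x, x \in `[0, 1] ->
  L1_fun (a *: v + v') x = a * L1_fun v x + L1_fun v' x}.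
Proof.
have H : {ae nu, forall x, Lrepr (a *: v + v') x = a * Lrepr v x + Lrepr v' x}.
  by apply: filterS2 (LspaceDE (a *: v) v') (LspaceZE a v) => x -> ->.
move/ae_mrestr01 : H; apply: filterS; first exact: (ae_filter_ringOfSetsType mu).
by move=> x + xI => /(_ xI); rewrite /L1_fun !patchE mem_set.
Qed.

Lemma Rintegral_ae (D : set R) u w : measurable (D : set (measurableTypeR R)) ->
  D `<=` `[0, 1] ->
  measurable_fun setT u -> measurable_fun setT w ->
  {ae mu, forall x, x \in `[0, 1] -> u x = w x} ->
  \int[mu]_(x in D) u x = \int[mu]_(x in D) w x.
Proof.
move=> mD DI mu_ mw uw; congr fine; apply: ae_eq_integral => //.
- exact/measurable_funTS/measurable_EFinP.
- exact/measurable_funTS/measurable_EFinP.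
- move: uw; apply: filterS; first exact: (ae_filter_ringOfSetsType mu).
  by move=> x uw /DI xI; rewrite /= uw.
Qed.

Lemma integrable_measurable u : mu.-integrable setT (EFin \o u) -> measurable_fun setT u.
Proof. by move=> /integrableP[/measurable_EFinP]. Qed.

Lemma L1_norm_fun v : `|v| = \int[mu]_(x in `]0, 1]) `|L1_fun v x|.
Proof.
rewrite L1_normE Rintegral_itv_obnd_cbnd; last first.
  exact/integrable_itv/integrable_norm/L1_fun_integrable.
by apply: eq_Rintegral => x /set_mem xI; rewrite /L1_fun patchE mem_set.
Qed.

Lemma L1_norm_classB u (iu : mu.-integrable setT (EFin \o u)) v :
  `|L1_class iu - v| = \int[mu]_(x in `]0, 1]) `|u x - L1_fun v x|.
Proof.
have iv := L1_fun_integrable.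
rewrite L1_norm_fun; apply: Rintegral_ae => //.
- by move=> x; rewrite /= !in_itv/= => /andP[/ltW -> ->].
- by apply: measurableT_comp => //; apply: integrable_measurable; exact: iv.
- apply: measurableT_comp => //; apply: measurable_funB; exact: integrable_measurable.
- have -> : L1_class iu - v = (-1) *: v + L1_class iu by rewrite scaleN1r addrC.
  have := L1_class_ae iu; have := L1_fun_scaleD (-1) v (L1_class iu); apply: filterS2.
    exact: (ae_filter_ringOfSetsType mu).
  by move=> x h1 h2 xI; rewrite h1// h2// mulN1r addrC.
Qed.

Lemma L1_norm_class_classB u w (iu : mu.-integrable setT (EFin \o u))
    (iw : mu.-integrable setT (EFin \o w)) :
  `|L1_class iu - L1_class iw| = \int[mu]_(x in `]0, 1]) `|u x - w x|.
Proof.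
have iv := L1_fun_integrable.
rewrite L1_norm_classB; apply: Rintegral_ae => //.
- by move=> x; rewrite /= !in_itv/= => /andP[/ltW -> ->].
- apply: measurableT_comp => //; apply: measurable_funB; exact: integrable_measurable.
- apply: measurableT_comp => //; apply: measurable_funB; exact: integrable_measurable.
- have := L1_class_ae iw; apply: filterS; first exact: (ae_filter_ringOfSetsType mu).
  by move=> x h xI; rewrite h.
Qed.

Definition tail_integral (s : R) v : R := \int[mu]_(x in `]s, 1]) L1_fun v x.

Lemma tail_integral_class (s : R) u (iu : mu.-integrable setT (EFin \o u)) : 0 <= s ->
  tail_integral s (L1_class iu) = \int[mu]_(x in `]s, 1]) u x.
Proof.
move=> s0; have iv := L1_fun_integrable; apply: Rintegral_ae => //.
- move=> x; rewrite /= !in_itv/= => /andP[sx ->].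
  by rewrite (le_trans s0)// ltW.
- exact: integrable_measurable.
- exact: integrable_measurable.
- exact: L1_class_ae.
Qed.

Lemma integrable_scale_indic (s t c : R) :
  mu.-integrable setT (EFin \o (fun x => c * \1_(`]s, t]%classic : set R) x)).
Proof.
have := integrableZl measurableT c (integrable_indic_itv s t false false).
by under [X in _ -> integrable _ _ X]eq_fun do rewrite /= EFinM.
Qed.

(** The transversal vector is the indicator of []s, 1]] divided by its length [1 - s]. *)
Lemma hyperplane_tail_integral (s : R) : 0 <= s -> s < 1 ->
  hyperplane [set v | tail_integral s v = 0].
Proof.
move=> s0 s1; have iv := L1_fun_integrable.
have sub : `]s, 1] `<=` (`[0, 1]%classic : set R).
  move=> x; rewrite /= !in_itv/= => /andP[sx ->].
  by rewrite (le_trans s0)// ltW.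
have ii v : mu.-integrable `]s, 1] (EFin \o L1_fun v) by exact: integrable_itv.
apply: (hyperplane_kernel (e := L1_class (integrable_scale_indic s 1 (1 - s)^-1))).
- move=> a v v'; rewrite /tail_integral.
  rewrite (@Rintegral_ae _ _ (fun x => a * L1_fun v x + L1_fun v' x))//.
  + rewrite RintegralD//; last first.
      have mI : measurable (`]s, 1]%classic : set (measurableTypeR R)) by exact: measurable_itv.
      have := integrableZl mI a (ii v).
      by under [X in _ -> integrable _ _ X]eq_fun do rewrite /= EFinM.
    by rewrite RintegralZl.
  + exact: integrable_measurable.
  + apply: measurable_funD; last exact: integrable_measurable.
    by apply: measurable_funM => //; exact: integrable_measurable.
  + exact: L1_fun_scaleD.
- move=> v; rewrite L1_norm_fun.
  rewrite (@Rintegral_itvD _ (fun x => `|L1_fun v x|) 0 s 1)//; last 2 first.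
    exact/integrable_norm.
    exact: ltW.
  apply: (le_trans (le_normr_Rintegral _ (ii v))) => //.
  by rewrite lerDr; apply: Rintegral_ge0.
- rewrite tail_integral_class//.
  rewrite (@eq_Rintegral _ _ _ mu _ (cst (1 - s)^-1)); last first.
    by move=> x xs; rewrite indicE xs mulr1.
  rewrite Rintegral_cst//= lebesgue_measure_itv/= lte_fin s1 -EFinB/=.
  by rewrite mulVf// subr_eq0 gt_eqF.
Qed.

End L1_functions.

(** * From densities to a quasi-isometry *)

Section density_quasi_isometry.
Context {R : realType} (M : curve R) (closed : bool).
Hypothesis cc : coarse_curve M closed.
Local Notation mu := (@lebesgue_measure R).
Implicit Types (u w : R -> R) (f g : Diff M).
Let D01 : `[0, 1] `<=` dom M := cc_dom cc.

Lemma tv_dist_density v v' u w : has_density v u -> has_density v' w ->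
  tv_dist v v' = \int[mu]_(x in `]0, 1]) `|u x - w x|.
Proof.
by move=> vu vw; rewrite /tv_dist (has_density_total_variation (has_densityB vu vw)).
Qed.

Lemma log_dist_density f g u w :
  has_density (log_deriv f) u -> has_density (log_deriv g) w ->
  log_dist f g = \int[mu]_(x in `]0, 1]) `|u x - w x|.
Proof. by rewrite log_distE; exact: tv_dist_density. Qed.

(** Densities are unique only almost everywhere, so the conclusion is a vanishing [L1] distance for
    every density of [log_deriv f]. *)
Lemma density_realize u : mu.-integrable setT (EFin \o u) ->
  (closed -> \int[mu]_(x in `]0, 1]) u x = 0) ->
  exists f, forall w, has_density (log_deriv f) w ->
    \int[mu]_(x in `]0, 1]) `|w x - u x| = 0.
Proof.
move=> iu u0; have pu := primitive_has_density iu.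
have p0 : primitive u 0 = 0 by rewrite /primitive set_itvoc0 Rintegral_set0.
have [|f _ fE] := cc_realize cc (has_density_abs_cont pu).
  by move=> cl; rewrite p0 /primitive u0.
by exists f => w fw; rewrite -(tv_dist_density fw pu); exact: tv_dist_eq0.
Qed.

Lemma density_exists f : exists u, has_density (log_deriv f) u.
Proof.
by have [u fu _] := abs_cont_density (log_deriv_abs_cont D01 f); exists u.
Qed.

Definition log_density f : R -> R := projT1 (cid (density_exists f)).

Lemma log_densityP f : has_density (log_deriv f) (log_density f).
Proof. by rewrite /log_density; case: cid. Qed.

Lemma log_density_integrable f : mu.-integrable setT (EFin \o log_density f).
Proof. by have [] := log_densityP f. Qed.

(** [T] carries the possible densities into the kernel of [tail_integral s], and [S] inverts it on
    the right there. For the circle both are the identity; for the interval they are the two shifts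
    of mass. *)
Variables (s : R) (T S : (R -> R) -> R -> R).
Hypothesis s0 : 0 <= s.
Hypothesis T_integrable : forall u, mu.-integrable setT (EFin \o u) ->
  mu.-integrable setT (EFin \o T u).
Hypothesis S_integrable : forall u, mu.-integrable setT (EFin \o u) ->
  mu.-integrable setT (EFin \o S u).
Hypothesis T_tail : forall u, mu.-integrable setT (EFin \o u) ->
  (closed -> \int[mu]_(x in `]0, 1]) u x = 0) -> \int[mu]_(x in `]s, 1]) T u x = 0.
Hypothesis S_closed : forall u, mu.-integrable setT (EFin \o u) ->
  \int[mu]_(x in `]s, 1]) u x = 0 -> closed -> \int[mu]_(x in `]0, 1]) S u x = 0.
Hypothesis T_lip : forall u w, mu.-integrable setT (EFin \o u) ->
  mu.-integrable setT (EFin \o w) ->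
  \int[mu]_(x in `]0, 1]) `|T u x - T w x| <= 3 * \int[mu]_(x in `]0, 1]) `|u x - w x|.
Hypothesis T_colip : forall u w, mu.-integrable setT (EFin \o u) ->
  mu.-integrable setT (EFin \o w) ->
  \int[mu]_(x in `]0, 1]) `|u x - w x| <= 3 * \int[mu]_(x in `]0, 1]) `|T u x - T w x|.
Hypothesis TS : forall u, mu.-integrable setT (EFin \o u) ->
  \int[mu]_(x in `]s, 1]) u x = 0 -> \int[mu]_(x in `]0, 1]) `|T (S u) x - u x| = 0.

(** [log_dist] is the [L1] distance of the densities, which [T] distorts by a factor at most 3. A
    vector [v] of the kernel is hit, at distance 0, by a diffeomorphism whose density is [S v]. *)
Lemma density_quasi_isometric :
  group_quasi_isometric (Diff M)
    (@norm_dist R (L1I R) [set v | tail_integral s v = 0]).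
Proof.
pose H : set (L1I R) := [set v | tail_integral s v = 0].
exists (@log_dist R M); split; first exact: (log_dist_maximal cc).
have iT f := T_integrable (log_density_integrable f).
have HT f : H (L1_class (iT f)).
  rewrite /H/= tail_integral_class//; apply: T_tail; first exact: log_density_integrable.
  move=> cl; have [_ fE] := log_densityP f.
  by rewrite -fE// (cc_closed cc f cl) subrr.
pose phi f : H := exist (fun v => v \in H) (L1_class (iT f)) (mem_set (HT f)).
exists phi, 3, 0; split; [lra|lra| |].
- move=> f g; rewrite subr0 addr0 /norm_dist /= L1_norm_class_classB.
  rewrite (log_dist_density (log_densityP f) (log_densityP g)).
  have lf := log_density_integrable f; have lg := log_density_integrable g.
  by rewrite ler_pdivrMl// T_colip// T_lip.
- move=> [v vH]; have Hv : tail_integral s v = 0 by exact: set_mem vH.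
  have iv := L1_fun_integrable v.
  have iSv := S_integrable iv.
  have [f fE] := density_realize iSv (S_closed iv Hv).
  exists f; rewrite /norm_dist /= L1_norm_classB.
  have lf := log_density_integrable f.
  have iB u w : mu.-integrable setT (EFin \o u) -> mu.-integrable setT (EFin \o w) ->
      mu.-integrable `]0, 1] (EFin \o (fun x => `|u x - w x|)).
    move=> iu iw; apply/integrable_itv/integrable_norm.
    by have := integrableB measurableT iu iw.
  have iTS := T_integrable iSv.
  apply: (@le_trans _ _ (\int[mu]_(x in `]0, 1])
      (`|T (log_density f) x - T (S (L1_fun v)) x| + `|T (S (L1_fun v)) x - L1_fun v x|))).
    apply: le_Rintegral => //.
    - exact: iB.
    - have mI : measurable (`]0, 1]%classic : set (measurableTypeR R)) by exact: measurable_itv.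
      by have := integrableD mI (iB _ _ (iT f) iTS) (iB _ _ iTS iv).
    - by move=> x _; rewrite (le_trans _ (ler_normD _ _))// subrKA.
  rewrite RintegralD//; [|exact: iB|exact: iB].
  rewrite TS// addr0 (le_trans (T_lip lf iSv))// fE ?mulr0//.
  exact: log_densityP.
Qed.

End density_quasi_isometry.

Lemma circle_group_quasi_isometric (R : realType) :
  group_quasi_isometric (Diff (circle_curve R))
    (@norm_dist R (L1I R) [set v | tail_integral 0 v = 0]).
Proof.
have ge0 (u w : R -> R) :
    0 <= \int[@lebesgue_measure R]_(x in `]0, 1]) `|u x - w x| by exact: Rintegral_ge0.
apply: (density_quasi_isometric circle_coarse_curve (T := id) (S := id)) => //.
- by move=> u _; exact.
- by move=> u w _ _; rewrite ler_peMl// ler1n.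
- by move=> u w _ _; rewrite ler_peMl// ler1n.
- move=> u _ _.
  rewrite (@eq_Rintegral _ _ _ (@lebesgue_measure R) _ (cst 0)) ?Rintegral_cst ?mul0r//.
  by move=> x _; rewrite subrr normr0.
Qed.

(** * Moving mass between dyadic shells *)

Section dyadic_shells.
Context {R : realType}.
Local Notation mu := (@lebesgue_measure R).
Implicit Types (u w : R -> R) (a b m : nat -> R) (x : R) (n k : nat).

Definition shell n : set R := `](2 ^+ n.+1)^-1, (2 ^+ n)^-1]%classic.

Lemma shellP n x : shell n x <-> (2 ^+ n.+1)^-1 < x /\ x <= (2 ^+ n)^-1.
Proof. by rewrite /shell /= in_itv/=; split=> [/andP[]|[-> ->]]. Qed.

Lemma inv_pow2_gt0 n : 0 < (2 ^+ n)^-1 :> R.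
Proof. by rewrite invr_gt0 exprn_gt0. Qed.

Lemma inv_pow2S n : (2 ^+ n)^-1 = 2 * (2 ^+ n.+1)^-1 :> R.
Proof. by rewrite exprS invfM mulrA divff// mul1r. Qed.

Lemma inv_pow2_le n k : (n <= k)%N -> (2 ^+ k)^-1 <= (2 ^+ n)^-1 :> R.
Proof. by move=> nk; rewrite lef_pV2 ?posrE ?exprn_gt0// ler_eXn2l ?ltr1n. Qed.

Lemma inv_pow2_le1 n : (2 ^+ n)^-1 <= 1 :> R.
Proof. by have := inv_pow2_le (leq0n n); rewrite expr0 invr1. Qed.

Lemma shell_exists x : 0 < x -> x <= 1 -> exists n, shell n x.
Proof.
move=> x0 x1; have ex : exists n, (2 ^+ n.+1)^-1 < x.
  exists (Num.truncn x^-1).+1; rewrite invf_plt ?posrE ?exprn_gt0//.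
  apply: (lt_le_trans (truncnS_gt _)); rewrite -natrX ler_nat.
  exact: ltnW (ltn_trans (ltnSn _) (ltn_expl _ _)).
case: (ex_minnP ex) => n nx nmin; exists n; apply/shellP; split=> //.
case: n nx nmin => [|n] nx nmin; first by rewrite expr0 invr1.
by rewrite leNgt; apply/negP => /nmin; rewrite ltnn.
Qed.

Lemma shell_inj n k x : shell n x -> shell k x -> n = k.
Proof.
wlog nk : n k / (n <= k)%N.
  by move=> H; have [/H//|/ltnW/H h ? ?] := leqP n k; apply/esym/h.
move=> /shellP[nx _] /shellP[_ xk]; apply/eqP; rewrite eqn_leq nk/= leqNgt.
by apply/negP => /inv_pow2_le; rewrite leNgt (lt_le_trans nx).
Qed.

Lemma shell_sub n : shell n `<=` `]0, 1]%classic.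
Proof.
move=> x /shellP[nx xn]; rewrite /= in_itv/= (lt_trans (inv_pow2_gt0 _) nx)/=.
exact: le_trans xn (inv_pow2_le1 n).
Qed.

Lemma bigcup_shell : \bigcup_n shell n = `]0, 1]%classic.
Proof.
apply/seteqP; split=> x; first by move=> [n _]; exact: shell_sub.
by rewrite /= in_itv/= => /andP[x0 x1]; have [n nx] := shell_exists x0 x1; exists n.
Qed.

Lemma trivIset_shell : trivIset setT shell.
Proof.
apply/trivIsetP => i j _ _ ij; apply/seteqP; split=> // x [ix jx].
by move: ij; rewrite (shell_inj ix jx) eqxx.
Qed.

Lemma measurable_shell n : measurable (shell n : set (measurableTypeR R)).
Proof. exact: measurable_itv. Qed.

Lemma lebesgue_measure_shell n : mu (shell n) = ((2 ^+ n.+1)^-1)%:E.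
Proof.
rewrite /shell (lebesgue_measure_oc (inv_pow2_le (leqnSn n))); congr EFin.
by rewrite inv_pow2S; ring.
Qed.

(* The factor makes the integral over [shell n] equal to [a n]. *)
Definition shell_step a x : R :=
  if pselect (exists n, shell n x) is left h then
    2 ^+ (projT1 (cid h)).+1 * a (projT1 (cid h)) else 0.

Lemma shell_stepE a n x : shell n x -> shell_step a x = 2 ^+ n.+1 * a n.
Proof.
rewrite /shell_step; case: pselect => [h nx|nex nx]; last by case: nex; exists n.
by case: cid => k /= kx; rewrite (shell_inj kx nx).
Qed.

Lemma shell_step_out a x : x \notin `]0, 1] -> shell_step a x = 0.
Proof.
rewrite /shell_step; case: pselect => // -[n nx] /negP[].
by have := shell_sub nx; rewrite /= in_itv.
Qed.

Lemma shell_stepB a b x :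
  shell_step a x - shell_step b x = shell_step (fun n => a n - b n) x.
Proof.
have [|xI] := boolP (x \in `]0, 1]); last by rewrite !shell_step_out// subrr.
rewrite in_itv/= => /andP[x0 x1]; have [n nx] := shell_exists x0 x1.
by rewrite !(shell_stepE _ nx) mulrBr.
Qed.

Lemma measurable_shell_step a : measurable_fun setT (shell_step a).
Proof.
have -> : shell_step a = shell_step a \_ (`]0, 1]%classic : set (measurableTypeR R)).
  apply/funext => x; rewrite patchE; case: ifPn => // xI.
  by apply: shell_step_out; apply: contra xI => xI; rewrite inE.
apply/(measurable_restrictT _ _).1 => //.
rewrite -bigcup_shell; apply/measurable_fun_bigcup => [n|n].
  exact: measurable_shell.
apply: (eq_measurable_fun (cst (2 ^+ n.+1 * a n))) => // x /set_mem nx.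
by rewrite (shell_stepE _ nx).
Qed.

Definition shell_mass u n : R := \int[mu]_(x in shell n) u x.

Lemma shell_mass_step a n : shell_mass (shell_step a) n = a n.
Proof.
rewrite /shell_mass (@eq_Rintegral _ _ _ mu _ (cst (2 ^+ n.+1 * a n))).
  rewrite Rintegral_cst; last exact: measurable_shell.
  rewrite [X in _ * fine X](lebesgue_measure_shell n)/=.
  by rewrite mulrAC divff ?mul1r// expf_eq0.
by move=> x /set_mem nx; rewrite (shell_stepE _ nx).
Qed.

(** Shell [n] contributes exactly [|a n|] to the integral, so bounded partial sums bound the whole
    series. *)
Lemma shell_step_norm a B : (forall n, \sum_(k < n) `|a k| <= B) ->
  (\int[mu]_(x in `]0%R, 1%R]) `|shell_step a x|%:E <= B%:E)%E.
Proof.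
move=> aB; rewrite -bigcup_shell ge0_integral_bigcup//; first last.
- exact: trivIset_shell.
- apply/measurable_EFinP; apply: measurable_funTS.
  by apply: measurableT_comp => //; exact: measurable_shell_step.
- by move=> n; exact: measurable_shell.
have E n : (\int[mu]_(x in shell n) `|shell_step a x|%:E = `|a n|%:E)%E.
  rewrite (eq_integral (cst (2 ^+ n.+1 * `|a n|)%:E)); last first.
    by move=> x /set_mem nx; rewrite (shell_stepE _ nx) normrM normrX normr_nat.
  rewrite integral_cst//; last exact: measurable_shell.
  rewrite [X in (_ * X)%E](lebesgue_measure_shell n) -EFinM; congr EFin.
  by rewrite mulrAC divff ?mul1r// expf_eq0.
apply: lime_le; first by apply: is_cvg_nneseries => n _ _; exact: integral_ge0.
apply: nearW => n; under eq_bigr do rewrite E.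
by rewrite sumEFin lee_fin big_mkord.
Qed.

Lemma shell_step_integrable a B : (forall n, \sum_(k < n) `|a k| <= B) ->
  mu.-integrable setT (EFin \o shell_step a).
Proof.
move=> aB; apply/integrableP; split; first by apply/measurable_EFinP; exact: measurable_shell_step.
have -> : (\int[mu]_x `|(EFin \o shell_step a) x| =
           \int[mu]_(x in `]0%R, 1%R]) `|shell_step a x|%:E)%E.
  rewrite [RHS]integral_mkcond; apply: eq_integral => x _ /=.
  rewrite patchE; case: ifPn => // xI.
  by rewrite shell_step_out ?normr0//; apply: contra xI => xI; rewrite inE.
by apply: le_lt_trans (shell_step_norm aB) (ltry _).
Qed.

(** The first [n] shells are disjoint with union [](2 ^+ n)^-1, 1]]. *)
Lemma sum_shell_mass u n : mu.-integrable setT (EFin \o u) ->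
  \sum_(k < n) `|shell_mass u k| <= \int[mu]_(x in `]0, 1]) `|u x|.
Proof.
move=> iu; have iun := integrable_norm iu.
apply: (@le_trans _ _ (\sum_(k < n) shell_mass (fun x => `|u x|) k)).
  apply: ler_sum => k _; apply: le_normr_Rintegral; first exact: measurable_shell.
  exact: integrable_itv.
have -> : \sum_(k < n) shell_mass (fun x => `|u x|) k =
    \int[mu]_(x in `](2 ^+ n)^-1, 1]) `|u x|.
  elim: n => [|n IH].
    by rewrite big_ord0 expr0 invr1 set_itvoc0 Rintegral_set0.
  rewrite big_ord_recr/= IH addrC -Rintegral_itvD//; last exact: inv_pow2_le1.
  exact: inv_pow2_le.
rewrite (@Rintegral_itvD _ (fun x => `|u x|) 0 (2 ^+ n)^-1 1 iun).
- by rewrite lerDr; apply: Rintegral_ge0.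
- exact/ltW/inv_pow2_gt0.
- exact: inv_pow2_le1.
Qed.

End dyadic_shells.

Section mass_shift.
Context {R : realType}.
Local Notation mu := (@lebesgue_measure R).
Implicit Types (u w : R -> R) (a b m : nat -> R) (x : R) (n k : nat).

(* [shift_right u] moves the mass of [u] on each shell to the next shell towards 0, leaving
   mass 0 on the first one; [shift_left u] moves it back. *)
Definition right_increment m n := (if n is k.+1 then m k else 0) - m n.
Definition left_increment m n := m n.+1 - m n.
(** Only masses move: on each shell [u] changes by a constant, so the operation is linear in [u] and
    has a pointwise inverse. *)
Definition add_increment (c : (nat -> R) -> nat -> R) u x :=
  u x + shell_step (c (shell_mass u)) x.
Definition shift_right := add_increment right_increment.
Definition shift_left := add_increment left_increment.

Lemma shell_massD u w n : mu.-integrable setT (EFin \o u) -> mu.-integrable setT (EFin \o w) ->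
  shell_mass (fun x => u x + w x) n = shell_mass u n + shell_mass w n.
Proof.
move=> iu iw; rewrite /shell_mass RintegralD//; first exact: measurable_shell.
  exact: integrable_itv.
exact: integrable_itv.
Qed.

Lemma shell_massB u w n : mu.-integrable setT (EFin \o u) -> mu.-integrable setT (EFin \o w) ->
  shell_mass (fun x => u x - w x) n = shell_mass u n - shell_mass w n.
Proof.
move=> iu iw; rewrite /shell_mass RintegralB//; first exact: measurable_shell.
  exact: integrable_itv.
exact: integrable_itv.
Qed.

Section increment.
Variable c : (nat -> R) -> nat -> R.
Hypothesis cB : forall a b n, c a n - c b n = c (fun k => a k - b k) n.
Hypothesis c_le : forall a B, (forall n, \sum_(k < n) `|a k| <= B) ->
  forall n, \sum_(k < n) `|c a k| <= 2 * B.

Lemma sum_increment u : mu.-integrable setT (EFin \o u) ->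
  forall n, \sum_(k < n) `|c (shell_mass u) k| <= 2 * \int[mu]_(x in `]0, 1]) `|u x|.
Proof. by move=> iu; apply: c_le => n; exact: sum_shell_mass. Qed.

Lemma increment_integrable u : mu.-integrable setT (EFin \o u) ->
  mu.-integrable setT (EFin \o shell_step (c (shell_mass u))).
Proof. by move=> iu; exact: shell_step_integrable (sum_increment iu). Qed.

Lemma add_increment_integrable u : mu.-integrable setT (EFin \o u) ->
  mu.-integrable setT (EFin \o add_increment c u).
Proof. by move=> iu; have := integrableD measurableT iu (increment_integrable iu). Qed.

(** By linearity the difference is the same operation applied to [u - w]: 1 for [u - w] itself and 2
    for the step function, by [c_le]. *)
Lemma add_increment_lip u w : mu.-integrable setT (EFin \o u) ->
  mu.-integrable setT (EFin \o w) ->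
  \int[mu]_(x in `]0, 1]) `|add_increment c u x - add_increment c w x| <=
  3 * \int[mu]_(x in `]0, 1]) `|u x - w x|.
Proof.
move=> iu iw.
have iB : mu.-integrable setT (EFin \o (fun x => u x - w x)).
  by have := integrableB measurableT iu iw.
have iM := increment_integrable iB.
have mE : (fun k => shell_mass u k - shell_mass w k) = shell_mass (fun x => u x - w x).
  by apply/funext => k; rewrite shell_massB.
have E x : add_increment c u x - add_increment c w x =
    (u x - w x) + shell_step (c (shell_mass (fun x => u x - w x))) x.
  rewrite /add_increment opprD addrACA shell_stepB; congr (_ + shell_step _ x).
  by apply/funext => n; rewrite cB mE.
have step_le : \int[mu]_(x in `]0, 1])
    `|shell_step (c (shell_mass (fun x => u x - w x))) x| <=
    2 * \int[mu]_(x in `]0, 1]) `|u x - w x|.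
  rewrite -lee_fin /Rintegral fineK; first exact: shell_step_norm (sum_increment iB).
  apply: integrable_fin_num => //; exact: (integrable_itv _ _ (integrable_norm iM)).
apply: (@le_trans _ _ (\int[mu]_(x in `]0, 1]) (`|u x - w x| +
    `|shell_step (c (shell_mass (fun x => u x - w x))) x|))).
  apply: le_Rintegral => //.
  - apply/integrable_itv/integrable_norm.
    by have := integrableB measurableT (add_increment_integrable iu) (add_increment_integrable iw).
  - apply: integrable_itv.
    by have := integrableD measurableT (integrable_norm iB) (integrable_norm iM).
  - by move=> x _; rewrite E ler_normD.
rewrite RintegralD//; [|exact/integrable_itv/integrable_norm..].
by rewrite (_ : 3 = 1 + 2 :> R)// mulrDl mul1r lerD2l.
Qed.

Lemma shell_mass_add_increment u n : mu.-integrable setT (EFin \o u) ->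
  shell_mass (add_increment c u) n = shell_mass u n + c (shell_mass u) n.
Proof.
by move=> iu; rewrite shell_massD ?shell_mass_step//; exact: increment_integrable.
Qed.

End increment.

Lemma right_incrementB a b n :
  right_increment a n - right_increment b n = right_increment (fun k => a k - b k) n.
Proof. by rewrite /right_increment; case: n => [|n]; ring. Qed.

Lemma left_incrementB a b n :
  left_increment a n - left_increment b n = left_increment (fun k => a k - b k) n.
Proof. by rewrite /left_increment; ring. Qed.

(** Each [a k] enters at most twice, once when it leaves its shell and once when it arrives in the
    next. *)
Lemma right_increment_le a (B : R) : (forall n, \sum_(k < n) `|a k| <= B) ->
  forall n, \sum_(k < n) `|right_increment a k| <= 2 * B.
Proof.
move=> aB n; rewrite mulr_natl mulr2n.
apply: (@le_trans _ _ (\sum_(k < n) `|if nat_of_ord k is j.+1 then a j else 0| +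
    \sum_(k < n) `|a k|)).
  by rewrite -big_split/=; apply: ler_sum => k _; exact: ler_normB.
apply: lerD => //; case: n => [|n].
  by rewrite big_ord0; have := aB 0%N; rewrite big_ord0.
by rewrite big_ord_recl normr0 add0r.
Qed.

Lemma left_increment_le a (B : R) : (forall n, \sum_(k < n) `|a k| <= B) ->
  forall n, \sum_(k < n) `|left_increment a k| <= 2 * B.
Proof.
move=> aB n; rewrite mulr_natl mulr2n.
apply: (@le_trans _ _ (\sum_(k < n) `|a k.+1| + \sum_(k < n) `|a k|)).
  by rewrite -big_split/=; apply: ler_sum => k _; exact: ler_normB.
apply: lerD => //; apply: le_trans (aB n.+1).
by rewrite big_ord_recl lerDr.
Qed.

Lemma shell_mass_shift_right u n : mu.-integrable setT (EFin \o u) ->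
  shell_mass (shift_right u) n = if n is k.+1 then shell_mass u k else 0.
Proof.
move=> iu; rewrite (shell_mass_add_increment right_increment_le)//.
by rewrite /right_increment subrKC.
Qed.

Lemma shell_mass_shift_left u n : mu.-integrable setT (EFin \o u) ->
  shell_mass (shift_left u) n = shell_mass u n.+1.
Proof.
move=> iu; rewrite (shell_mass_add_increment left_increment_le)//.
by rewrite /left_increment subrKC.
Qed.

Lemma shift_rightK u x : mu.-integrable setT (EFin \o u) -> x \in `]0, 1] ->
  shift_left (shift_right u) x = u x.
Proof.
move=> iu; rewrite in_itv/= => /andP[x0 x1]; have [n nx] := shell_exists x0 x1.
rewrite /shift_left {1}/add_increment {1}/shift_right {1}/add_increment.
rewrite !(shell_stepE _ nx) /left_increment !shell_mass_shift_right//.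
by rewrite /right_increment; case: n {nx} => [|n]; ring.
Qed.

(** [shift_left] discards the mass of shell 0, so the hypothesis that this mass is 0 is what makes
    the operation reversible. *)
Lemma shift_leftK u x : mu.-integrable setT (EFin \o u) -> shell_mass u 0 = 0 ->
  x \in `]0, 1] -> shift_right (shift_left u) x = u x.
Proof.
move=> iu u0; rewrite in_itv/= => /andP[x0 x1]; have [n nx] := shell_exists x0 x1.
rewrite /shift_right {1}/add_increment {1}/shift_left {1}/add_increment.
rewrite !(shell_stepE _ nx) /right_increment; case: n {nx} => [|n].
  by rewrite !shell_mass_shift_left// /left_increment u0; ring.
by rewrite !shell_mass_shift_left// /left_increment; ring.
Qed.

End mass_shift.

Lemma interval_group_quasi_isometric (R : realType) :
  group_quasi_isometric (Diff (interval_curve R))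
    (@norm_dist R (L1I R) [set v | tail_integral 2^-1 v = 0]).
Proof.
have half : (`]2^-1, 1]%classic : set R) = shell 0 by rewrite /shell expr1 expr0 invr1.
have iR u := @add_increment_integrable R _ right_increment_le u.
have iL u := @add_increment_integrable R _ left_increment_le u.
apply: (density_quasi_isometric interval_coarse_curve
  (T := shift_right) (S := shift_left)) => //.
- by move=> u iu _; rewrite half -/(shell_mass _ 0) shell_mass_shift_right.
- by move=> u w; apply: add_increment_lip; [exact: right_incrementB|exact: right_increment_le].
- move=> u w iu iw.
  (* The lower bound for [shift_right] is the Lipschitz bound for its left inverse [shift_left]. *)
  apply: le_trans (add_increment_lip left_incrementB left_increment_le (iR _ iu) (iR _ iw)).
  rewrite le_eqVlt; apply/orP; left; apply/eqP; apply: eq_Rintegral => x /set_mem xI.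
  by rewrite -/(shift_left _ _) -/(shift_left _ _) !shift_rightK.
- move=> u iu; rewrite half => u0.
  rewrite (@eq_Rintegral _ _ _ (@lebesgue_measure R) _ (cst 0)) ?Rintegral_cst ?mul0r//.
  by move=> x /set_mem xI; rewrite shift_leftK// subrr normr0.
Qed.


Theorem theorem1p7 (R : realType) :
  (exists2 H : set (L1I R), hyperplane H &
     group_quasi_isometric (Diff (circle_curve R)) (@norm_dist R (L1I R) H)) /\
  (exists2 H : set (L1I R), hyperplane H &
     group_quasi_isometric (Diff (interval_curve R)) (@norm_dist R (L1I R) H)).

Proof.
split; [exists [set v | tail_integral 0 v = 0] | exists [set v | tail_integral 2^-1 v = 0]].
- exact: hyperplane_tail_integral.
- exact: circle_group_quasi_isometric.
- by apply: hyperplane_tail_integral; rewrite ?invr_ge0// invf_lt1// ltr1n.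
- exact: interval_group_quasi_isometric.
Qed.
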